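(* Let $k$ be an arbitrary field, $n\le m$, $R=k[x_{ij}\mid 1\le i\le n,\ 1\le j\le m]$, $M=(x_{ij})$ the $n\times m$ matrix of variables, and $<$ an arbitrary term order on $R$. Let $\Delta$ be an $(n-1)$-dimensional pure simplicial complex on $[m]$ such that $|\sigma\cap\tau|<n-1$ for all distinct facets $\sigma,\tau$ of $\Delta^\vee$. Then: (1) $(\operatorname{rain}_<(J_\Delta))^\vee$ is the polarization of an Artinian monomial ideal if and only if $\operatorname{grade}(\operatorname{rain}_<(J_\Delta):g)=m-n$ for all $g\in G(\operatorname{rain}_<(J_{\Delta^\vee}))$; and (2) in the situation of (1), $(\operatorname{rain}_<(J_\Delta))^\vee$ is a polarization of a power of the graded maximal ideal if and only if $|\Delta^\vee|=0$ (that is, $\Delta^\vee$ has no facets, equivalently $\operatorname{rain}_<(J_\Delta)=\operatorname{in}_<I_n(M)$).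
   Context: For an $n$-subset $\mathbf a\subseteq[m]$, $[\mathbf a]$ is the maximal minor of $M$ on the columns $\mathbf a$; $I_n(M)$ is the ideal generated by all of these. For a pure complex $\Gamma$ with facets of size $n$, $\operatorname{rain}_<(J_\Gamma)$ is the monomial ideal generated by the lead monomials $\operatorname{in}_<([\mathbf a])$, $\mathbf a$ a facet of $\Gamma$. $\Delta^\vee$ is the pure simplicial complex whose facets are exactly the $n$-subsets of $[m]$ that are not facets of $\Delta$. $G(\cdot)$ is the minimal monomial generating set; $\operatorname{grade}$ of an ideal is the length of a maximal regular sequence in it. Alexander dual of an ideal: for a (squarefree) monomial ideal $I$, $I^\vee$ is the ideal generated by all monomials having a nontrivial common divisor with every generator of $I$. Polarization: let $I\subseteq S=k[x_1,\dots,x_n]$ be an Artinian monomial ideal with $x_i^{m_i}$ a minimal generator for each $i$, and $\tilde S=k[x_{ij}\mid1\le i\le n,1\le j\le m_i]$. An ideal $\tilde I\subseteq\tilde S$ is a polarization of $I$ if the sequence of variable differences $\sigma=\{x_{i1}-x_{ij}\mid1\le i\le n,\ 2\le j\le m_i\}$ is regular on $\tilde S/\tilde I$ and $\tilde I\otimes\tilde S/\sigma\cong I$ (identifying $\tilde S/\sigma$ with $S$ via $x_{ij}\mapsto x_i$). Here the ambient ring of $(\operatorname{rain}_<(J_\Delta))^\vee$ is taken to be the polynomial ring in those variables $x_{ij}$ that divide some generator of $\operatorname{rain}_<(J_\Delta)$; the $i$-th block consists of such variables in row $i$ (relabelled $x_{i1},\dots,x_{im_i}$). The graded maximal ideal in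 (2) is $(x_1,\dots,x_n)\subseteq S$. *)

(* Defs.v *)
From mathcomp Require Export all_boot all_order all_algebra.
From mathcomp Require Export mpoly.

Set Implicit Arguments.
Unset Strict Implicit.
Unset Printing Implicit Defensive.

Import GRing.Theory.
Local Open Scope ring_scope.

(* Ideals are Prop-valued predicates, compared extensionally with eq_ideal. *)

Section Ideals.
Variable R : comNzRingType.
Implicit Types (S I J : R -> Prop) (s : seq R) (f g : R).

Definition is_ideal I : Prop :=
  [/\ I 0, (forall f g, I f -> I g -> I (f + g))
    & (forall a f, I f -> I (a * f))].

Definition sub_ideal I J : Prop := forall f, I f -> J f.

Definition eq_ideal I J : Prop := forall f, I f <-> J f.

Definition ideal_gen S : R -> Prop := fun f =>
  exists s : seq (R * R),
    (forall x, x \in s -> S x.2) /\ f = \sum_(x <- s) x.1 * x.2.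

Definition zero_ideal : R -> Prop := fun f => f = 0.

Definition ideal_adjoin I s : R -> Prop :=
  ideal_gen (fun f => I f \/ f \in s).

Definition ideal_mul I J : R -> Prop :=
  ideal_gen (fun f => exists a b, [/\ I a, J b & f = a * b]).

Definition ideal_pow I (t : nat) : R -> Prop :=
  ideal_gen (fun f => exists a : 'I_t -> R,
    (forall i, I (a i)) /\ f = \prod_(i < t) a i).

Definition colon I g : R -> Prop := fun f => I (f * g).

(* s is a regular sequence on R / I, including R / (I + (s)) != 0. *)
Definition regular_on I s : Prop :=
  (forall j f, (j < size s)%N ->
     ideal_adjoin I (take j s) (s`_j * f) -> ideal_adjoin I (take j s) f)
  /\ ~ ideal_adjoin I s 1.

(* The greatest length of an R-regular sequence contained in I is r. *)
Definition has_grade I (r : nat) : Prop :=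
  (exists s, [/\ regular_on zero_ideal s, (forall f, f \in s -> I f)
               & size s = r])
  /\ (forall s, regular_on zero_ideal s -> (forall f, f \in s -> I f) ->
        (size s <= r)%N).

(* R / I is an Artinian ring: the ideals containing I satisfy the
   descending chain condition. *)
Definition artinian_quotient I : Prop :=
  forall J : nat -> R -> Prop,
    (forall t, is_ideal (J t)) ->
    (forall t, sub_ideal I (J t)) ->
    (forall t, sub_ideal (J t.+1) (J t)) ->
    exists t0, forall t, (t0 <= t)%N -> eq_ideal (J t) (J t0).

End Ideals.

Section MonomialIdeals.
Variables (k : fieldType) (N : nat).
Implicit Types (A : 'X_{1..N} -> Prop) (I : {mpoly k[N]} -> Prop).
Implicit Types (p q d : 'X_{1..N}) (le : rel 'X_{1..N}).

Definition mono_ideal A : {mpoly k[N]} -> Prop :=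
  ideal_gen (fun f => exists2 p, A p & f = 'X_[p]).

Definition is_monomial_ideal I : Prop := exists A, eq_ideal I (mono_ideal A).

(* The set G(I), for a monomial ideal I: the exponents of the monomials of I
   that are minimal for divisibility. *)
Definition min_gens I : 'X_{1..N} -> Prop := fun p =>
  I 'X_[p] /\ forall q, I 'X_[q] -> (q <= p)%MM -> q = p.

Definition alexander_dual I : {mpoly k[N]} -> Prop :=
  mono_ideal (fun p => forall q, min_gens I q ->
    exists d, [/\ d != 0%MM, (d <= p)%MM & (d <= q)%MM]).

Definition maximal_ideal : {mpoly k[N]} -> Prop :=
  ideal_gen (fun f => exists i : 'I_N, f = 'X_i).

(* le is the reflexive form of the order. *)
Definition term_order le : Prop :=
  [/\ antisymmetric le, transitive le, total le, (forall p, le 0%MM p)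
    & (forall p q d, le p q -> le (p + d)%MM (q + d)%MM)].

(* The exponent of the lead monomial of f; for f = 0 it is the junk value 0. *)
Definition in_mon le (f : {mpoly k[N]}) : 'X_{1..N} :=
  \big[(fun p q => if le p q then q else p)/0%MM]_(p <- msupp f) p.

Definition in_ideal le I : {mpoly k[N]} -> Prop :=
  mono_ideal (fun p => exists f, [/\ I f, f != 0 & p = in_mon le f]).

End MonomialIdeals.

Arguments maximal_ideal k N : clear implicits.

(* For T : finType, the polynomial ring on variables indexed by T is
   {mpoly k[#|T|]}, the variable of t being 'X_(enum_rank t). *)

Section Polarization.
Variables (k : fieldType) (n : nat) (m_ : 'I_n -> nat).

Definition pol_idx : finType := {i : 'I_n & 'I_(m_ i)}.

Definition pol_var (i : 'I_n) (j : 'I_(m_ i)) : {mpoly k[#|pol_idx|]} :=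
  'X_(enum_rank (Tagged (fun i => 'I_(m_ i)) j : pol_idx)).

Definition block_vars (i : 'I_n) : seq {mpoly k[#|pol_idx|]} :=
  [seq pol_var j | j <- enum 'I_(m_ i)].

(* x_{i1} - x_{ij} for 2 <= j <= m_i, row by row. *)
Definition pol_diffs : seq {mpoly k[#|pol_idx|]} :=
  flatten [seq [seq head 0 (block_vars i) - y | y <- behead (block_vars i)]
          | i <- enum 'I_n].

(* x_{ij} |-> x_i, which identifies S~/sigma with S. *)
Definition depolarize (f : {mpoly k[#|pol_idx|]}) : {mpoly k[n]} :=
  f \mPo [tuple 'X_(tag (enum_val u)) | u < #|pol_idx|].

(* I~ (x) S~/sigma = I~ / sigma I~; the last three conditions say that
   depolarize induces a bijection from it onto I. *)
Definition is_polarization (I : {mpoly k[n]} -> Prop)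
    (It : {mpoly k[#|pol_idx|]} -> Prop) : Prop :=
  [/\ [/\ is_monomial_ideal I, artinian_quotient I
        & forall i, min_gens I (U_(i) *+ m_ i)%MM],
      regular_on It pol_diffs,
      (forall f, It f -> I (depolarize f)),
      (forall g, I g -> exists2 f, It f & depolarize f = g)
    & (forall f, It f -> depolarize f = 0 ->
         ideal_mul (ideal_gen (fun g => g \in pol_diffs)) It f)].

Definition is_artinian_polarization It : Prop :=
  exists I, is_polarization I It.

Definition is_power_polarization It : Prop :=
  exists t, is_polarization (ideal_pow (maximal_ideal k n) t) It.

End Polarization.

Section Complexes.
Variable m : nat.
Implicit Types D : {set {set 'I_m}}.

(* "On [m]" means that [m] is the vertex set. *)
Definition simplicial_complex D : Prop :=
  (forall F G : {set 'I_m}, F \in D -> G \subset F -> G \in D)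
  /\ (forall v : 'I_m, [set v] \in D).

Definition facets D : {set {set 'I_m}} :=
  [set F | maxset (fun G => G \in D) F].

(* Pure of dimension n - 1. *)
Definition pure_with (n : nat) D : Prop :=
  facets D != set0 /\ forall F, F \in facets D -> #|F| = n.

Definition dual_complex (n : nat) D : {set {set 'I_m}} :=
  [set G : {set 'I_m} | [exists F : {set 'I_m},
     [&& #|F| == n, F \notin facets D & G \subset F]]].

End Complexes.

Section Rainbow.
Variables (k : fieldType) (n m : nat).

Definition vars : finType := ('I_n * 'I_m)%type.

Definition gen_matrix : 'M[{mpoly k[#|vars|]}]_(n, m) :=
  \matrix_(i < n, c < m) 'X_(enum_rank ((i, c) : vars)).

(* Column j of the minor is the j-th smallest column in a; only used when
   #|a| = n, where nth is in range. *)
Definition max_minor (a : {set 'I_m}) : {mpoly k[#|vars|]} :=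
  \det (\matrix_(i < n, j < n) nth 0 [seq gen_matrix i c | c <- enum a] j).

Definition minors_ideal : {mpoly k[#|vars|]} -> Prop :=
  ideal_gen (fun f => exists a : {set 'I_m}, #|a| = n /\ f = max_minor a).

Variable le : rel 'X_{1..#|vars|}.
Implicit Types D : {set {set 'I_m}}.

Definition rain D : {mpoly k[#|vars|]} -> Prop :=
  mono_ideal (fun p =>
    exists2 a : {set 'I_m}, a \in facets D & p = in_mon le (max_minor a)).

(* Columns c such that x_{ic} divides some generator of rain D. *)
Definition row_support D (i : 'I_n) : {set 'I_m} :=
  [set c | [exists a in facets D,
     (0 < in_mon le (max_minor a) (enum_rank ((i, c) : vars)))%N]].

Definition row_size D (i : 'I_n) : nat := #|row_support D i|.

(* Relabelling: the variable (i, j) of the small ring is x_{ic}, where c is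
   the j-th element of row_support D i. *)
Definition small_to_var D (u : pol_idx (row_size D)) : vars :=
  (tag u, enum_val (tagged u)).

Definition restrict_mon D (p : 'X_{1..#|vars|}) :
    'X_{1..#|pol_idx (row_size D)|} :=
  [multinom p (enum_rank (small_to_var (enum_val u)))
     | u < #|pol_idx (row_size D)|].

(* rain D, as an ideal of the polynomial ring in the variables x_{ij} that
   divide some generator. *)
Definition rain_small D : {mpoly k[#|pol_idx (row_size D)|]} -> Prop :=
  mono_ideal (fun q => exists2 a, a \in facets D
    & q = restrict_mon D (in_mon le (max_minor a))).

Definition rain_dual D : {mpoly k[#|pol_idx (row_size D)|]} -> Prop :=
  alexander_dual (@rain_small D).

End Rainbow.

Arguments minors_ideal k n m : clear implicits.
Arguments rain k {n m} le D.
Arguments rain_small k {n m} le D.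
Arguments rain_dual k {n m} le D.

(* Main.v *)
From HB Require Import structures.
From mathcomp Require Import perm.
From Stdlib Require Import Classical_Prop.
From Stdlib Require Import FunctionalExtensionality PropExtensionality.
Require Import Defs.

Set Implicit Arguments.
Unset Strict Implicit.
Unset Printing Implicit Defensive.

(* Let M_a be the matching of the rows with the columns of an n-set a whose
   monomial is in_<[a].  For n + 1 columns, replacing one column of a matching
   by the omitted one shows that the matchings are linked by a tree whose edges
   are labelled by the rows.  From these trees, for every (n-1)-set U, the cells
   X_U = {(l, c) : c not in U, M_(U + c) l = c} meet all matchings, and
   U |-> (number of cells of X_U in each row) is a bijection onto the vectors of
   sum m - n + 1.

   Polarizations.  Modulo P_b = (x_(i, b i) : i) the variable x_(i, j) becomes the
   difference x_(i, j) - x_(i, b i), so the quotient by an intersection of r such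
   primes embeds in A^r, A the ring generated by the differences of variables of
   a row.  If the depolarized ideal has at most r standard monomials, these form
   an A-basis of the quotient, and the differences are a regular sequence.  For
   the dual of rain(J_D) the standard monomials are counted with the X_U and, for
   each non-facet a, the cells E_a = {(l, c) : c not in a, M_a with l |-> c optimal},
   the only cover of size at most m - n that misses M_a.  Now rain(J_D) : in[a] is
   generated by the variables of E_a, so its grade is |E_a| >= m - n, and equality
   for all a is exactly what the count needs.

   Groebner basis.  Substituting in I_n(M) a generic matrix with columns orthogonal
   to the cofactors of the columns of U shows that in(f) meets every X_U; the
   freeness argument, for D the full complex, shows that every cover contains some
   X_U, so in(f) is divisible by some in[a]. *)

(** * Optimal matchings and linkage *)

(** The separation hypothesis on the dual complex acts twice. Exchanging one column of a non-facet a
    gives a set sharing n - 1 columns with a, hence a facet; so E_a is a minimal cover and lives in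
    the small ring. And as row degrees of X_U determine U, non-facets whose E have equal or adjacent
    row degrees would share n - 1 columns; so these degrees are distinct. The constants are
    binomial. There are C(m, n-1) sets U and as many vectors of sum m - n + 1 in n rows, so only
    injectivity needs an argument: X_U, completed on the columns of U, is the unique optimum of a
    transportation problem with prescribed row degrees. There are C(m, n) vectors of sum at most m -
    n; removing the degree of E_a for each non-facet leaves the number of facets, provided that each
    E_a has exactly m - n cells. For (2), a non-facet puts a monomial of degree m - n into the
    ideal; if the ideal is a power, moving one unit between two rows of its degree reaches a second
    non-facet too close to the first. This takes two rows; for n = 1 there are no non-facets, since
    all vertices belong to the complex. *)

Section TermOrder.
Variables (N : nat) (le : rel 'X_{1..N}).
Hypothesis hle : term_order le.

Lemma to_refl p : le p p.
Proof. by case: hle => _ _ tot _ _; have := tot p p; rewrite orbb. Qed.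

Lemma to_anti p q : le p q -> le q p -> p = q.
Proof. by case: hle => anti _ _ _ _ h1 h2; apply: anti; rewrite h1 h2. Qed.

Lemma to_trans q p r : le p q -> le q r -> le p r.
Proof. by case: hle => _ tr _ _ _; apply: tr. Qed.

Lemma to_total p q : le p q || le q p.
Proof. by case: hle. Qed.

Lemma to_add2r d p q : le (p + d)%MM (q + d)%MM = le p q.
Proof.
case: hle => _ _ _ _ add; apply/idP/idP => [h|]; last exact: add.
case/orP: (to_total p q) => // /(add _ _ d) /(to_anti h) /addIm ->.
exact: to_refl.
Qed.

Lemma to_add2l d p q : le (d + p)%MM (d + q)%MM = le p q.
Proof. by rewrite ![(d + _)%MM]addmC to_add2r. Qed.

Lemma to_add p q p' q' : le p q -> le p' q' -> le (p + p')%MM (q + q')%MM.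
Proof.
move=> h h'; apply: (@to_trans (q + p')%MM); first by rewrite to_add2r.
by rewrite to_add2l.
Qed.

Lemma to_sum (I : finType) (F G : I -> 'X_{1..N}) :
  (forall i, le (F i) (G i)) -> le (\sum_i F i)%MM (\sum_i G i)%MM.
Proof.
move=> h; apply: (big_ind2 (fun p q => le p q)) => //; first exact: to_refl.
exact: (fun _ _ _ _ => @to_add _ _ _ _).
Qed.

Lemma to_argmax (T : finType) (P : pred T) (F : T -> 'X_{1..N}) x0 :
  P x0 -> exists2 x, P x & forall y, P y -> le (F y) (F x).
Proof.
move=> Px0.
suff: forall s : seq T, has P s ->
    exists2 x, P x & forall y, y \in s -> P y -> le (F y) (F x).
  case/(_ (enum T)); first by apply/hasP; exists x0; rewrite ?mem_enum.
  by move=> x Px h; exists x => // y; apply: h; rewrite mem_enum.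
elim=> [//|z s IH] /=; case: (boolP (has P s)) => [/IH [x Px hx] _|hs].
  case: (boolP (P z && le (F x) (F z))) => [/andP[Pz hz]|hz].
    exists z => // y; rewrite inE => /orP[/eqP->|ys Py]; first by rewrite to_refl.
    exact: to_trans (hx _ ys Py) hz.
  exists x => // y; rewrite inE => /orP[/eqP-> Pz|ys Py]; last exact: hx.
  by move: hz; rewrite Pz /=; case/orP: (to_total (F x) (F z)) => ->.
rewrite orbF => Pz; exists z => // y; rewrite inE => /orP[/eqP->|ys Py].
  by rewrite to_refl.
by case/hasP: hs; exists y.
Qed.

End TermOrder.

Section OptimalMatching.
Variables (L V : finType) (N : nat) (wt : L -> V -> 'X_{1..N}).
Variable le : rel 'X_{1..N}.
Hypothesis hle : term_order le.

(** Labels and vertices stay abstract because the theory serves twice: with rows matched to columns,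
    and, for the cofactors of the columns [U], with columns matched to rows. *)
Definition weight (g : {ffun L -> V}) : 'X_{1..N} := (\sum_l wt l (g l))%MM.

Hypothesis weight_inj : injective weight.

Definition matching (S : {set V}) (g : {ffun L -> V}) : Prop :=
  injective g /\ forall l, g l \in S.

Definition optimal S g : Prop :=
  matching S g /\ forall h, matching S h -> le (weight h) (weight g).

Lemma optimal_ex (S : {set V}) : #|S| = #|L| -> exists g, optimal S g.
Proof.
move=> cS; pose P (g : {ffun L -> V}) := injectiveb g && [forall l, g l \in S].
have PP g : reflect (matching S g) (P g).
  apply: (iffP andP) => [[/injectiveP gi /forallP gS]|[gi gS]]; split=> //.
    exact/injectiveP.
  exact/forallP.
have [g0 Pg0] : exists g0, P g0.
  pose f l : V := enum_val (cast_ord (esym cS) (enum_rank l)).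
  exists [ffun l => f l]; apply/PP; split=> [x y|l].
    by rewrite !ffunE => /enum_val_inj/cast_ord_inj/enum_rank_inj.
  by rewrite ffunE; apply: enum_valP.
have [g Pg hg] := to_argmax hle weight Pg0.
by exists g; split=> [|h mh]; [apply/PP | apply/hg/PP].
Qed.

Lemma matching_surj (S : {set V}) g x : #|S| = #|L| -> matching S g ->
  x \in S -> exists l, g l = x.
Proof.
move=> cS [gi gS] xS.
have: [set g l | l : L] == S.
  rewrite eqEcard card_imset // cS leqnn andbT.
  by apply/subsetP=> _ /imsetP[l _ ->].
by move/eqP=> eS; move: xS; rewrite -eS => /imsetP[l _ ->]; exists l.
Qed.

Lemma weight_swap (g h : {ffun L -> V}) l :
  (forall l', l' != l -> g l' = h l') ->
  (wt l (h l) + weight g = wt l (g l) + weight h)%MM.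
Proof.
move=> e; rewrite /weight (bigD1 l) //= [in RHS](bigD1 l) //= !addmA.
by rewrite [(wt l (h l) + _)%MM]addmC; congr (_ + _)%MM; apply: eq_bigr => i /e ->.
Qed.

Variable M : {set V} -> {ffun L -> V}.
Hypothesis M_opt : forall S : {set V}, #|S| = #|L| -> optimal S (M S).

(* The maximiser p of x |-> wt l x + weight (M (tau \ x)) is exchanged with
   q = M (tau \ p) l: the swapped matching attains the maximum as well. *)
Lemma edge_ex (tau : {set V}) l : #|tau| = #|L|.+1 -> exists p q,
  [/\ [/\ p \in tau, q \in tau & p != q],
      M (tau :\ p) l = q, M (tau :\ q) l = p,
      (forall l', l' != l -> M (tau :\ p) l' = M (tau :\ q) l') &
      forall x, x \in tau -> le (wt l x + weight (M (tau :\ x)))%MM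
                                (wt l p + weight (M (tau :\ p)))%MM].
Proof.
move=> ct; have cD x : x \in tau -> #|tau :\ x| = #|L|.
  by move=> xt; apply/eqP; rewrite -eqSS -ct (cardsD1 x tau) xt.
have [x0 x0t] : exists x, x \in tau by apply/set0Pn; rewrite -card_gt0 ct.
have [p pt hp] := to_argmax hle (fun x => wt l x + weight (M (tau :\ x)))%MM x0t.
pose q := M (tau :\ p) l; have [[Mi MS] _] := M_opt (cD _ pt).
have /[!inE] /andP[qp qt] := MS l.
pose g := [ffun l' => if l' == l then p else M (tau :\ p) l'].
have gne l' : l' != l -> g l' = M (tau :\ p) l' by rewrite ffunE => /negbTE->.
have gl : g l = p by rewrite ffunE eqxx.
have mg : matching (tau :\ q) g.
  have np l' : p != M (tau :\ p) l'.
    by have /[!inE] /andP[] := MS l'; rewrite eq_sym.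
  split=> [a b|l'].
    case: (eqVneq a l) => [->|na]; case: (eqVneq b l) => [->|nb] //.
    - by rewrite gl (gne _ nb) => /eqP; rewrite (negbTE (np b)).
    - by rewrite gl (gne _ na) => /esym/eqP; rewrite (negbTE (np a)).
    - by rewrite !gne //; apply: Mi.
  case: (eqVneq l' l) => [->|nl]; first by rewrite gl !inE eq_sym qp.
  rewrite gne // !inE (inj_eq Mi) nl /=.
  by have /[!inE] /andP[] := MS l'.
have ew : (wt l q + weight g = wt l p + weight (M (tau :\ p)))%MM.
  by rewrite (weight_swap gne) gl.
have [mq oq] := M_opt (cD _ qt).
have eg : g = M (tau :\ q).
  apply: weight_inj; apply: (to_anti hle); first exact: oq.
  by rewrite -(to_add2l hle (wt l q)) ew; apply: hp.
exists p, q; split=> //; first by rewrite eq_sym.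
  by rewrite -eg.
by move=> l' nl; rewrite -eg gne.
Qed.

End OptimalMatching.

Lemma connect_ind (T : finType) (e : rel T) (P : T -> Prop) x y :
  connect e x y -> P x ->
  (forall a b, connect e x a -> e a b -> P a -> P b) -> P y.
Proof.
move=> /connectP[s es ->{y}] Px step; elim/last_ind: s es => // s z IH.
rewrite rcons_path last_rcons => /andP[es ez]; apply: step ez (IH es).
by apply/connectP; exists s.
Qed.

(* F x matches the labels with the vertices other than x; moving x along the
   edge {p l, q l} only changes the value at l.  The edges then form a tree. *)
Section Linkage.
Variables (L V : finType) (tau : {set V}) (F : V -> L -> V) (p q : L -> V).
Hypothesis card_tau : #|tau| = #|L|.+1.
Hypothesis F_inj : forall x, x \in tau -> injective (F x).
Hypothesis F_in : forall x l, x \in tau -> F x l \in tau :\ x.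
Hypothesis p_in : forall l, p l \in tau.
Hypothesis q_in : forall l, q l \in tau.
Hypothesis Fp : forall l, F (p l) l = q l.
Hypothesis Fq : forall l, F (q l) l = p l.
Hypothesis Fpq : forall l l', l' != l -> F (p l) l' = F (q l) l'.

Definition link (x y : V) : bool :=
  [exists l, ((x == p l) && (y == q l)) || ((x == q l) && (y == p l))].

Lemma link_sym : ssrbool.symmetric link.
Proof.
by move=> x y; apply: eq_existsb => l; rewrite orbC; congr (_ || _); rewrite andbC.
Qed.

Lemma linkP x y : link x y -> exists l, [/\ x \in tau /\ y \in tau, F x l = y,
  F y l = x, (forall l', l' != l -> F x l' = F y l') &
  (x = p l /\ y = q l) \/ (x = q l /\ y = p l)].
Proof.
case/existsP=> l /orP[] /andP[/eqP-> /eqP->]; exists l; split=> //.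
- exact: Fpq.
- by left.
- by move=> l' /Fpq ->.
- by right.
Qed.

Let lsym : connect_sym link := sym_connect_sym link_sym.

Lemma link_in x y : connect link x y -> x \in tau -> y \in tau.
Proof.
move=> c xt; apply: (connect_ind (P := fun x => x \in tau)) c xt _.
by move=> a b _ /linkP[l [[]]].
Qed.

(** An edge with a label other than [l] leaves the value at [l] unchanged, and across an edge
    labelled [l] the value is the other end; either way it stays in the component of [p l]. *)
Lemma link_label l x : connect link (p l) x -> connect link (p l) (F x l).
Proof.
have pq : link (p l) (q l) by apply/existsP; exists l; rewrite !eqxx.
move=> c; apply: (connect_ind (P := fun x => connect link (p l) (F x l))) c _ _.
  by rewrite Fp connect1.
move=> a b ca /linkP[l' [_ Fa Fb Fab _]].
by case: (eqVneq l l') => [e|/Fab <- //]; subst l'; rewrite Fb.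
Qed.

(** With two components there would be too little room: for each label [l], evaluate at the root
    [rho l] of the component of [p l]. The values [phi l] are pairwise distinct and never roots, so
    the labels inject into [tau] minus two roots, which has only [#|L| - 1] elements. *)
Lemma link_connected x y : x \in tau -> y \in tau -> connect link x y.
Proof.
move=> xt yt; apply: contraT => nxy.
pose rho l := fingraph.root link (p l); pose phi l := F (rho l) l.
have cr l : connect link (p l) (rho l) by apply: connect_root.
have rt l : rho l \in tau by apply: link_in (cr l) (p_in l).
have rphi l : fingraph.root link (phi l) = rho l.
  by apply/esym/eqP; rewrite (root_connect lsym); apply: link_label (cr l).
have phi_inj : injective phi.
  by move=> l l' e; move: (e); rewrite /phi -!rphi e; apply: F_inj; rewrite rphi.
have rx z : z \in tau -> fingraph.root link z \in tau.
  by apply: link_in; apply: connect_root.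
have phin z l : phi l != fingraph.root link z.
  apply/eqP => e; have := F_in l (rt l); rewrite -/(phi l) !inE -(rphi l) e.
  by rewrite (root_root lsym) eqxx.
have : [set phi l | l : L] \subset tau :\ fingraph.root link x :\ fingraph.root link y.
  apply/subsetP=> _ /imsetP[l _ ->]; rewrite !inE !phin /=.
  by have := F_in l (rt l); rewrite !inE => /andP[].
move/subset_leq_card; rewrite card_imset //.
have := card_tau; rewrite (cardsD1 (fingraph.root link x)) rx //.
rewrite (cardsD1 (fingraph.root link y) (tau :\ _)) !inE rx // andbT eq_sym.
by rewrite (root_connect lsym) nxy /= !add1n => -[<-]; rewrite ltnn.
Qed.

Lemma link_value x l : x \in tau -> F x l = p l \/ F x l = q l.
Proof.
move=> xt; have c := link_connected (p_in l) xt.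
apply: (connect_ind (P := fun x => F x l = p l \/ F x l = q l)) c _ _.
  by right.
move=> a b _ /linkP[l' [_ Fa Fb Fab h]].
case: (eqVneq l l') => [e|/Fab <- //]; subst l'; rewrite Fb.
by case: h => -[-> _]; [left | right].
Qed.

(* Walk from j to the nearest vertex of C: each step only affects the labels
   of the two vertices it joins. *)
Lemma link_towards (j : V) (C : {set V}) : j \in tau -> C \subset tau ->
  j \notin C -> C != set0 -> exists2 c, c \in C &
  forall l y, y \in C -> y != c -> (F c l == y) = (F j l == y).
Proof.
move=> jt Ct jC /set0Pn[z zC].
pose e x y := (x \notin C) && link x y.
have inv x : connect e j x ->
    forall l y, y \in C -> y != x -> (F x l == y) = (F j l == y).
  move=> c; apply: (connect_ind (P := fun x => forall l y, y \in C -> y != x ->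
    (F x l == y) = (F j l == y)) ) c _ _ => // a b _ /andP[aC lab] IH l y yC yb.
  have ya : y != a by apply: contraNneq aC => <-.
  rewrite -IH //; case/linkP: lab => l' [_ Fa Fb Fab _].
  case: (eqVneq l l') => [->|/Fab -> //].
  by rewrite Fa Fb eq_sym (negbTE ya) eq_sym (negbTE yb).
case: (boolP [exists c in C, connect e j c]) => [/exists_inP[c cC /inv h]|h].
  by exists c.
suff /existsP : exists c, (c \in C) && connect e j c by rewrite (negbTE h).
exists z; rewrite zC /=.
have zt := subsetP Ct _ zC.
apply: (connect_ind (P := fun x => connect e j x)) (link_connected jt zt) _ _ => //.
move=> a b _ lab ja; apply: connect_trans (ja) _; apply: connect1.
rewrite /e lab andbT; apply: contraNN h => aC; apply/existsP; exists a.
by rewrite aC.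
Qed.

End Linkage.

Section OptimalTree.
Variables (L V : finType) (N : nat) (wt : L -> V -> 'X_{1..N}).
Variable le : rel 'X_{1..N}.
Hypothesis hle : term_order le.
Hypothesis weight_inj : injective (weight wt).
Variable M : {set V} -> {ffun L -> V}.
Hypothesis M_opt : forall S : {set V}, #|S| = #|L| -> optimal wt le S (M S).
Variable tau : {set V}.
Hypothesis card_tau : #|tau| = #|L|.+1.

Lemma card_tauD x : x \in tau -> #|tau :\ x| = #|L|.
Proof. by move=> xt; apply/eqP; rewrite -eqSS -card_tau (cardsD1 x tau) xt. Qed.

Let F x l := M (tau :\ x) l.

Let F_inj x : x \in tau -> injective (F x).
Proof. by move=> /card_tauD/M_opt[[inj _] _]; apply: inj. Qed.

Let F_in x l : x \in tau -> F x l \in tau :\ x.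
Proof. by move=> /card_tauD/M_opt[[_ in_tau] _]; apply: in_tau. Qed.

Lemma opt_towards j (C : {set V}) : j \in tau -> C \subset tau :\ j ->
  C != set0 -> exists2 c, c \in C & forall l y, y \in C -> y != c ->
    (M (tau :\ c) l == y) = (M (tau :\ j) l == y).
Proof.
move=> jt /subsetP Cj C0.
have /fin_all_exists[p /fin_all_exists[q h]] := fun l => edge_ex hle weight_inj M_opt l card_tau.
apply: (@link_towards L V tau F p q) => //.
all: try by move=> l; case: (h l) => -[].
- by apply/subsetP=> x /Cj /[!inE] /andP[].
by apply/negP=> /Cj; rewrite !inE eqxx.
Qed.

Lemma opt_edge l : exists p q,
  [/\ [/\ p \in tau, q \in tau & p != q],
      M (tau :\ p) l = q, M (tau :\ q) l = p,
      (forall l', l' != l -> M (tau :\ p) l' = M (tau :\ q) l') &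
      forall x, x \in tau -> (M (tau :\ x) l = p \/ M (tau :\ x) l = q) /\
        le (wt l x + weight wt (M (tau :\ x)))%MM
           (wt l p + weight wt (M (tau :\ p)))%MM].
Proof.
have /fin_all_exists[p /fin_all_exists[q h]] := fun l => edge_ex hle weight_inj M_opt l card_tau.
exists (p l), (q l); case: (h l) => h1 h2 h3 h4 h5; split=> // x xt; split; last exact: h5.
apply: (@link_value L V tau F p q) => // {h1 h2 h3 h4 h5} l1.
all: by case: (h l1) => -[].
Qed.

(** The value at [l] is an end of the edge labelled [l]. The end [p] attains the maximum by its
    choice, and the other end gives the same total by [weight_swap]. *)
Lemma opt_max l x y : x \in tau -> y \in tau -> let z := M (tau :\ x) l in
  le (wt l y + weight wt (M (tau :\ y)))%MM (wt l z + weight wt (M (tau :\ z)))%MM.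
Proof.
move=> xt yt; have [p [q [_ hp hq hne h]]] := opt_edge l.
case: (h x xt) => -[-> _ /=|-> _ /=]; first by case: (h y yt).
have := weight_swap wt hne; rewrite hp hq => <-; by case: (h y yt).
Qed.

End OptimalTree.

(** * Coherent matching fields *)

Section MatchingField.
Variables (n m : nat) (n_gt0 : 0 < n) (n_le_m : n <= m).
Variable le : rel 'X_{1..#|vars n m|}.
Hypothesis hle : term_order le.

Definition cell (i : 'I_n) (c : 'I_m) : 'X_{1..#|vars n m|} :=
  U_(enum_rank ((i, c) : vars n m))%MM.

Lemma cellE i c i' c' :
  cell i c (enum_rank ((i', c') : vars n m)) = (i == i') && (c == c') :> nat.
Proof. by rewrite /cell mnm1E (inj_eq enum_rank_inj) xpair_eqE. Qed.

Lemma row_weightE (g : {ffun 'I_n -> 'I_m}) i c :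
  weight cell g (enum_rank ((i, c) : vars n m)) = (g i == c) :> nat.
Proof.
rewrite /weight mnm_sumE (bigD1 i) //= cellE eqxx /= big1 ?addn0 // => l ne.
by rewrite cellE (negbTE ne).
Qed.

Lemma row_weight_inj : injective (weight cell).
Proof.
move=> g h e; apply/ffunP=> i; apply/eqP.
have := row_weightE g i (h i); rewrite e row_weightE eqxx.
by case: (g i == h i).
Qed.

Lemma col_weightE (T : finType) (f : T -> 'I_m) (g : {ffun T -> 'I_n}) i t :
  injective f ->
  weight (fun t i => cell i (f t)) g (enum_rank ((i, f t) : vars n m))
  = (g t == i) :> nat.
Proof.
move=> fi; rewrite /weight mnm_sumE (bigD1 t) //= cellE eqxx andbT.
rewrite big1 ?addn0 // => l ne.
by rewrite cellE (inj_eq fi) (negbTE ne) andbF.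
Qed.

Lemma col_weight_inj (T : finType) (f : T -> 'I_m) : injective f ->
  injective (weight (fun t i => cell i (f t))).
Proof.
move=> fi g h e; apply/ffunP=> t; apply/eqP.
have := col_weightE g (h t) t fi; rewrite e col_weightE // eqxx.
by case: (g t == h t).
Qed.

Variable M : {set 'I_m} -> {ffun 'I_n -> 'I_m}.
Hypothesis M_optn : forall a : {set 'I_m}, #|a| = n -> optimal cell le a (M a).

Let M_opt (a : {set 'I_m}) : #|a| = #|'I_n| -> optimal cell le a (M a).
Proof. by rewrite card_ord; apply: M_optn. Qed.

Lemma M_inj (a : {set 'I_m}) : #|a| = n -> injective (M a).
Proof. by move=> /M_optn[[i _] _]; apply: i. Qed.

Lemma M_in (a : {set 'I_m}) l : #|a| = n -> M a l \in a.
Proof. by move=> /M_optn[[_ i] _]; apply: i. Qed.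

Lemma M_surj (a : {set 'I_m}) c : #|a| = n -> c \in a -> exists l, M a l = c.
Proof.
move=> ca; apply: matching_surj; first by rewrite ca card_ord.
by case: (M_optn ca).
Qed.

(* The number of cells of X_U in row l. *)
Definition dg (U : {set 'I_m}) (l : 'I_n) : nat :=
  #|[set c | (c \notin U) && (M (c |: U) l == c)]|.

Definition rowX (U : {set 'I_m}) (c : 'I_m) : 'I_n :=
  odflt (Ordinal n_gt0) [pick l | M (c |: U) l == c].

Lemma cardU1n (U : {set 'I_m}) c : #|U|.+1 = n -> c \notin U -> #|c |: U| = n.
Proof. by move=> <- cU; rewrite cardsU1 cU. Qed.

Lemma rowXP (U : {set 'I_m}) c : #|U|.+1 = n -> c \notin U ->
  M (c |: U) (rowX U c) = c.
Proof.
move=> cU nc; rewrite /rowX; case: pickP => [l /eqP //|h].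
have [l e] := M_surj (cardU1n cU nc) (setU11 c U).
by have := h l; rewrite e eqxx.
Qed.

Lemma rowX_eq (U : {set 'I_m}) c l : #|U|.+1 = n -> c \notin U ->
  (M (c |: U) l == c) = (rowX U c == l).
Proof.
move=> cU nc; rewrite -{2}(rowXP cU nc) (inj_eq (M_inj (cardU1n cU nc))).
exact: eq_sym.
Qed.

Lemma dgE (U : {set 'I_m}) l : #|U|.+1 = n ->
  dg U l = #|[set c | (c \notin U) && (rowX U c == l)]|.
Proof.
move=> cU; apply: eq_card => c; rewrite !inE.
by case: (boolP (c \in U)) => // nc; rewrite /= rowX_eq.
Qed.

(** [X_U] has exactly one cell in each of the [m - (n - 1)] columns outside [U]. *)
Lemma dg_sum (U : {set 'I_m}) : #|U|.+1 = n -> \sum_l dg U l = (m - n).+1.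
Proof.
move=> cU; transitivity #|~: U|; last first.
  by rewrite cardsCs setCK card_ord -{1}cU subnSK // cU.
rewrite -sum1_card (partition_big (rowX U) predT) //=.
apply: eq_bigr => l _; rewrite dgE // -sum1_card; apply: eq_bigl => c.
by rewrite !inE.
Qed.

(** Induction on [#|a :\: U|]. If [U] lies in [a], then [a = c |: U] and the cell of column [c] is
    hit. Otherwise add some [j] of [U] to [a] and walk from [j] to the nearest vertex [c] of
    [a :\: U]: dropping [c] instead of [j] brings the set closer to [U], and the matchings agree on
    the columns of [a :\: U] other than [c], so a hit for the new set is a hit for [a]. *)
Lemma X_cover (U a : {set 'I_m}) : #|U|.+1 = n -> #|a| = n ->
  exists2 l, M a l \notin U & M (M a l |: U) l = M a l.
Proof.
move=> cU; elim: {a}_.+1 {-2}a (ltnSn #|a :\: U|) => // k IH a lta ca.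
case: (boolP (U \subset a)) => [sUa|/subsetPn[j jU ja]].
  have [c ca' cnU] : exists2 c, c \in a & c \notin U.
    apply/subsetPn; apply/negP=> /subset_leq_card.
    by rewrite ca -cU ltnn.
  have e : a = c |: U.
    apply/esym/eqP; rewrite eqEcard subUset sub1set ca' sUa /=.
    by rewrite (cardU1n cU cnU) ca.
  by have [l el] := M_surj ca ca'; exists l; rewrite el // -e.
have ct : #|j |: a| = #|'I_n|.+1 by rewrite cardsU1 ja ca card_ord.
have Dj : (j |: a) :\ j = a by rewrite setU1K.
have := opt_towards hle row_weight_inj M_opt ct (setU11 j a) (C := a :\: U).
rewrite Dj subsetDl => /(_ isT).
case=> [|c /[!inE] /andP[cU' ca'] h].
  apply/eqP => e; have : a \subset U by rewrite -setD_eq0 e.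
  by move/subset_leq_card; rewrite ca -cU ltnn.
have cb : #|(j |: a) :\ c| = n.
  by rewrite (card_tauD ct) ?card_ord // !inE ca' orbT.
case: (IH _ _ cb) => [|l h1 h2].
  apply: leq_trans (_ : #|a :\: U| <= k); last by rewrite -ltnS.
  apply: proper_card; apply/properP; split.
    apply/subsetP=> x; rewrite !inE => /andP[xU /andP[xc /orP[/eqP xj|xa]]].
      by move: xU; rewrite xj jU.
    by rewrite xU xa.
  by exists c; rewrite !inE ?eqxx ?cU' ?ca' //= andbF.
exists l; set x := M (_ :\ c) l in h1 h2.
all: have xa : x \in a :\: U.
all: try (rewrite !inE h1; have := M_in l cb; rewrite -/x !inE => /andP[_ /orP[/eqP xj|//]]; by move: h1; rewrite xj jU).
all: have xc : x != c by have := M_in l cb; rewrite -/x !inE => /andP[].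
all: have /eqP -> : M a l == x by rewrite -h // ?eqxx //.
all: by [].
Qed.

Section Cofactors.
Variable U : {set 'I_m}.
Hypothesis cardU : #|U|.+1 = n.

Let L : finType := {u : 'I_m | u \in U}.

Lemma card_U_sub : #|L| = #|U|.
Proof. by rewrite card_sig; apply: eq_card. Qed.

Let wt2 (u : L) (i : 'I_n) := cell i (val u).

Lemma cofactor_ex : exists N : {set 'I_n} -> {ffun L -> 'I_n},
  forall S : {set 'I_n}, #|S| = #|L| -> optimal wt2 le S (N S).
Proof.
have w_inj : injective (weight wt2) by apply: col_weight_inj; apply: val_inj.
have : forall S : {set 'I_n}, exists g, #|S| = #|L| -> optimal wt2 le S g.
  move=> S; case: (#|S| =P #|L|) => [/(optimal_ex wt2 hle)[g hg]|ne]; first by exists g.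
  by exists [ffun=> Ordinal n_gt0] => /ne.
by move/fin_all_exists => [N hN]; exists N.
Qed.

Lemma weight_split (g : {ffun 'I_n -> 'I_m}) (h : {ffun L -> 'I_n}) i :
  injective h -> (forall u, h u != i) -> (forall u, g (h u) = val u) ->
  weight cell g = (cell i (g i) + weight wt2 h)%MM.
Proof.
move=> hi hne gh; rewrite {1}/weight (bigD1 i) //=; congr (_ + _)%MM.
have e : [set h u | u : L] = [set l | l != i].
  apply/eqP; rewrite eqEcard; apply/andP; split.
    by apply/subsetP=> _ /imsetP[u _ ->]; rewrite inE.
  have -> : [set l | l != i] = ~: [set i] by apply/setP=> l; rewrite !inE.
  by rewrite card_imset // card_U_sub -ltnS cardU cardsC1 card_ord prednK.
transitivity (\sum_(l in [set l | l != i]) cell l (g l))%MM.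
  by apply: eq_bigl => l; rewrite inE.
rewrite -e big_imset /=; last by move=> ? ? _ _; apply: hi.
by apply: eq_bigr => u _; rewrite gh.
Qed.

Variable N : {set 'I_n} -> {ffun L -> 'I_n}.
Hypothesis N_opt : forall S : {set 'I_n}, #|S| = #|L| -> optimal wt2 le S (N S).

(** The exponent of the lead monomial of the minor of the columns [U] without row [i]. *)
Let nu i := weight wt2 (N (setT :\ i)).

Let cardT : #|[set: 'I_n]| = #|L|.+1.
Proof. by rewrite cardsT card_ord card_U_sub cardU. Qed.

Let cardTD i : #|[set: 'I_n] :\ i| = #|L|.
Proof. by apply: card_tauD cardT _ _; rewrite inE. Qed.

Lemma N_inj i : injective (N (setT :\ i)).
Proof. by case: (N_opt (cardTD i)) => -[]. Qed.

Lemma N_neq i u : N (setT :\ i) u != i.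
Proof.
by case: (N_opt (cardTD i)) => -[_ /(_ u)]; rewrite !inE andbT.
Qed.

Lemma N_surj i l : l != i -> exists u, N (setT :\ i) u = l.
Proof.
move=> ne; apply: matching_surj (cardTD i) _ _; last by rewrite !inE ne.
by case: (N_opt (cardTD i)).
Qed.

(** A Laplace expansion along column [c]: putting [c] in row [i] and [U] optimally in the other rows
    is one matching of [c |: U], and the optimal one puts [c] in row [rowX U c]. *)
Lemma cofactor_le c i : c \notin U ->
  le (cell i c + nu i)%MM (cell (rowX U c) c + nu (rowX U c))%MM.
Proof.
move=> nc; have cc := cardU1n cardU nc; have [_ optc] := M_optn cc.
apply: (@to_trans _ _ hle (weight cell (M (c |: U)))).
  pose g := [ffun l => if [pick u | N (setT :\ i) u == l] is Some u
                       then val u else c].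
  have gN u : g (N (setT :\ i) u) = val u.
    rewrite ffunE; case: pickP => [u' /eqP/N_inj -> //|/(_ u)].
    by rewrite eqxx.
  have gi : g i = c.
    by rewrite ffunE; case: pickP => // u /eqP e; have := N_neq i u; rewrite e eqxx.
  rewrite -{1}gi -weight_split //; first last.
  - exact: N_neq.
  - exact: N_inj.
  have gor l : l = i \/ exists2 u, l = N (setT :\ i) u & g l = val u.
    case: (eqVneq l i) => [|/N_surj[u <-]]; [by left | right].
    by exists u => //; rewrite gN.
  apply: optc; split=> [x y|l].
    case: (gor x) => [->|[u -> gu]]; case: (gor y) => [->|[v -> gv]] //.
    - by rewrite gi gN => e; move: nc; rewrite e (valP v).
    - by rewrite gi gN => e; move: nc; rewrite -e (valP u).
    - by rewrite !gN => /val_inj ->.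
  case: (gor l) => [->|[u -> _]]; rewrite ?gi ?gN !inE ?eqxx //.
  by rewrite (valP u) orbT.
set r := rowX U c; set Mc := M (c |: U).
have Mr : Mc r = c by apply: rowXP.
pose h := [ffun u : L => odflt r [pick l | Mc l == val u]].
have Mh u : Mc (h u) = val u.
  rewrite ffunE; case: pickP => [l /eqP //|/= nl].
  have : val u \in c |: U by rewrite !inE (valP u) orbT.
  by case/(M_surj cc) => l e; have := nl l; rewrite e eqxx.
have hi : injective h by move=> u v e; apply: val_inj; rewrite -!Mh e.
have hr u : h u != r.
  by apply/eqP=> e; have := Mh u; rewrite e Mr => e'; move: nc; rewrite e' (valP u).
have := weight_split hi hr Mh; rewrite Mr => ->.
rewrite (to_add2l hle); case: (N_opt (cardTD r)) => _; apply; split=> // u.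
by rewrite !inE hr.
Qed.

(** Completing [X_U] by a matching of the columns of [U] with the rows other than [i0] gives every
    column a row, so that different [U] compete in one transportation problem. The row [i0] is a
    parameter that [dg_inj] chooses. *)
Definition extX (i0 : 'I_n) : {ffun 'I_m -> 'I_n} :=
  [ffun c => if insub c is Some u then N (setT :\ i0) u else rowX U c].

Lemma extX_in i0 (u : L) : extX i0 (val u) = N (setT :\ i0) u.
Proof. by rewrite ffunE valK. Qed.

Lemma extX_out i0 c : c \notin U -> extX i0 c = rowX U c.
Proof. by move=> nc; rewrite ffunE insubN. Qed.

(** Outside [U] this is the Laplace expansion; on [U] it is [opt_max] for the tree on the [n] rows,
    whose labels are the columns of [U]. *)
Lemma extX_le i0 c i :
  le (cell i c + nu i)%MM (cell (extX i0 c) c + nu (extX i0 c))%MM.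
Proof.
case: (boolP (c \in U)) => [cU|nc]; last by rewrite extX_out //; apply: cofactor_le.
have -> : c = val (exist _ c cU : L) by [].
rewrite extX_in; set u : L := exist _ c cU.
have w_inj : injective (weight wt2) by apply: col_weight_inj; apply: val_inj.
by apply: (opt_max hle w_inj N_opt cardT u (x := i0) (y := i)); rewrite inE.
Qed.

Definition rd (Z : {ffun 'I_m -> 'I_n}) (l : 'I_n) : nat := #|[set c | Z c == l]|.

Lemma rd_nu (Z : {ffun 'I_m -> 'I_n}) k :
  (\sum_c nu (Z c))%MM k = \sum_l rd Z l * nu l k.
Proof.
rewrite mnm_sumE (partition_big Z predT) //=; apply: eq_bigr => l _.
rewrite -sum_nat_const; apply: eq_big => [c|c /eqP -> //]; by rewrite inE.
Qed.

(* The nu are potentials: every entry of extX i0 is extremal for them, so extX i0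
   is the heaviest assignment with its row degrees. *)
Lemma extX_opt i0 (Z : {ffun 'I_m -> 'I_n}) : rd Z =1 rd (extX i0) ->
  le (weight (fun c i => cell i c) Z) (weight (fun c i => cell i c) (extX i0)).
Proof.
move=> e; have := to_sum hle (fun c => extX_le i0 c (Z c)); rewrite !big_split /=.
have -> : (\sum_c nu (Z c) = \sum_c nu (extX i0 c))%MM.
  by apply/mnmP=> k; rewrite !rd_nu; apply: eq_bigr => l _; rewrite e.
by rewrite (to_add2r hle).
Qed.

Lemma rd_extX i0 l : rd (extX i0) l = dg U l + (l != i0).
Proof.
rewrite dgE // /rd -(cardsID U [set c | extX i0 c == l]) [LHS]addnC; congr (_ + _).
  apply: eq_card => c; rewrite !inE; case: (boolP (c \in U)) => //= nc.
  by rewrite extX_out.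
case: (eqVneq l i0) => [->|/N_surj[u e]] /=.
  apply: eq_card0 => c; rewrite !inE; apply/negP=> /andP[/eqP e cU].
  by have := N_neq i0 (exist _ c cU); rewrite -extX_in e eqxx.
rewrite -(cards1 (val u)); apply: eq_card => c; rewrite !inE.
apply/andP/eqP => [[/eqP h cU]|->]; last by rewrite (valP u) extX_in e.
have := extX_in i0 (exist _ c cU); rewrite /= h -e => /N_inj -> //.
Qed.

End Cofactors.

(** Equal row degrees make the two completed assignments optimal for the same problem, so they
    coincide for every [i0]. If [u] were in [U] but not in [U'], take for [i0] the row of [u] in the
    cells of [U']: the assignment of [U] never puts [u] in row [i0]. *)
Lemma dg_inj (U U' : {set 'I_m}) : #|U|.+1 = n -> #|U'|.+1 = n ->
  dg U =1 dg U' -> U = U'.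
Proof.
have : forall U U' : {set 'I_m}, #|U|.+1 = n -> #|U'|.+1 = n ->
  dg U =1 dg U' -> U \subset U'.
  move=> {}U {}U' cU cU' e; have [N oN] := cofactor_ex U.
  have [N' oN'] := cofactor_ex U'.
  have eE i0 : extX N i0 = extX N' i0.
    apply: (col_weight_inj (f := id)) => //; apply: (to_anti hle).
      by apply: extX_opt => // l; rewrite !rd_extX // e.
    by apply: extX_opt => // l; rewrite !rd_extX // e.
  apply/subsetP=> u uU; apply: contraT => nu'.
  have := eE (rowX U' u); move/ffunP/(_ u).
  rewrite (extX_out N' _ nu') (extX_in N _ (exist _ u uU)) => /eqP.
  by rewrite (negbTE (N_neq _ oN _ _)).
by move=> h cU cU' e; apply/eqP; rewrite eqEsubset !h.
Qed.

Lemma card_degrees q :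
  #|[set t : n.-tuple 'I_q.+1 | \sum_(i <- t) i == q]| = 'C(n.-1 + q, n.-1).
Proof. by case: n n_gt0 => // k _; rewrite card_ord_partitions. Qed.

(** An injection between finite sets of the same size: the [(n-1)]-sets and the vectors both number
    ['C(m, n.-1)], because [n.-1 + (m - n).+1 = m]. *)
Lemma dg_surj (d : 'I_n -> nat) : \sum_l d l = (m - n).+1 ->
  exists2 U : {set 'I_m}, #|U|.+1 = n & dg U =1 d.
Proof.
set q := (m - n).+1 => sd.
pose tup (e : 'I_n -> nat) : n.-tuple 'I_q.+1 := [tuple inord (e l) | l < n].
have tupE e l : \sum_l e l = q -> tnth (tup e) l = e l :> nat.
  move=> se; rewrite tnth_mktuple inordK // ltnS -se.
  by rewrite (bigD1 l) //= leq_addr.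
have tup_in e : \sum_l e l = q -> tup e \in [set t : n.-tuple 'I_q.+1 | \sum_(i <- t) i == q].
  move=> se; rewrite inE big_tuple -[X in _ == X]se.
  by apply/eqP/eq_bigr => l _; rewrite tupE.
pose A := [set U : {set 'I_m} | #|U| == n.-1].
have AP U : U \in A -> #|U|.+1 = n by rewrite inE => /eqP->; rewrite prednK.
have f_inj : {in A &, injective (fun U => tup (dg U))}.
  move=> U U' /AP cU /AP cU' e; apply: dg_inj => // l.
  by rewrite -(tupE _ l (dg_sum cU)) -(tupE _ l (dg_sum cU')) e.
have : [set tup (dg U) | U in A] == [set t : n.-tuple 'I_q.+1 | \sum_(i <- t) i == q].
  rewrite eqEcard; apply/andP; split.
    by apply/subsetP=> _ /imsetP[U /AP cU ->]; apply/tup_in/dg_sum.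
  rewrite card_in_imset // card_degrees card_draws card_ord.
  suff -> : n.-1 + q = m by [].
  by rewrite /q addnS -addSn prednK // subnKC.
move/eqP => e; have := tup_in d sd; rewrite -e => /imsetP[U /AP cU ed].
exists U => // l; rewrite -(tupE _ l (dg_sum cU)) -(tupE _ l sd); congr (val (tnth _ _)).
by rewrite ed.
Qed.

(** The cells of the sets [X_(a - u)], [u] in [a], that lie in columns outside [a]. In this form
    covering follows from [X_cover]; that replacing [M a l] by [c] is optimal is then [Ea_swap]. *)
Definition Ea (a : {set 'I_m}) (l : 'I_n) (c : 'I_m) : bool :=
  (c \notin a) && [exists u in a, M (c |: a :\ u) l == c].

Lemma card_swap (a : {set 'I_m}) c u : #|a| = n -> c \notin a -> u \in a ->
  #|c |: a :\ u| = n.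
Proof.
move=> ca nc ua; apply: cardU1n; last by rewrite !inE negb_and nc orbT.
by rewrite -ca (cardsD1 u a) ua.
Qed.

Lemma setU1D1 (a : {set 'I_m}) c u : c \notin a -> u \in a ->
  (c |: a) :\ u = c |: a :\ u.
Proof.
move=> nc ua; rewrite setDUl; congr (_ :|: _); apply/setP=> x; rewrite !inE.
by case: (eqVneq x c) => [->|]; rewrite ?andbF // andbT; apply: contraNneq nc => ->.
Qed.

(** In the tree on [c |: a], a value [c] at [l] means that [c] is an end of the edge labelled [l].
    Its other end is [M a l], and the matchings at the two ends differ only at [l]. *)
Lemma Ea_swap (a : {set 'I_m}) l c : #|a| = n -> Ea a l c -> forall l',
  M (c |: a :\ M a l) l' = if l' == l then c else M a l'.
Proof.
move=> ca /andP[nc /exists_inP[u ua /eqP e]] l'.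
have ct : #|c |: a| = #|'I_n|.+1 by rewrite cardsU1 nc ca card_ord.
have ac : (c |: a) :\ c = a by rewrite setU1K.
have [p [q [_ hp hq hne h]]] := opt_edge hle row_weight_inj M_opt ct l.
have uc : u \in c |: a by rewrite !inE ua orbT.
have Mla := M_in l ca.
suff [hc hl] : M ((c |: a) :\ M a l) l = c /\
    forall k, k != l -> M ((c |: a) :\ M a l) k = M a k.
  by rewrite -setU1D1 //; case: eqVneq => [->|/hl].
case: (h u uc) => -[]; rewrite setU1D1 // e => e' _.
  move: hp hq hne; rewrite -e' ac => -> hq hne; split=> // k /hne ->//.
by move: hp hq hne; rewrite -e' ac => hp -> hne; split=> // k /hne ->.
Qed.

Lemma X_Ea (a : {set 'I_m}) u l c : u \in a -> c \notin a ->
  M (c |: a :\ u) l = c -> Ea a l c.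
Proof. by move=> ua nc e; rewrite /Ea nc; apply/exists_inP; exists u; rewrite ?e. Qed.

Lemma cardD1n (a : {set 'I_m}) u : #|a| = n -> u \in a -> #|a :\ u|.+1 = n.
Proof. by move=> <- ua; rewrite (cardsD1 u a) ua. Qed.

Lemma Ea_ex (a : {set 'I_m}) c : #|a| = n -> c \notin a -> exists l, Ea a l c.
Proof.
move=> ca nc; have [u ua] : exists u, u \in a by apply/set0Pn; rewrite -card_gt0 ca.
have [l e] := M_surj (card_swap ca nc ua) (setU11 c _).
by exists l; apply: X_Ea ua nc e.
Qed.

(** Choose [u] in [a] but not in [b]. The cell where [M b] meets [X_(a - u)] is in a column outside
    [a - u], and not in column [u], which [b] lacks. *)
Lemma Ea_cover (a b : {set 'I_m}) : #|a| = n -> #|b| = n -> a != b ->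
  exists l, Ea a l (M b l).
Proof.
move=> ca cb ab; have [u ua ub] : exists2 u, u \in a & u \notin b.
  apply/subsetPn; apply: contraNN ab => ab.
  by rewrite eqEcard ab ca cb /=.
have [l h1 h2] := X_cover (cardD1n ca ua) cb; exists l; apply: (X_Ea ua) h2.
apply: contraNN h1 => h; rewrite !inE h andbT; apply: contraNneq ub => <-.
exact: M_in.
Qed.

(** With at most one cell of [E_a] per column, [X_(a - M a i)] is [E_a] with the single cell
    [(i, M a i)] added. Row degrees of [E_a] thus profit from the injectivity of [dg]. *)
Lemma Ea_dg (a : {set 'I_m}) i l : #|a| = n ->
  (forall c l l', Ea a l c -> Ea a l' c -> l = l') ->
  dg (a :\ M a i) l = #|[set c | Ea a l c]| + (l == i).
Proof.
move=> ca good; pose A := [set c | (c \notin a :\ M a i) && (M (c |: a :\ M a i) l == c)].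
rewrite -[dg _ _]/#|A| -(cardsID [set M a i] A) [LHS]addnC; congr (_ + _).
  apply: eq_card => c; rewrite !inE; case: (eqVneq c (M a i)) => [->|ne] /=.
    by rewrite /Ea M_in.
  case: (boolP (c \in a)) => [cin|nc] /=; first by rewrite /Ea cin.
  apply/eqP/idP => [|h]; first by apply: X_Ea (M_in i ca) nc.
  have [l' e] := M_surj (card_swap ca nc (M_in i ca)) (setU11 c _).
  by have /good/(_ h) <- := X_Ea (M_in i ca) nc e.
rewrite -[RHS](_ : #|[set c | (c == M a i) && (l == i)]| = _); last first.
  case: (l == i) => /=; last by apply: eq_card0 => c; rewrite !inE andbF.
  by rewrite -[RHS](cards1 (M a i)); apply: eq_card => c; rewrite !inE andbT.
apply: eq_card => c; rewrite !inE andbC; case: eqP => //= ->.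
by rewrite setD1K ?M_in // (inj_eq (M_inj ca)).
Qed.

End MatchingField.

(** * Regular sequences and the Koszul complex *)

Section IdealTheory.
Local Open Scope ring_scope.
Import GRing.Theory.
Variable R : comNzRingType.
Implicit Types (I J S : R -> Prop) (s : seq R) (f g : R).

Lemma idealN I f : is_ideal I -> I f -> I (- f).
Proof. by case=> _ _ M h; rewrite -mulN1r; apply: M. Qed.

Lemma idealB I f g : is_ideal I -> I f -> I g -> I (f - g).
Proof. by move=> iI hf hg; case: (iI) => _ D _; apply/D/(idealN iI). Qed.

Lemma ideal_sum I (T : eqType) (r : seq T) (F : T -> R) : is_ideal I ->
  (forall x, x \in r -> I (F x)) -> I (\sum_(x <- r) F x).
Proof. by case=> I0 D _ h; rewrite big_seq; apply: big_ind. Qed.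

Lemma ideal_gen_ideal S : is_ideal (ideal_gen S).
Proof.
split=> [|f g [s [hs ->]] [t [ht ->]]|a f [s [hs ->]]].
- by exists [::]; rewrite big_nil.
- exists (s ++ t); split=> [x|]; last by rewrite big_cat.
  by rewrite mem_cat => /orP[/hs|/ht].
exists [seq (a * x.1, x.2) | x <- s]; split=> [_ /mapP[x xs ->]|].
  exact: (hs x).
by rewrite big_map mulr_sumr; apply: eq_bigr => x _; rewrite mulrA.
Qed.

Lemma ideal_gen_in S f : S f -> ideal_gen S f.
Proof.
move=> Sf; exists [:: (1, f)]; rewrite big_seq1 mul1r; split=> // x.
by rewrite inE => /eqP->.
Qed.

Lemma ideal_gen_min S J : is_ideal J -> (forall f, S f -> J f) ->
  forall f, ideal_gen S f -> J f.
Proof.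
move=> iJ h f [s [hs ->]]; apply: ideal_sum => // x /hs/h.
by case: iJ => _ _; apply.
Qed.

Lemma zero_is_ideal : is_ideal (@zero_ideal R).
Proof.
by split=> [|f g -> ->|a f ->]; rewrite /zero_ideal ?addr0 ?mulr0.
Qed.

Lemma adjoin_ideal I s : is_ideal (ideal_adjoin I s).
Proof. exact: ideal_gen_ideal. Qed.

Lemma adjoin_sub I s f : I f -> ideal_adjoin I s f.
Proof. by move=> h; apply: ideal_gen_in; left. Qed.

Lemma adjoin_mem I s f : f \in s -> ideal_adjoin I s f.
Proof. by move=> h; apply: ideal_gen_in; right. Qed.

Lemma adjoin_min I s J : is_ideal J -> (forall f, I f -> J f) ->
  (forall f, f \in s -> J f) -> forall f, ideal_adjoin I s f -> J f.
Proof. by move=> iJ h1 h2; apply: ideal_gen_min => // f []; [apply: h1 | apply: h2]. Qed.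

Lemma adjoin0 I f : is_ideal I -> ideal_adjoin I [::] f <-> I f.
Proof. by move=> iI; split; [apply: adjoin_min | apply: adjoin_sub]. Qed.

Lemma adjoin_cons I a s f :
  ideal_adjoin (ideal_adjoin I [:: a]) s f <-> ideal_adjoin I (a :: s) f.
Proof.
split; apply: adjoin_min; try exact: adjoin_ideal.
- apply: adjoin_min; first exact: adjoin_ideal; first exact: adjoin_sub.
  by move=> g; rewrite inE => /eqP->; apply: adjoin_mem; rewrite inE eqxx.
- by move=> g h; apply: adjoin_mem; rewrite inE h orbT.
- by move=> g h; apply/adjoin_sub/adjoin_sub.
move=> g; rewrite inE => /orP[/eqP->|h]; last exact: adjoin_mem.
by apply/adjoin_sub/adjoin_mem; rewrite inE.
Qed.

Lemma adjoin1P I a f : is_ideal I ->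
  ideal_adjoin I [:: a] f -> exists c, I (f - c * a).
Proof.
move=> iI; have [I0 ID IM] := iI.
apply: (adjoin_min (J := fun f => exists c, I (f - c * a))).
- split=> [|g h [c hc] [c' hc']|b g [c hc]].
  + by exists 0; rewrite mul0r subr0.
  + exists (c + c'); rewrite mulrDl opprD addrACA; exact: ID.
  + by exists (b * c); rewrite -mulrA -mulrBr; apply: IM.
- by move=> g hg; exists 0; rewrite mul0r subr0.
- by move=> g; rewrite inE => /eqP->; exists 1; rewrite mul1r subrr.
Qed.

Lemma adjoinP I s f : is_ideal I -> ideal_adjoin I s f ->
  exists c : nat -> R, I (f - \sum_(l < size s) c l * s`_l).
Proof.
move=> iI; have [I0 ID IM] := iI.
apply: (adjoin_min (J := fun f => exists c : nat -> R, I (f - \sum_(l < size s) c l * s`_l))).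
- split=> [|g h [c hc] [c' hc']|b g [c hc]].
  + exists (fun=> 0); rewrite big1 ?subr0 // => l _; exact: mul0r.
  + exists (fun l => c l + c' l); under eq_bigr do rewrite mulrDl.
    by rewrite big_split /= opprD addrACA; exact: ID.
  + exists (fun l => b * c l); under eq_bigr do rewrite -mulrA.
    by rewrite -mulr_sumr -mulrBr; apply: IM.
- move=> g hg; exists (fun=> 0); rewrite big1 ?subr0 // => l _; exact: mul0r.
move=> g gs; exists (fun l => (l == index g s)%:R).
have lt : (index g s < size s)%N by rewrite index_mem.
rewrite (bigD1 (Ordinal lt)) //= eqxx mul1r nth_index // big1 ?addr0 ?subrr // => l ne.
suff /negbTE-> : (l != index g s :> nat) by rewrite mul0r.
by apply: contraNneq ne => e; apply/eqP/val_inj.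
Qed.

Lemma adjoin_split I s f : is_ideal I -> ideal_adjoin I s f ->
  exists2 t, I t & ideal_gen (fun g => g \in s) (f - t).
Proof.
move=> iI; have [I0 ID IM] := iI.
have [G0 GD GM] := ideal_gen_ideal (fun g => g \in s).
apply: (adjoin_min (J := fun f => exists2 t, I t & ideal_gen (fun g => g \in s) (f - t))).
- split=> [|g h [c hc hc'] [d hd hd']|b g [c hc hc']].
  + by exists 0 => //; rewrite subr0.
  + by exists (c + d); [apply: ID | rewrite opprD addrACA; apply: GD].
  + by exists (b * c); [apply: IM | rewrite -mulrBr; apply: GM].
- by move=> g hg; exists g => //; rewrite subrr.
by move=> g hg; exists 0 => //; rewrite subr0; apply: ideal_gen_in.
Qed.

Lemma ideal_gen_adjoin I s f : ideal_gen (fun g => g \in s) f -> ideal_adjoin I s f.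
Proof.
by apply: ideal_gen_min; [apply: adjoin_ideal | move=> g; apply: adjoin_mem].
Qed.

Definition weakly_regular I s : Prop := forall j f, (j < size s)%N ->
  ideal_adjoin I (take j s) (s`_j * f) -> ideal_adjoin I (take j s) f.

(* Vanishing of Tor_1(R / I, R / (s)). *)
Lemma weakly_regular_mul I s f : is_ideal I -> weakly_regular I s ->
  I f -> ideal_gen (fun g => g \in s) f ->
  ideal_mul (ideal_gen (fun g => g \in s)) I f.
Proof.
move=> iI reg; have [_ _ IM] := iI.
set G := ideal_gen (fun g => g \in s).
have [P0 PD PM] : is_ideal (ideal_mul G I) by apply: ideal_gen_ideal.
suff h j : (j <= size s)%N -> forall f, I f -> ideal_gen (fun g => g \in take j s) f ->
    ideal_mul G I f.
  by move=> If hf; apply: (h (size s)) => //; rewrite take_size.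
elim: j => [|j IH] lt {}f If.
  rewrite take0; apply: (ideal_gen_min (J := ideal_mul G I)) => //.
have iGj := ideal_gen_ideal (fun g => g \in take j s).
have [Gj0 GjD GjM] := iGj.
rewrite (take_nth 0 lt) => hf.
have [c hc] : exists c, ideal_gen (fun g => g \in take j s) (f - c * s`_j).
  apply: (ideal_gen_min (J := fun f => exists c, ideal_gen (fun g => g \in take j s) (f - c * s`_j))) hf.
    split=> [|g h [c hc] [d hd]|b g [c hc]].
    + by exists 0; rewrite mul0r subr0.
    + by exists (c + d); rewrite mulrDl opprD addrACA; apply: GjD.
    + by exists (b * c); rewrite -mulrA -mulrBr; apply: GjM.
  move=> g; rewrite mem_rcons inE => /orP[/eqP->|h].
    by exists 1; rewrite mul1r subrr.
  by exists 0; rewrite mul0r subr0; apply: ideal_gen_in.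
have : ideal_adjoin I (take j s) (s`_j * c).
  have -> : s`_j * c = f - (f - c * s`_j) by rewrite opprB addrC subrK mulrC.
  apply: idealB; [exact: adjoin_ideal | exact: adjoin_sub | exact: ideal_gen_adjoin].
move/(reg _ _ lt)/(adjoin_split iI) => [t It ht].
have -> : f = (f - t * s`_j) + t * s`_j by rewrite subrK.
apply: PD; last first.
  apply: ideal_gen_in; exists s`_j, t; split=> //; last by rewrite mulrC.
  by apply: ideal_gen_in; apply: mem_nth.
apply: IH; first exact: ltnW.
  by apply: idealB => //; rewrite mulrC; apply: IM.
have -> : f - t * s`_j = (f - c * s`_j) + s`_j * (c - t).
  by rewrite mulrBr addrA [s`_j * c]mulrC subrK mulrC.
by apply: GjD => //; apply: GjM.
Qed.

End IdealTheory.

(* The Koszul complex on xs, built one element at a time as a mapping cone;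
   [koszul_h xs a] is a contracting homotopy for multiplication by sum a_i x_i. *)
Section Koszul.
Local Open Scope ring_scope.
Import GRing.Theory.
Variable R : comNzRingType.
Implicit Types (I : R -> Prop) (xs a : seq R).

(** All degrees at once, a free module of rank [2 ^ p]: a pair [(u, v)] stands for [u + e * v], with
    [e] the exterior generator of the head of the list. *)
Fixpoint koszul (p : nat) : lmodType R :=
  if p is p'.+1 then (koszul p' * koszul p')%type : lmodType R else R^o.

Fixpoint koszul_d xs : koszul (size xs) -> koszul (size xs) :=
  if xs is x :: xs' return koszul (size xs) -> koszul (size xs) then
    fun w => (koszul_d w.1, x *: w.1 - koszul_d w.2)
  else fun => 0.

Fixpoint koszul_h xs a : koszul (size xs) -> koszul (size xs) :=
  if xs is x :: xs' return koszul (size xs) -> koszul (size xs) then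
    fun w => (koszul_h (behead a) w.1 + head 0 a *: w.2,
              - koszul_h (behead a) w.2)
  else fun => 0.

Fixpoint koszul_in I p : koszul p -> Prop :=
  if p is p'.+1 return koszul p -> Prop then
    fun w => koszul_in I w.1 /\ koszul_in I w.2
  else I.

(** All components of cohomological degree at least [j] vanish; the second factor carries one more
    exterior generator, hence the shift. *)
Fixpoint deg_lt p j : koszul p -> Prop :=
  if p is p'.+1 return koszul p -> Prop then
    fun w => deg_lt j w.1 /\ deg_lt j.-1 w.2
  else fun w => j = 0%N -> w = 0.

Fixpoint top p : koszul p :=
  if p is p'.+1 return koszul p then (0, top p') else 1.

Fixpoint topc p : koszul p -> R :=
  if p is p'.+1 return koszul p -> R then fun w => topc w.2 else id.

Fixpoint dot xs a : R :=
  if xs is x :: xs' then head 0 a * x + dot xs' (behead a) else 0.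

Lemma koszul_dD xs c (u v : koszul (size xs)) :
  koszul_d (c *: u + v) = c *: koszul_d u + koszul_d v.
Proof.
elim: xs u v => [|x xs IH] u v; first by rewrite /= scaler0 addr0.
case: u v => u1 u2 [v1 v2] /=; rewrite !IH; congr pair => /=.
have -> : x *: (c *: u1 + v1) = c *: (x *: u1) + x *: v1.
  by rewrite scalerDr !scalerA mulrC.
by rewrite opprD addrACA scalerBr.
Qed.

Lemma koszul_hD xs a c (u v : koszul (size xs)) :
  koszul_h a (c *: u + v) = c *: koszul_h a u + koszul_h a v.
Proof.
elim: xs a u v => [|x xs IH] a u v; first by rewrite /= scaler0 addr0.
case: u v => u1 u2 [v1 v2] /=; rewrite !IH; congr pair => /=; last by rewrite opprD -scalerN.
have -> : head 0 a *: (c *: u2 + v2) = c *: (head 0 a *: u2) + head 0 a *: v2.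
  by rewrite scalerDr !scalerA mulrC.
by rewrite addrACA scalerDr.
Qed.

Lemma koszul_d0 xs : koszul_d (0 : koszul (size xs)) = 0.
Proof. by have := koszul_dD 1 (0 : koszul (size xs)) 0; rewrite !scale1r addr0 => /eqP; rewrite -subr_eq subrr => /eqP. Qed.

Lemma koszul_dZ xs c (u : koszul (size xs)) : koszul_d (c *: u) = c *: koszul_d u.
Proof. by rewrite -[c *: u]addr0 koszul_dD koszul_d0 addr0. Qed.

Lemma koszul_dN xs (u : koszul (size xs)) : koszul_d (- u) = - koszul_d u.
Proof. by rewrite -!scaleN1r koszul_dZ. Qed.

Lemma koszul_dB xs (u v : koszul (size xs)) :
  koszul_d (u - v) = koszul_d u - koszul_d v.
Proof. by rewrite -[u]scale1r koszul_dD koszul_dN !scale1r. Qed.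

Lemma koszul_h0 xs a : koszul_h a (0 : koszul (size xs)) = 0.
Proof. by have := koszul_hD a 1 (0 : koszul (size xs)) 0; rewrite !scale1r addr0 => /eqP; rewrite -subr_eq subrr => /eqP. Qed.

Lemma koszul_hZ xs a c (u : koszul (size xs)) : koszul_h a (c *: u) = c *: koszul_h a u.
Proof. by rewrite -[c *: u]addr0 koszul_hD koszul_h0 addr0. Qed.

Lemma koszul_hN xs a (u : koszul (size xs)) : koszul_h a (- u) = - koszul_h a u.
Proof. by rewrite -!scaleN1r koszul_hZ. Qed.

Lemma koszul_hB xs a (u v : koszul (size xs)) :
  koszul_h a (u - v) = koszul_h a u - koszul_h a v.
Proof. by rewrite -[u]scale1r koszul_hD koszul_hN !scale1r. Qed.

Lemma koszul_dd xs (u : koszul (size xs)) : koszul_d (koszul_d u) = 0.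
Proof.
elim: xs u => [|x xs IH] //= [u v] /=.
by rewrite koszul_dB koszul_dZ !IH subr0 subrr.
Qed.

Let aux1 (W : zmodType) (A B C D : W) : A + (B - C) + (D + C) = B + (A + D).
Proof. by rewrite [D + C]addrC addrA -(addrA A) subrK [A + B]addrC addrA. Qed.

Let aux2 (W : zmodType) (A B C D : W) : A - B + (B + C + D) = C + (A + D).
Proof. by rewrite -[B + C + D]addrA -[A - B + _]addrA addKr addrCA. Qed.

Lemma koszul_homotopy xs a (u : koszul (size xs)) :
  koszul_h a (koszul_d u) + koszul_d (koszul_h a u) = dot xs a *: u.
Proof.
elim: xs a u => [|x xs IH] a u; first by rewrite /= addr0 scale0r.
case: u => u v /=; set b := behead a; set c := head 0 a.
have e (w : koszul (size xs)) : dot xs b *: w = koszul_h b (koszul_d w) + koszul_d (koszul_h b w).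
  by rewrite IH.
have eD (w w' : koszul (size xs)) : koszul_d (w + c *: w') = koszul_d w + c *: koszul_d w'.
  by rewrite addrC koszul_dD addrC.
congr pair => /=; rewrite scalerDl e.
  rewrite eD scalerBr scalerA.
  by refine (aux1 _ _ _ _).
rewrite koszul_hB koszul_hZ koszul_dN opprB opprK scalerDr scalerA [x * c]mulrC.
by refine (aux2 _ _ _ _).
Qed.

Lemma koszul_inP I p : is_ideal I ->
  [/\ koszul_in I (0 : koszul p), (forall u v : koszul p, koszul_in I u -> koszul_in I v ->
      koszul_in I (u + v)) & forall c (u : koszul p), koszul_in I u -> koszul_in I (c *: u)].
Proof.
move=> [I0 ID IM]; elim: p => [|p [h0 hD hZ]] //=; split=> //.
- by move=> [u u'] [v v'] /= [] ? ? [] ? ?; split; apply: hD.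
- by move=> c [u u'] /= [] ? ?; split; apply: hZ.
Qed.

Lemma koszul_inB I p (u v : koszul p) : is_ideal I ->
  koszul_in I u -> koszul_in I v -> koszul_in I (u - v).
Proof.
by move=> iI hu hv; have [_ D Z] := koszul_inP p iI; rewrite -scaleN1r; apply/D/Z.
Qed.

Lemma koszul_in_d I xs (u : koszul (size xs)) : is_ideal I ->
  koszul_in I u -> koszul_in I (koszul_d u).
Proof.
move=> iI; elim: xs u => [|x xs IH] /=; first by case: iI.
move=> [u v] /= [hu hv]; split; first exact: IH.
have [_ D Z] := koszul_inP (size xs) iI; apply: koszul_inB => //; [exact: Z | exact: IH].
Qed.

Lemma koszul_in_h I xs a (u : koszul (size xs)) : is_ideal I ->
  koszul_in I u -> koszul_in I (koszul_h a u).
Proof.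
move=> iI; elim: xs a u => [|x xs IH] a /=; first by case: iI.
have [_ D Z] := koszul_inP (size xs) iI.
move=> [u v] /= [hu hv]; split; first by apply: D; [exact: IH | exact: Z].
by rewrite -scaleN1r; apply/Z/IH.
Qed.

Lemma koszul_in_adjoin I f p (w : koszul p) : is_ideal I ->
  koszul_in (ideal_adjoin I [:: f]) w -> exists v, koszul_in I (w - f *: v).
Proof.
move=> iI; elim: p w => [|p IH] /=; first by move=> w /(adjoin1P iI)[c h]; exists c; rewrite /GRing.scale /= mulrC.
by move=> [u v] /= [/IH[u' hu] /IH[v' hv]]; exists (u', v').
Qed.

Lemma koszul_in_reg I f p (w : koszul p) : (forall g, I (f * g) -> I g) ->
  koszul_in I (f *: w) -> koszul_in I w.
Proof.
move=> reg; elim: p w => [|p IH] /=; first by move=> w; apply: reg.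
by move=> [u v] /= [/IH hu /IH hv].
Qed.

Lemma deg_lt0 p (w : koszul p) : deg_lt 0 w -> w = 0.
Proof.
elim: p w => [|p IH] w /=; first by apply.
by case: w => u v /= [/IH -> /IH ->].
Qed.

Lemma deg_ltP p j : [/\ deg_lt j (0 : koszul p),
  (forall u v : koszul p, deg_lt j u -> deg_lt j v -> deg_lt j (u + v)) &
  (forall c (u : koszul p), deg_lt j u -> deg_lt j (c *: u))].
Proof.
elim: p j => [|p IH] j /=.
  split=> // [u v hu hv j0|c u hu j0]; first by rewrite hu // hv // addr0.
  by rewrite hu // scaler0.
have [h0 hD hZ] := IH j; have [h0' hD' hZ'] := IH j.-1; split=> //.
- by move=> [u u'] [v v'] /= [] ? ? [] ? ?; split; [apply: hD | apply: hD'].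
- by move=> c [u u'] /= [] ? ?; split; [apply: hZ | apply: hZ'].
Qed.

Lemma deg_lt_h xs a j (w : koszul (size xs)) : deg_lt j w -> deg_lt j.-1 (koszul_h a w).
Proof.
elim: xs a j w => [|x xs IH] a j //= [u v] /= [hu hv].
have [_ D Z] := deg_ltP (size xs) j.-1.
split; first by apply: D; [exact: IH | exact: Z].
by have [_ _ Z'] := deg_ltP (size xs) j.-1.-1; rewrite -scaleN1r; apply/Z'/IH.
Qed.

Lemma deg_lt_all p j (w : koszul p) : (p < j)%N -> deg_lt j w.
Proof.
elim: p j w => [|p IH] j w; first by case: j.
by case: j => // j h; case: w => u v /=; split; apply: IH => //; apply: ltnW.
Qed.

Lemma koszul_d_top xs : koszul_d (top (size xs)) = 0.
Proof. by elim: xs => //= x xs ->; rewrite koszul_d0 scaler0 subr0. Qed.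

Lemma topcB p (u v : koszul p) : topc (u - v) = topc u - topc v.
Proof. by elim: p u v => //= p IH [u u'] [v v'] /=; rewrite IH. Qed.

Lemma topcZ p c (u : koszul p) : topc (c *: u) = c * topc u.
Proof. by elim: p u => //= p IH [u u'] /=; rewrite IH. Qed.

Lemma topc_top p : topc (top p) = 1.
Proof. by elim: p. Qed.

Lemma topc_d xs (u : koszul (size xs)) : ideal_gen (fun f => f \in xs) (topc (koszul_d u)).
Proof.
suff h J : is_ideal J -> (forall f, f \in xs -> J f) -> J (topc (koszul_d u)).
  by apply: h; [exact: ideal_gen_ideal | move=> f hf; exact: ideal_gen_in].
move=> iJ; elim: xs u => [|x xs IH] /=; first by case: iJ.
move=> [u v] hJ /=; rewrite topcB topcZ; apply: idealB => //.
  by rewrite mulrC; case: iJ => _ _; apply; apply: hJ; rewrite inE eqxx.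
by apply: IH => f h; apply: hJ; rewrite inE h orbT.
Qed.

Lemma in_dot xs f : ideal_gen (fun g => g \in xs) f -> exists a, f = dot xs a.
Proof.
have dD s a b : exists c, dot s a + dot s b = dot s c.
  elim: s a b => [|x s IH] a b /=; first by exists [::]; rewrite addr0.
  have [c e] := IH (behead a) (behead b); exists ((head 0 a + head 0 b) :: c).
  by rewrite /= -e mulrDl addrACA.
have dM s b a : exists c, b * dot s a = dot s c.
  elim: s a => [|x s IH] a /=; first by exists [::]; rewrite mulr0.
  have [c e] := IH (behead a); exists ((b * head 0 a) :: c).
  by rewrite /= -e mulrDr mulrA.
have d0 s : dot s [::] = 0 by elim: s => //= x s ->; rewrite mul0r addr0.
apply: (ideal_gen_min (J := fun f => exists a, f = dot xs a)).
  split=> [|g h [a ->] [b ->]|b g [a ->]]; [by exists [::] | exact: dD | exact: dM].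
move=> g; elim: xs => [|x xs IH] //; rewrite inE => /orP[/eqP->|/IH[a ->]].
  by exists [:: 1]; rewrite /= d0 mul1r addr0.
by exists (0 :: a); rewrite /= mul0r add0r.
Qed.

(** Depth sensitivity of the Koszul complex. Contract with [f = dot xs a]: modulo [I + (f)] the
    element [koszul_h a w] is a cocycle of lower degree, so by induction it is [d u + f v] modulo
    [I]; applying [d] gives [f w = f d v] modulo [I], and [f] cancels. *)
Lemma koszul_exact xs (fs : seq R) I : is_ideal I -> weakly_regular I fs ->
  (forall f, f \in fs -> ideal_gen (fun g => g \in xs) f) ->
  forall w : koszul (size xs), deg_lt (size fs) w -> koszul_in I (koszul_d w) ->
  exists v, koszul_in I (w - koszul_d v).
Proof.
elim: fs I => [|f fs IH] I iI reg hf w hw hdw.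
  exists 0; rewrite (deg_lt0 hw) koszul_d0 subr0.
  by have [] := koszul_inP (size xs) iI.
have [a ef] := in_dot (hf f (mem_head _ _)).
have reg0 g : I (f * g) -> I g.
  move=> h; have := reg 0%N g isT; rewrite take0 /= => /(_ (adjoin_sub _ h)).
  by move/(adjoin0 _ iI).
pose I' := ideal_adjoin I [:: f]; have iI' : is_ideal I' by apply: adjoin_ideal.
have reg' : weakly_regular I' fs.
  move=> j g jlt; rewrite /I' => /adjoin_cons h; apply/adjoin_cons.
  exact: (reg j.+1).
have hom := koszul_homotopy a w; rewrite -ef in hom.
have fI' g : I' (f * g).
  by rewrite mulrC; case: iI' => _ _; apply; apply: adjoin_mem; rewrite inE.
have fw (p : nat) (u : koszul p) : koszul_in I' (f *: u).
  by elim: p u => [u|p IHp [u v]] /=; [apply: fI' | split].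
have sub (p : nat) (u : koszul p) : koszul_in I u -> koszul_in I' u.
  elim: p u => [u|p IHp [u v]] /=; first exact: adjoin_sub.
  by case=> ? ?; split; apply: IHp.
have hdI := koszul_in_h a iI hdw.
have ehom : koszul_d (koszul_h a w) = f *: w - koszul_h a (koszul_d w).
  by rewrite -hom addrC addKr.
have hd : koszul_in I' (koszul_d (koszul_h a w)).
  by rewrite ehom; apply: koszul_inB => //; apply: sub.
have hf' g : g \in fs -> ideal_gen (fun g => g \in xs) g.
  by move=> gs; apply: hf; rewrite inE gs orbT.
have [u hu] := IH I' iI' reg' hf' (koszul_h a w) (deg_lt_h a hw) hd.
have [v hv] := koszul_in_adjoin iI hu.
exists v; apply: (koszul_in_reg reg0).
have := koszul_in_d iI hv; rewrite !koszul_dB koszul_dd subr0 koszul_dZ ehom => h.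
have [_ D _] := koszul_inP (size xs) iI.
rewrite scalerBr; have := D _ _ h hdI.
by rewrite addrAC subrK.
Qed.

(* The top cocycle of the Koszul complex has class 1 in R / (xs), so it is not
   a coboundary when (xs) is proper. *)
Lemma regular_size_le xs (fs : seq R) :
  weakly_regular (@zero_ideal R) fs ->
  (forall f, f \in fs -> ideal_gen (fun g => g \in xs) f) ->
  ~ ideal_gen (fun g => g \in xs) 1 -> (size fs <= size xs)%N.
Proof.
move=> reg hf n1; rewrite leqNgt; apply/negP=> lt; apply: n1.
have zI := @zero_is_ideal R.
have [|v hv] := koszul_exact zI reg hf (deg_lt_all (top (size xs)) lt).
  by rewrite koszul_d_top; case: (koszul_inP (size xs) zI).
have eq0 (p : nat) (u : koszul p) : koszul_in (@zero_ideal R) u -> u = 0.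
  by elim: p u => [u //|p IH [u1 u2] /= [/IH -> /IH ->]].
have := topc_d v; have /eqP := eq0 _ _ hv; rewrite subr_eq0 => /eqP <-.
by rewrite topc_top.
Qed.

End Koszul.

(** * Monomial ideals *)

Section MonomialIdealTheory.
Local Open Scope ring_scope.
Import GRing.Theory.
Variables (k : fieldType) (N : nat).
Implicit Types (A : 'X_{1..N} -> Prop) (I : {mpoly k[N]} -> Prop).
Implicit Types (f g : {mpoly k[N]}) (p q : 'X_{1..N}).

Lemma supp_ideal (P : 'X_{1..N} -> Prop) : (forall p q, P p -> P (q + p)%MM) ->
  is_ideal (fun f => forall p, p \in msupp f -> P p).
Proof.
move=> hP; split=> [p|f g hf hg p|a f hf p].
- by rewrite msupp0.
- by move/msuppD_le; rewrite mem_cat => /orP[/hf|/hg].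
by move/msuppM_le/allpairsP=> [[p1 p2] /= [_ /hf h ->]]; apply: hP.
Qed.

Lemma supp_gen I f : is_ideal I -> (forall p, p \in msupp f -> I 'X_[p]) -> I f.
Proof.
move=> iI h; rewrite (mpolyE f); apply: ideal_sum => // p /h hp.
by rewrite -mul_mpolyC; case: iI => _ _; apply.
Qed.

Lemma mono_idealP A f :
  mono_ideal A f <-> forall p, p \in msupp f -> exists2 q, A q & (q <= p)%MM.
Proof.
split.
  apply: (ideal_gen_min (J := fun f => forall p, p \in msupp f ->
      exists2 q, A q & (q <= p)%MM)).
    apply: (supp_ideal (P := fun p => exists2 q, A q & (q <= p)%MM)).
    by move=> p q [r Ar le]; exists r => //; apply: lepm_trans le (lem_addl _ _).
  by move=> g [q Aq ->] p; rewrite msuppX inE => /eqP->; exists q => //; apply: lepm_refl.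
have iI := ideal_gen_ideal (fun f => exists2 p, A p & f = 'X_[p]).
move=> h; apply: (supp_gen iI) => p /h[q Aq le].
rewrite -(submK le) mpolyXD; case: iI => _ _; apply.
by apply: ideal_gen_in; exists q.
Qed.

Lemma mono_idealX A p : mono_ideal A ('X_[p] : {mpoly k[N]}) <-> exists2 q, A q & (q <= p)%MM.
Proof.
rewrite mono_idealP; split=> [|h q]; first by apply; rewrite msuppX inE.
by rewrite msuppX inE => /eqP->.
Qed.

Lemma mono_ideal_ideal A : is_ideal (mono_ideal (k := k) A).
Proof. exact: ideal_gen_ideal. Qed.

Lemma coef0_ideal : is_ideal (fun f => f@_0%MM = 0).
Proof.
by split=> [|f g hf hg|a f hf]; rewrite ?mcoeff0 // ?mcoeffD ?hf ?hg ?addr0 // rmorphM /= hf mulr0.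
Qed.

Definition subst (M : nat) (h : 'I_N -> {mpoly k[M]}) : {mpoly k[N]} -> {mpoly k[M]} :=
  mmap (@mpolyC M k) h.

HB.instance Definition _ M (h : 'I_N -> {mpoly k[M]}) :=
  GRing.RMorphism.copy (subst h) (mmap (@mpolyC M k) h).

Lemma substX M (h : 'I_N -> {mpoly k[M]}) p : subst h 'X_[p] = \prod_i h i ^+ p i.
Proof. by rewrite /subst mmapX. Qed.

Lemma substXU M (h : 'I_N -> {mpoly k[M]}) i : subst h 'X_i = h i.
Proof. by rewrite /subst mmapX mmap1U. Qed.

Lemma substE M (h : 'I_N -> {mpoly k[M]}) f :
  subst h f = \sum_(p <- msupp f) f@_p *: \prod_i h i ^+ p i.
Proof. by apply: eq_bigr => p _; rewrite mul_mpolyC. Qed.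

Lemma subst_id f : subst (fun i => 'X_i) f = f.
Proof.
by rewrite substE [RHS]mpolyE; apply: eq_bigr => p _; rewrite [in RHS]mpolyXE_id.
Qed.

Lemma subst_congr M (h h' : 'I_N -> {mpoly k[M]}) (J : {mpoly k[M]} -> Prop) :
  is_ideal J -> (forall i, J (h i - h' i)) ->
  forall f, J (subst h f - subst h' f).
Proof.
move=> iJ hh f; have [J0 JD JM] := iJ.
have mulJ a b c d : J (a - b) -> J (c - d) -> J (a * c - b * d).
  move=> h1 h2; have -> : a * c - b * d = c * (a - b) + b * (c - d).
    by rewrite !mulrBr [c * a]mulrC [c * b]mulrC addrA subrK.
  by apply: JD; apply: JM.
rewrite !substE -sumrB; apply: ideal_sum => // p _.
rewrite -scalerBr -mul_mpolyC; apply: JM.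
apply: (big_rec2 (fun x y => J (x - y))); first by rewrite subrr.
move=> i x y _; apply: (mulJ).
elim: (p i) => [|e IH]; first by rewrite !expr0 subrr.
by rewrite !exprS; apply: mulJ.
Qed.

End MonomialIdealTheory.

Section SubstComp.
Local Open Scope ring_scope.
Import GRing.Theory.

Lemma subst_subst (k : fieldType) (N M P : nat) (h : 'I_N -> {mpoly k[M]})
    (g : 'I_M -> {mpoly k[P]}) f :
  subst g (subst h f) = subst (fun v => subst g (h v)) f.
Proof.
rewrite [in RHS]substE (substE h) rmorph_sum /=; apply: eq_bigr => p _.
rewrite -mul_mpolyC rmorphM /= rmorph_prod /= {1}/subst mmapC mul_mpolyC.
by congr (_ *: _); apply: eq_bigr => v _; rewrite rmorphXn.
Qed.

End SubstComp.

Section RegularByKernel.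
Local Open Scope ring_scope.
Import GRing.Theory.
Variables (R : idomainType) (s : seq R) (kap : nat -> {rmorphism R -> R}).
Hypothesis kap_mod : forall j f, (j < size s)%N ->
  ideal_adjoin (@zero_ideal R) (take j s) (f - kap j f).
Hypothesis kap_kill : forall j x, (j < size s)%N -> x \in take j s -> kap j x = 0.
Hypothesis kap_next : forall j, (j < size s)%N -> kap j s`_j != 0.

Lemma kap_ker j f : (j < size s)%N ->
  ideal_adjoin (@zero_ideal R) (take j s) f <-> kap j f = 0.
Proof.
move=> lt; split; last by move=> e; have := kap_mod f lt; rewrite e subr0.
apply: (adjoin_min (J := fun f => kap j f = 0)) => [|g ->|g]; [|exact: rmorph0|exact: kap_kill].
split=> [|a b ha hb|a b hb]; [exact: rmorph0| |].
  by rewrite rmorphD ha hb addr0.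
by rewrite rmorphM hb mulr0.
Qed.

(** [kap j] embeds the quotient by the first [j] elements into a domain, where the nonzero image of
    the next element is no zero divisor. *)
Lemma weakly_regular_kernel : weakly_regular (@zero_ideal R) s.
Proof.
move=> j f lt /(kap_ker _ lt); rewrite rmorphM => /eqP.
by rewrite mulf_eq0 (negbTE (kap_next lt)) /= => /eqP h; apply/kap_ker.
Qed.

End RegularByKernel.

Section VariableIdeal.
Local Open Scope ring_scope.
Import GRing.Theory.
Variables (k : fieldType) (N : nat) (vs : seq 'I_N).
Hypothesis vs_uniq : uniq vs.

Let xs : seq {mpoly k[N]} := [seq 'X_i | i <- vs].

Let kap j : {rmorphism {mpoly k[N]} -> {mpoly k[N]}} :=
  subst (fun i => if i \in take j vs then 0 else 'X_i).

Lemma variables_weakly_regular : weakly_regular (@zero_ideal {mpoly k[N]}) xs.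
Proof.
apply: (@weakly_regular_kernel _ _ kap).
- move=> j f _; have := subst_id f; rewrite {1}/subst => {1}<-.
  apply: subst_congr; first exact: adjoin_ideal.
  move=> i; case: ifP => h; rewrite ?subr0 ?subrr.
    by apply: adjoin_mem; rewrite /xs -map_take; apply/mapP; exists i.
  by case: (adjoin_ideal (@zero_ideal {mpoly k[N]}) (take j xs)).
- move=> j x _; rewrite /xs -map_take => /mapP[i hi ->].
  by rewrite /kap /= substXU hi.
move=> j; rewrite size_map => lt.
have [i0 _] : exists i0 : 'I_N, true by case: (vs) lt => // i0 ? _; exists i0.
rewrite (nth_map i0) // /kap /= substXU.
case: ifP => [|_]; last first.
  apply/eqP => /(congr1 (mcoeff U_(nth i0 vs j)%MM)) /eqP.
  by rewrite mcoeffX eqxx mcoeff0 oner_eq0.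
have := vs_uniq; rewrite -{1}(cat_take_drop j vs) cat_uniq => /and3P[_ /hasPn h _].
by rewrite (drop_nth i0) // in h; rewrite (negbTE (h _ (mem_head _ _))).
Qed.

(** The variables themselves are a regular sequence, and the Koszul bound excludes longer ones
    because the ideal has [size vs] generators. *)
Lemma variable_ideal_grade (I : {mpoly k[N]} -> Prop) :
  (forall f, I f <-> forall p, p \in msupp f -> has (fun i => p i != 0%N) vs) ->
  has_grade I (size vs).
Proof.
move=> IE.
have coef0 f : ideal_gen (fun g => g \in xs) f -> f@_0%MM = 0.
  apply: (ideal_gen_min (J := fun f => f@_0%MM = 0)); first exact: coef0_ideal.
  by move=> g /mapP[i _ ->]; rewrite mcoeffX mnm1_eq0.
split.
  exists xs; split; last by rewrite size_map.
    split; first exact: variables_weakly_regular.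
    move=> h1; suff /eqP : (1 : {mpoly k[N]})@_0%MM = 0 by rewrite mcoeff1 eqxx oner_eq0.
    apply: coef0; apply: adjoin_min h1; first exact: ideal_gen_ideal.
      by move=> g ->; case: (ideal_gen_ideal (fun g => g \in xs)).
    by move=> g hg; exact: ideal_gen_in.
  move=> f /mapP[i hi ->]; apply/IE => p; rewrite msuppX inE => /eqP->.
  by apply/hasP; exists i; rewrite // mnm1E eqxx.
move=> s [reg _] hs; rewrite -(size_map (fun i => 'X_i : {mpoly k[N]}) vs).
apply: regular_size_le reg _ _; last first.
  by move/coef0 => /eqP; rewrite mcoeff1 eqxx oner_eq0.
move=> f /hs /IE h; have iX := ideal_gen_ideal (fun g => g \in xs).
apply: (supp_gen iX) => p /h /hasP[i hi pi].
have le : (U_(i) <= p)%MM by rewrite lep1mP.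
rewrite -(submK le) mpolyXD; case: iX => _ _; apply.
by apply: ideal_gen_in; apply/mapP; exists i.
Qed.

End VariableIdeal.

Lemma has_grade_inj (R : comNzRingType) (I : R -> Prop) r r' :
  has_grade I r -> has_grade I r' -> r = r'.
Proof.
case=> [[s [sr sI es]] h] [[s' [sr' sI' es']] h'].
by apply/eqP; rewrite eqn_leq -{1}es -{2}es' h // h'.
Qed.

(** * Points of a grid over the ring of differences *)

Section Grid.
Local Open Scope ring_scope.
Import GRing.Theory.
Variables (k : fieldType) (n : nat) (m_ : 'I_n -> nat).
Hypothesis m_gt0 : forall i, (0 < m_ i)%N.

Local Notation T := (pol_idx m_).
Local Notation S := {mpoly k[#|pol_idx m_|]}.
Implicit Types (p q : 'X_{1..#|T|}) (d : 'X_{1..n}) (f g : S) (b : 'I_n -> T).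

Definition hd (i : 'I_n) : T := Tagged (fun i => 'I_(m_ i)) (Ordinal (m_gt0 i)).

Definition xv (u : T) : S := 'X_(enum_rank u).

(** The exponent of the depolarized monomial, by [depolarizeX]. *)
Definition rdeg p : 'X_{1..n} :=
  [multinom (\sum_(u : T | tag u == i) p (enum_rank u))%N | i < n].

Lemma rdegD p q : rdeg (p + q)%MM = (rdeg p + rdeg q)%MM.
Proof.
apply/mnmP=> i; rewrite mnmDE !mnmE -big_split /=.
by apply: eq_bigr => u _; rewrite mnmDE.
Qed.

Lemma rdegU (u : T) : rdeg U_(enum_rank u)%MM = U_(tag u)%MM.
Proof.
apply/mnmP=> i; rewrite mnmE mnm1E; case: eqP => [<-|ne].
  rewrite (bigD1 u) //= mnm1E eqxx big1 // => v /andP[_ ne].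
  by rewrite mnm1E (inj_eq enum_rank_inj) eq_sym (negbTE ne).
rewrite big1 // => v /eqP tv; rewrite mnm1E (inj_eq enum_rank_inj).
by case: eqP => // e; case: ne; rewrite e.
Qed.

Lemma mdeg_rdeg p : mdeg (rdeg p) = mdeg p.
Proof.
rewrite !mdegE [RHS](reindex (@enum_rank T)) /=; last first.
  by exists enum_val => x _; rewrite ?enum_rankK ?enum_valK.
rewrite [RHS](partition_big (fun u : T => tag u) xpredT) //=.
by apply: eq_bigr => i _; rewrite mnmE.
Qed.

Lemma depolarizeE f : depolarize f = subst (fun v => 'X_(tag (enum_val v))) f.
Proof.
rewrite /depolarize /comp_mpoly /subst /mmap; apply: eq_bigr => p _.
by congr (_ * _); apply: mmap1_eq => v; rewrite tnth_mktuple.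
Qed.

Lemma depolarizeX p : depolarize ('X_[p] : S) = 'X_[rdeg p].
Proof.
rewrite depolarizeE substX [RHS]mpolyXE_id.
rewrite (reindex (@enum_rank T)) /=; last by exists enum_val => x _; rewrite ?enum_rankK ?enum_valK.
rewrite (partition_big (fun u : T => tag u) xpredT) //=.
apply: eq_bigr => i _; rewrite mnmE -prodrXr.
by apply: eq_bigr => u /eqP tu; rewrite enum_rankK tu.
Qed.

Definition valid b : Prop := forall i, tag (b i) = i.

Definition ev b : S -> S := subst (fun v => 'X_v - xv (b (tag (enum_val v)))).

HB.instance Definition _ b := GRing.RMorphism.copy (ev b)
  (subst (fun v => 'X_v - xv (b (tag (enum_val v))))).

Lemma ev_xv b u : ev b (xv u) = xv u - xv (b (tag u)).
Proof. by rewrite /ev substXU enum_rankK. Qed.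

(* The ring A of the differences, as the elements fixed by all the evaluations. *)
Definition diffring f : Prop := forall b, valid b -> ev b f = f.

Lemma diffring_sub u v : tag u = tag v -> diffring (xv u - xv v).
Proof.
move=> e b vb; rewrite rmorphB /= !ev_xv e.
by rewrite opprD opprK addrACA addNr addr0.
Qed.

Lemma diffringD f g : diffring f -> diffring g -> diffring (f + g).
Proof. by move=> hf hg b vb; rewrite rmorphD /= hf // hg. Qed.

Lemma diffringM f g : diffring f -> diffring g -> diffring (f * g).
Proof. by move=> hf hg b vb; rewrite rmorphM /= hf // hg. Qed.

Lemma diffringC (c : nat) : diffring c%:R.
Proof. by move=> b vb; rewrite rmorph_nat. Qed.

Lemma diffringZ c : diffring c%:MP.
Proof. by move=> b vb; rewrite /ev /subst mmapC. Qed.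

Definition ypow d : S := \prod_i xv (hd i) ^+ d i.

Section Span.
Variables (It : S -> Prop) (B : seq 'X_{1..n}).
Hypothesis It_ideal : is_ideal It.
Hypothesis B_uniq : uniq B.
Hypothesis It_mono : forall d, d \notin B -> exists2 p, rdeg p = d & It 'X_[p].

Definition spanned f : Prop := exists2 a : 'X_{1..n} -> S,
  (forall d, diffring (a d)) & It (f - \sum_(d <- B) a d * ypow d).

Lemma spannedD f g : spanned f -> spanned g -> spanned (f + g).
Proof.
move=> [a ha hf] [a' ha' hg]; exists (fun d => a d + a' d).
  by move=> d; apply: diffringD.
under eq_bigr do rewrite mulrDl.
by rewrite big_split /= opprD addrACA; case: It_ideal => _ D _; apply: D.
Qed.

Lemma spannedM c f : diffring c -> spanned f -> spanned (c * f).
Proof.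
move=> hc [a ha hf]; exists (fun d => c * a d).
  by move=> d; apply: diffringM.
under eq_bigr do rewrite -mulrA.
by rewrite -mulr_sumr -mulrBr; case: It_ideal => _ _; apply.
Qed.

Lemma spanned_in f : It f -> spanned f.
Proof.
move=> h; exists (fun=> 0); first by move=> d; apply: (diffringC 0).
by rewrite big1 ?subr0 // => d _; rewrite mul0r.
Qed.

Lemma spanned_ypow d : d \in B -> spanned (ypow d).
Proof.
move=> dB; exists (fun d' => (d' == d)%:R); first by move=> d'; apply: diffringC.
rewrite (bigD1_seq d) //= eqxx mul1r big1 ?addr0 ?subrr; first by case: It_ideal.
by move=> d' /negbTE ->; rewrite mul0r.
Qed.

Lemma spannedB f g : spanned f -> spanned g -> spanned (f - g).
Proof.
move=> hf hg; apply: spannedD => //; rewrite -mulN1r; apply: spannedM => //.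
by move=> b vb; rewrite rmorphN rmorph1.
Qed.

(** The inner induction measure of [spannedX]: the degree in the variables that are not the head of
    their row. *)
Definition offhd p : nat := \sum_(u : T | u != hd (tag u)) p (enum_rank u).

Lemma offhdD p q : offhd (p + q)%MM = (offhd p + offhd q)%N.
Proof. by rewrite -big_split /=; apply: eq_bigr => u _; rewrite mnmDE. Qed.

Lemma offhdU (u : T) : offhd U_(enum_rank u)%MM = (u != hd (tag u)).
Proof.
rewrite /offhd; case: (boolP (u == hd (tag u))) => uh.
  apply: big1 => v vh; rewrite mnm1E (inj_eq enum_rank_inj).
  by case: (eqVneq u v) vh => // <-; rewrite uh.
rewrite (bigD1 u) //= mnm1E eqxx big1 // => v /andP[_ ne].
by rewrite mnm1E (inj_eq enum_rank_inj) eq_sym (negbTE ne).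
Qed.

Lemma offhd0 p : (forall u : T, u != hd (tag u) -> p (enum_rank u) = 0%N) ->
  'X_[p] = ypow (rdeg p).
Proof.
move=> h; rewrite mpolyXE_id (reindex (@enum_rank T)) /=; last first.
  by exists enum_val => x _; rewrite ?enum_rankK ?enum_valK.
rewrite (partition_big (fun u : T => tag u) xpredT) //=.
apply: eq_bigr => i _; rewrite mnmE.
have -> : (\sum_(u : T | tag u == i) p (enum_rank u))%N = p (enum_rank (hd i)).
  rewrite (bigD1 (hd i)) //= big1 ?addn0 // => u /andP[/eqP tu ne].
  by rewrite h // tu.
rewrite (bigD1 (hd i)) //= big1 ?mulr1 // => u /andP[/eqP tu ne].
by rewrite h ?expr0 // tu.
Qed.

(** Trading a variable for the head of its row changes a monomial by a difference times a monomial
    of smaller degree, so up to smaller degrees ['X_[p]] depends only on [rdeg p]. If [rdeg p] is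
    outside [B], it is compared with a monomial of [It] that has the same row degrees. *)
Lemma spannedX p : spanned 'X_[p].
Proof.
elim: {p}_.+1 {-2}p (ltnSn (mdeg p)) => // t IHt p; rewrite ltnS => lt.
have red : forall q, (mdeg q <= t)%N -> spanned ('X_[q] - ypow (rdeg q)).
  move=> q; elim: {q}_.+1 {-2}q (ltnSn (offhd q)) => // e IHe q; rewrite ltnS => le_e lq.
  case: (boolP [exists u : T, (u != hd (tag u)) && (q (enum_rank u) != 0%N)]).
    move=> /existsP[u /andP[uh qu]].
    have le1 : (U_(enum_rank u) <= q)%MM by rewrite lep1mP.
    pose q' := (q - U_(enum_rank u))%MM; have eq : q = (q' + U_(enum_rank u))%MM by rewrite submK.
    pose q2 := (q' + U_(enum_rank (hd (tag u))))%MM.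
    have e2 : rdeg q2 = rdeg q by rewrite eq !rdegD !rdegU.
    have -> : 'X_[q] - ypow (rdeg q) =
       (xv u - xv (hd (tag u))) * 'X_[q'] + ('X_[q2] - ypow (rdeg q2)).
      rewrite e2 addrA; congr (_ - _); rewrite eq !mpolyXD mulrBl mulrC.
      by rewrite [X in _ = _ + X]mulrC subrK.
    apply: spannedD.
      apply: spannedM; first by apply: diffring_sub.
      apply: IHt; rewrite -ltnS; apply: leq_trans (_ : (mdeg q).+1 <= _)%N; last by rewrite ltnS.
      by rewrite eq mdegD mdeg1 addn1.
    apply: IHe; last by rewrite -mdeg_rdeg e2 mdeg_rdeg.
    apply: leq_trans le_e; rewrite eq !offhdD !offhdU eqxx uh addn0 addn1.
    exact: leqnn.
  move/existsPn => h; rewrite offhd0 ?subrr; first by apply: spanned_in; case: It_ideal.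
  by move=> u uh; apply/eqP; have := h u; rewrite uh negbK.
case: (boolP (rdeg p \in B)) => [pB|/It_mono[q eq Iq]].
  by rewrite -[X in spanned X](subrK (ypow (rdeg p))); apply: spannedD (red _ lt) (spanned_ypow pB).
have hq : (mdeg q <= t)%N by rewrite -mdeg_rdeg eq mdeg_rdeg.
have -> : 'X_[p] = ('X_[p] - ypow (rdeg p)) - ('X_[q] - ypow (rdeg q)) + 'X_[q] :> S.
  by rewrite eq opprB addrA subrK subrK.
by apply: spannedD (spanned_in Iq); apply: spannedB; apply: red.
Qed.

Lemma span_all f : spanned f.
Proof.
rewrite (mpolyE f); elim/big_rec: _ => [|p g _ hg].
  by apply: spanned_in; case: It_ideal.
apply: spannedD hg; rewrite -mul_mpolyC; apply: spannedM (spannedX p).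
exact: diffringZ.
Qed.

End Span.

Section Independence.
Variables (It : S -> Prop) (B : seq 'X_{1..n}).
Hypothesis It_span : forall f, spanned It B f.
Variables (r : nat) (pts : 'I_r -> 'I_n -> T).
Hypothesis pts_valid : forall s, valid (pts s).
Hypothesis pts_neq : forall s t, s != t -> exists i, pts s i != pts t i.
Hypothesis It_ev : forall s f, It f -> ev (pts s) f = 0.
Hypothesis B_size : (size B <= r)%N.

Lemma ev_comb s (a : 'X_{1..n} -> S) : (forall d, diffring (a d)) ->
  ev (pts s) (\sum_(d <- B) a d * ypow d) = \sum_(d <- B) a d * ev (pts s) (ypow d).
Proof.
by move=> ha; rewrite rmorph_sum; apply: eq_bigr => d _; rewrite rmorphM /= ha.
Qed.

(** For each other point [t], take the variable that [t] picks in a row where the two points differ: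
    it vanishes at [t] and becomes a nonzero difference at [s]. The product over [t] separates [s]
    from all of them. *)
Lemma separate s : exists2 c : S,
  forall t, t != s -> ev (pts t) c = 0 & ev (pts s) c != 0.
Proof.
have : forall t, exists c : S, t != s -> ev (pts t) c = 0 /\ ev (pts s) c != 0.
  move=> t; case: (eqVneq t s) => [_|ne]; first by exists 0.
  have [i ti] := pts_neq ne; exists (xv (pts t i)) => _.
  have vi s' := pts_valid s' i.
  split; first by rewrite ev_xv vi subrr.
  rewrite ev_xv vi subr_eq0; apply: contraNneq ti => e; apply/eqP.
  move: e; rewrite /xv => /(congr1 (fun f : S => f@_U_(enum_rank (pts t i))%MM)).
  rewrite !mcoeffXU eqxx (inj_eq enum_rank_inj); case: eqP => // _ /eqP.
  by rewrite oner_eq0.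
move=> /fin_all_exists[c hc]; exists (\prod_(t | t != s) c t) => [t ts|].
  by rewrite (bigD1 t) //= rmorphM /= (proj1 (hc t ts)) mul0r.
by rewrite rmorph_prod prodf_seq_neq0; apply/allP => t _; apply/implyP => /hc[].
Qed.

(* Evaluation at the r points, on the span of the y^d with d in B.  It is onto
   after inverting the coefficient ring because the points can be separated. *)
Let Q : 'M[{fraction S}]_(size B, r) :=
  \matrix_(i, s) tofrac (ev (pts s) (ypow (nth 0%MM B i))).

(** Expanding the separating elements on the span yields a matrix [C] for which [C *m Q] is diagonal
    with nonzero entries. *)
Lemma eval_rank : (r <= \rank Q)%N.
Proof.
have /fin_all_exists[L hL] : forall s, exists c : S,
  (forall t, t != s -> ev (pts t) c = 0) /\ ev (pts s) c != 0.
  by move=> s; have [c] := separate s; exists c.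
have /fin_all_exists[a ha] : forall s, exists a : 'X_{1..n} -> S,
  (forall d, diffring (a d)) /\ It (L s - \sum_(d <- B) a d * ypow d).
  by move=> s; have [a] := It_span (L s); exists a.
pose C : 'M[{fraction S}]_(r, size B) := \matrix_(s, i) tofrac (a s (nth 0%MM B i)).
have CQ : C *m Q = diag_mx (\row_s tofrac (ev (pts s) (L s))).
  apply/matrixP=> s t; rewrite !mxE.
  have -> : \sum_j C s j * Q j t = tofrac (ev (pts t) (L s)).
    have [ad al] := ha s; have := It_ev t al; rewrite rmorphB => /eqP.
    rewrite subr_eq0 => /eqP /= ->; rewrite ev_comb // rmorph_sum /= (big_nth 0%MM) big_mkord.
    by apply: eq_bigr => j _; rewrite !mxE -rmorphM.
  case: (eqVneq s t) => [->|st]; first by rewrite mulr1n.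
  by rewrite (proj1 (hL s)) 1?eq_sym // rmorph0 mulr0n.
have : \rank (C *m Q) = r.
  apply/eqP; rewrite -[_ == _]/(row_free _) row_free_unit unitmxE CQ det_diag.
  rewrite unitfE prodf_seq_neq0; apply/allP => s _; rewrite mxE /=.
  by rewrite tofrac_eq0; case: (hL s).
by move=> e; apply: leq_trans (mxrankM_maxr C Q); rewrite e.
Qed.

Lemma independent (a : 'X_{1..n} -> S) : (forall d, diffring (a d)) ->
  (forall s, ev (pts s) (\sum_(d <- B) a d * ypow d) = 0) ->
  forall d, d \in B -> a d = 0.
Proof.
move=> ha h d dB.
have Qfree : row_free Q.
  by rewrite /row_free eqn_leq rank_leq_row (leq_trans B_size eval_rank).
pose v : 'rV[{fraction S}]_(size B) := \row_i tofrac (a (nth 0%MM B i)).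
have : v *m Q = 0.
  apply/matrixP=> z s; rewrite [RHS]mxE mxE.
  have e : tofrac (ev (pts s) (\sum_(d <- B) a d * ypow d)) = 0.
    by rewrite h rmorph0.
  rewrite -[RHS]e ev_comb // rmorph_sum /= (big_nth 0%MM) big_mkord.
  by apply: eq_bigr => j _; rewrite !mxE -rmorphM.
move/eqP; rewrite mulmx_free_eq0 // => /eqP/matrixP/(_ 0 (Ordinal (_ : index d B < size B)%N)).
have lt : (index d B < size B)%N by rewrite index_mem.
move/(_ lt); rewrite !mxE /= nth_index // => /eqP; rewrite tofrac_eq0 => /eqP //.
Qed.

(** The coefficients of an element that vanishes at all points are zero by independence. So the size
    bound on [B] forces [It] to be the whole intersection of the kernels of the evaluations. *)
Lemma span_ker f : (forall s, ev (pts s) f = 0) -> It f.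
Proof.
move=> h; have [a ha hf] := It_span f.
suff e : \sum_(d <- B) a d * ypow d = 0 by rewrite e subr0 in hf.
rewrite big_seq big1 // => d dB; rewrite (independent ha) ?mul0r // => s.
by have := It_ev s hf; rewrite rmorphB /= h sub0r => /eqP; rewrite oppr_eq0 => /eqP.
Qed.

End Independence.
Definition tails : seq T :=
  [seq Tagged (fun i => 'I_(m_ i)) j | i <- enum 'I_n, j <- behead (enum 'I_(m_ i))].

Lemma enum_ord_head i : enum 'I_(m_ i) = Ordinal (m_gt0 i) :: behead (enum 'I_(m_ i)).
Proof.
have lt : (0 < size (enum 'I_(m_ i)))%N by rewrite size_enum_ord.
rewrite -[LHS]drop0 (drop_nth (Ordinal (m_gt0 i))) // drop1; congr (_ :: _).
by apply: val_inj; rewrite /= nth_enum_ord.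
Qed.

Lemma pol_diffsE : pol_diffs k m_ = [seq xv (hd (tag u)) - xv u | u <- tails].
Proof.
rewrite /pol_diffs /tails [RHS]map_flatten -[in RHS]map_comp; congr flatten.
apply: eq_map => i /=; rewrite -map_comp /block_vars enum_ord_head /= -map_comp.
by apply: eq_map => j /=.
Qed.

Lemma tailsP u : (u \in tails) = (u != hd (tag u)).
Proof.
case: u => i j; have := enum_uniq 'I_(m_ i); rewrite enum_ord_head /= => /andP[h0 _].
apply/allpairsPdep/idP => [[i' [j' [_ j't e]]]|ne].
  have ei : i' = i by have := congr1 tag e; rewrite /= => ->.
  subst i'; have /eqP ej : j == j' by move/eqP: e; rewrite eq_Tagged.
  by rewrite /= /hd eq_Tagged /= ej; apply: contraNneq h0 => <-.
exists i, j; split=> //; first by rewrite mem_enum.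
have : j \in enum 'I_(m_ i) by rewrite mem_enum.
rewrite enum_ord_head inE; case/orP => // /eqP ej.
by move: ne; rewrite /hd /= ej eqxx.
Qed.

Lemma tails_uniq : uniq tails.
Proof.
apply: allpairs_uniq_dep; first exact: enum_uniq.
  by move=> i _; have := enum_uniq 'I_(m_ i); rewrite enum_ord_head /= => /andP[].
by move=> [i j] [i' j'] _ _ /= e.
Qed.

Let kap j : {rmorphism S -> S} :=
  subst (fun v => if enum_val v \in take j tails then xv (hd (tag (enum_val v))) else 'X_v).

Lemma kap_xv j u : kap j (xv u) = if u \in take j tails then xv (hd (tag u)) else xv u.
Proof. by rewrite /kap /= substXU enum_rankK. Qed.

Lemma hd_tails j i : hd i \in take j tails = false.
Proof. by apply/negP=> /mem_take; rewrite tailsP eqxx. Qed.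

Lemma xv_inj : injective xv.
Proof.
move=> u v; rewrite /xv => /(congr1 (fun f : S => f@_U_(enum_rank v)%MM)).
rewrite !mcoeffXU eqxx (inj_eq enum_rank_inj); case: eqP => // _ /eqP.
by rewrite eq_sym oner_eq0.
Qed.

Lemma pol_diffs_regular0 : weakly_regular (@zero_ideal S) (pol_diffs k m_).
Proof.
rewrite pol_diffsE; apply: (@weakly_regular_kernel _ _ kap).
- move=> j f _; have := subst_id f => {1}<-.
  have iJ := adjoin_ideal (@zero_ideal S) (take j [seq xv (hd (tag u)) - xv u | u <- tails]).
  apply: subst_congr => // v; case: ifP => h; last by rewrite subrr; case: iJ.
  rewrite -opprB; apply: idealN => //; apply: adjoin_mem; rewrite -map_take.
  by apply/mapP; exists (enum_val v) => //; rewrite /xv enum_valK.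
- move=> j x _; rewrite -map_take => /mapP[u hu ->].
  by rewrite rmorphB /= !kap_xv hu hd_tails subrr.
move=> j; rewrite size_map => lt.
have [u0 _] : exists u : T, true by case: tails lt => // u ? _; exists u.
rewrite (nth_map u0) //; set u := nth u0 tails j.
have uT : u \in tails by apply: mem_nth.
rewrite rmorphB /= !kap_xv hd_tails ifF.
  by rewrite subr_eq0 (inj_eq xv_inj) eq_sym -tailsP.
apply/negP => h; have := tails_uniq.
rewrite -{1}(cat_take_drop j tails) cat_uniq => /and3P[_ /hasPn h' _].
by have := h' u; rewrite (drop_nth u0) // mem_head h => /(_ isT).
Qed.

Lemma depolarize_ker f : depolarize f = 0 -> ideal_gen (fun g => g \in pol_diffs k m_) f.
Proof.
move=> df; have iJ := ideal_gen_ideal (fun g : S => g \in pol_diffs k m_).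
have e0 : subst (fun v => xv (hd (tag (enum_val v)))) f = 0.
  have e : subst (fun i => xv (hd i)) (depolarize f) = 0 by rewrite df rmorph0.
  rewrite -[RHS]e depolarizeE subst_subst.
  rewrite !substE; apply: eq_bigr => p _; congr (_ *: _).
  by apply: eq_bigr => v _; rewrite substXU.
rewrite -[f]subr0 -e0 -{1}(subst_id f); apply: subst_congr => // v.
set u := enum_val v; case: (eqVneq u (hd (tag u))) => [uh|].
  by rewrite -uh /xv enum_valK subrr; case: iJ.
rewrite -tailsP => uT; rewrite -opprB; apply: idealN => //; apply: ideal_gen_in.
by rewrite pol_diffsE; apply/mapP; exists u => //; rewrite /xv enum_valK.
Qed.

Section Regular.
Variables (It : S -> Prop) (B : seq 'X_{1..n}).
Hypothesis It_ideal : is_ideal It.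
Hypothesis It_span : forall f, spanned It B f.
Variables (r : nat) (pts : 'I_r -> 'I_n -> T).
Hypothesis pts_valid : forall s, valid (pts s).
Hypothesis pts_neq : forall s t, s != t -> exists i, pts s i != pts t i.
Hypothesis It_ev : forall s f, It f -> ev (pts s) f = 0.
Hypothesis B_size : (size B <= r)%N.

Lemma pol_diffs_diffring j : diffring (pol_diffs k m_)`_j.
Proof.
rewrite pol_diffsE; case: (ltnP j (size tails)) => lt; last first.
  by rewrite nth_default ?size_map //; apply: (diffringC 0).
have [u0 _] : exists u : T, true by case: tails lt => // u ? _; exists u.
by rewrite (nth_map u0) //; apply: diffring_sub.
Qed.

(** The quotient by [It] is free over the ring of differences on the [ypow d], [d] in [B]. A
    relation therefore splits into one relation per basis element, an identity in the polynomial
    ring itself, where [pol_diffs_regular0] applies. *)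
Lemma pol_diffs_regular : weakly_regular It (pol_diffs k m_).
Proof.
set s := pol_diffs k m_; move=> j f lt h; have [I0 ID IM] := It_ideal.
have [c hc] := adjoinP It_ideal h.
have [a ha haI] := It_span f.
have /fin_all_exists[e he] : forall l : 'I_(size (take j s)), exists e : 'X_{1..n} -> S,
    (forall d, diffring (e d)) /\ It (c l - \sum_(d <- B) e d * ypow d).
  by move=> l; have [e he1 he2] := It_span (c l); exists e.
(* The coefficient of [ypow d] in [s_j * f] minus the given combination of the earlier elements. *)
pose z d := s`_j * a d - \sum_(l < size (take j s)) e l d * (take j s)`_l.
have szj : (size (take j s) <= size s)%N by rewrite size_take_min geq_minr.
have tk l : (take j s)`_l = s`_l \/ (take j s)`_l = 0.
  by case: (ltnP l j) => lj; [left; rewrite nth_take | right; rewrite nth_default // size_take_min geq_min lj].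
have diffN g : diffring g -> diffring (- g).
  by move=> hg; rewrite -mulN1r; apply: diffringM => // b vb; rewrite rmorphN rmorph1.
have hz d : diffring (z d).
  apply: diffringD; first by apply: diffringM => //; apply: pol_diffs_diffring.
  apply: diffN; apply: (big_ind diffring); [exact: (diffringC 0)|exact: diffringD|].
  move=> l _; apply: diffringM; first by have [] := he l.
  by case: (tk l) => ->; [apply: pol_diffs_diffring | apply: (diffringC 0)].
have zI : It (\sum_(d <- B) z d * ypow d).
  have -> : \sum_(d <- B) z d * ypow d = s`_j * f - \sum_(l < size (take j s)) c l * (take j s)`_l
     - s`_j * (f - \sum_(d <- B) a d * ypow d) 
     + \sum_(l < size (take j s)) (take j s)`_l * (c l - \sum_(d <- B) e l d * ypow d).
    under eq_bigr do rewrite mulrBl -mulrA.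
    rewrite sumrB -mulr_sumr.
    have -> : \sum_(d <- B) (\sum_(l < size (take j s)) e l d * (take j s)`_l) * ypow d =
       \sum_(l < size (take j s)) (take j s)`_l * \sum_(d <- B) e l d * ypow d.
      under eq_bigr do rewrite mulr_suml; rewrite exchange_big; apply: eq_bigr => l _.
      by rewrite mulr_sumr; apply: eq_bigr => d _; rewrite -mulrA mulrCA.
    set X := s`_j * (\sum_(i <- B) _); set Z := \sum_(l < _) _ * _.
    have -> : \sum_(l < size (take j s)) (take j s)`_l * (c l - \sum_(d <- B) e l d * ypow d)
        = \sum_(l < size (take j s)) c l * (take j s)`_l - Z.
      by rewrite -sumrB; apply: eq_bigr => l _; rewrite mulrBr [_ * c l]mulrC.
    rewrite mulrBr -/X; set P := s`_j * f; set W := \sum_(l < _) _.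
    have -> : P - W - (P - X) = X - W by rewrite opprB addrC addrA subrK.
    by rewrite addrA subrK.
  apply: ID; first by apply: idealB => //; apply: IM.
  by apply: ideal_sum => // l _; apply: IM; case: (he l).
have z0 d : d \in B -> z d = 0.
  apply: (independent It_span pts_valid pts_neq It_ev B_size hz) => t.
  exact: It_ev.
have iJ := adjoin_ideal It (take j s); have [J0 JD JM] := iJ.
rewrite -[f](subrK (\sum_(d <- B) a d * ypow d)); apply: JD; first exact: adjoin_sub.
apply: ideal_sum => // d dB; rewrite mulrC; apply: JM.
have : ideal_adjoin (@zero_ideal S) (take j s) (a d).
  apply: pol_diffs_regular0 => //.
  have /eqP := z0 d dB; rewrite subr_eq0 => /eqP ->.
  have iZ := adjoin_ideal (@zero_ideal S) (take j s).
  apply: ideal_sum => // l _; case: (iZ) => _ _; apply; apply: adjoin_mem.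
  by apply: mem_nth.
apply: adjoin_min => // [g ->|g]; [exact: J0 | exact: adjoin_mem].
Qed.

End Regular.
End Grid.

(** * Artinian quotients and depolarization *)

Section Artinian.
Local Open Scope ring_scope.
Import GRing.Theory.

Lemma min_nat (Q : nat -> Prop) : (exists r, Q r) ->
  exists2 r, Q r & forall r', Q r' -> (r <= r')%N.
Proof.
move=> [r]; elim: {r}_.+1 {-2}r (ltnSn r) => // b IH r; rewrite ltnS => lt Qr.
case: (classic (exists2 r', Q r' & (r' < r)%N)) => [[r' Q' lt']|h].
  by apply: (IH r') => //; apply: leq_trans lt' lt.
exists r => // r' Q'; rewrite leqNgt; apply/negP => lt'.
by apply: h; exists r'.
Qed.

(** The chosen matrix has the largest rank among those whose row space lies in [W]; a vector of [W]
    outside it would raise the rank. *)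
Lemma subspace_matrix (F : fieldType) N (W : 'rV[F]_N -> Prop) :
  W 0 -> (forall a u v, W u -> W v -> W (a *: u + v)) ->
  exists A : 'M[F]_N, forall v, W v <-> (v <= A)%MS.
Proof.
move=> W0 WL; have WZ a u : W u -> W (a *: u).
  by move=> hu; rewrite -[a *: u]addr0; apply: WL.
pose Q r := exists A : 'M[F]_N, (forall v : 'rV_N, (v <= A)%MS -> W v) /\ (N - \rank A)%N = r.
have [|r [A [hA er]] hmin] := @min_nat Q.
  by exists (N - \rank (0 : 'M[F]_N)%R)%N, (0 : 'M[F]_N)%R; split=> // v; rewrite submx0 => /eqP->.
exists A => v; split; last exact: hA.
move=> Wv; apply: contraT => nv.
have hs (w : 'rV_N) : (w <= A + v)%MS -> W w.
  case/sub_addsmxP=> -[x y] /= ->; rewrite addrC.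
  have -> : y *m v = y 0 0 *: v by rewrite [y]mx11_scalar mul_scalar_mx !mxE mulr1n.
  by apply: WL => //; apply: hA; apply: submxMl.
have := hmin (N - \rank (A + v)%MS)%N; rewrite -er => /(_ (ex_intro _ _ (conj hs erefl))).
have lt : (\rank A < \rank (A + v)%MS)%N.
  rewrite (ltn_leqif (mxrank_leqif_sup (addsmxSl A v))).
  by apply: contra nv; apply: submx_trans; apply: addsmxSr.
rewrite leqNgt => /negP; case; apply: ltn_sub2l => //.
by apply: leq_trans lt (rank_leq_col _).
Qed.

(** Modulo [I] every polynomial is a combination of monomials in [B], so each [J t] is determined by
    a subspace of a finite-dimensional space; from where its rank is least, the chain is
    constant. *)
Lemma artinian_of_monomials (k : fieldType) n (I : {mpoly k[n]} -> Prop)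
    (B : seq 'X_{1..n}) :
  is_ideal I -> (forall d, d \notin B -> I 'X_[d]) -> artinian_quotient I.
Proof.
move=> iI hB J iJ IJ dJ; set N := size (undup B).
pose vec (v : 'rV[k]_N) : {mpoly k[n]} := \sum_(i < N) v 0 i *: 'X_[nth 0%MM (undup B) i].
pose crd (f : {mpoly k[n]}) : 'rV[k]_N := \row_i f@_(nth 0%MM (undup B) i).
have vec_crd f : I (f - vec (crd f)).
  apply: (supp_gen iI) => p; rewrite mcoeff_msupp => hp; apply: hB; apply: contraNN hp => pB.
  rewrite mcoeffB subr_eq0; apply/eqP; rewrite /vec raddf_sum /=.
  have lt : (index p (undup B) < N)%N by rewrite index_mem mem_undup.
  rewrite (bigD1 (Ordinal lt)) //= big1 ?addr0; last first.
    move=> i ne; rewrite mcoeffZ mcoeffX; case: eqP => [e|]; last by rewrite mulr0.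
    case/eqP: ne; apply: val_inj => /=.
    by rewrite -e index_uniq // undup_uniq.
  by rewrite mcoeffZ mcoeffX mxE nth_index ?mem_undup // eqxx mulr1.
have dJle s t : (s <= t)%N -> sub_ideal (J t) (J s).
  elim: t => [|t IH]; first by rewrite leqn0 => /eqP->.
  rewrite leq_eqVlt => /orP[/eqP-> //|/IH h] f /dJ; exact: h.
have JA t : exists A : 'M[k]_N, forall v, J t (vec v) <-> (v <= A)%MS.
  have [J0 JD JM] := iJ t; apply: subspace_matrix.
    by rewrite /vec big1 // => i _; rewrite mxE scale0r.
  move=> a u v hu hv; have -> : vec (a *: u + v) = a%:MP * vec u + vec v.
    rewrite /vec mul_mpolyC scaler_sumr -big_split /=; apply: eq_bigr => i _.
    by rewrite !mxE scalerDl scalerA.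
  by apply: JD => //; apply: JM.
pose Q r := exists t, exists A : 'M[k]_N, (forall v, J t (vec v) <-> (v <= A)%MS) /\ \rank A = r.
have [|r [t0 [A0 [hA0 er]]] hmin] := @min_nat Q.
  by have [A hA] := JA 0%N; exists (\rank A), 0%N, A.
exists t0 => t le f; split; first exact: dJle.
move=> hf; have [A hA] := JA t.
have sub : (A <= A0)%MS.
  apply/row_subP => i; apply/hA0; apply: (dJle _ _ le); apply/hA; exact: row_sub.
have rk : (\rank A0 <= \rank A)%N by rewrite er; apply: hmin; exists t, A.
have sub' : (A0 <= A)%MS by rewrite -(mxrank_leqif_sup sub) eqn_leq rk mxrankS.
have [_ JD _] := iJ t.
rewrite -[f](subrK (vec (crd f))); apply: JD; first exact: IJ.
apply/hA; apply: submx_trans sub'; apply/hA0.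
have -> : vec (crd f) = f - (f - vec (crd f)) by rewrite opprB addrC subrK.
by apply: idealB => //; apply: IJ.
Qed.

End Artinian.

Section Criterion.
Local Open Scope ring_scope.
Import GRing.Theory.
Variables (k : fieldType) (n : nat) (m_ : 'I_n -> nat).
Hypothesis m_gt0 : forall i, (0 < m_ i)%N.
Local Notation T := (pol_idx m_).
Local Notation S := {mpoly k[#|pol_idx m_|]}.

Definition depolarized (It : S -> Prop) : {mpoly k[n]} -> Prop :=
  fun g => exists2 f, It f & depolarize f = g.

Lemma depolarized_mono (A : 'X_{1..#|T|} -> Prop) :
  eq_ideal (depolarized (mono_ideal A))
           (mono_ideal (fun d => exists2 p, A p & rdeg p = d)).
Proof.
move=> g; split=> [[f hf <-]|].
  rewrite depolarizeE; have iI := @mono_ideal_ideal k n (fun d => exists2 p, A p & rdeg p = d).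
  rewrite substE; apply: ideal_sum => // p /(proj1 (mono_idealP _ _) hf)[q Aq le].
  rewrite -mul_mpolyC -substX -depolarizeE depolarizeX; case: (iI) => _ _; apply.
  apply/mono_idealX; exists (rdeg q); first by exists q.
  by rewrite -(submK le) rdegD lem_addl.
apply: (ideal_gen_min (J := depolarized (mono_ideal A))); last first.
  move=> _ [d [p Ap <-] ->]; exists 'X_[p]; last by rewrite depolarizeX.
  by apply/mono_idealX; exists p => //; apply: lepm_refl.
have [I0 ID IM] := @mono_ideal_ideal k #|T| A.
split.
- by exists 0 => //; rewrite depolarizeE rmorph0.
- move=> _ _ [f hf <-] [f' hf' <-]; exists (f + f'); first exact: ID.
  by rewrite !depolarizeE rmorphD.
(* Substituting the head variables is a section of [depolarize], so multiples lift. *)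
move=> a _ [f hf <-]; exists (subst (fun i => xv k (hd m_gt0 i)) a * f); first exact: IM.
rewrite !depolarizeE rmorphM /=; congr (_ * _).
rewrite subst_subst -[RHS]subst_id !substE; apply: eq_bigr => p _; congr (_ *: _).
by apply: eq_bigr => i _; rewrite /xv substXU enum_rankK.
Qed.

End Criterion.

(** * Leading monomials *)

Section Leading.
Local Open Scope ring_scope.
Import GRing.Theory.
Variables (k : fieldType) (N : nat) (le : rel 'X_{1..N}).
Hypothesis hle : term_order le.
Implicit Types (f g : {mpoly k[N]}) (p q : 'X_{1..N}).

Lemma in_mon_seq (r : seq 'X_{1..N}) :
  let b := \big[(fun p q => if le p q then q else p)/0%MM]_(p <- r) p in
  (forall p, p \in r -> le p b) /\ (r != [::] -> b \in r).
Proof.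
elim: r => [|x r [h1 h2]] /=; first by split.
rewrite big_cons; set b := \big[_/_]_(p <- r) _ in h1 h2 *.
have hb : r == [::] -> b = 0%MM by move/eqP => e; rewrite /b e big_nil.
case: ifP => h; split=> [p|_].
- by rewrite inE => /orP[/eqP-> //|]; apply: h1.
(* For an empty tail [b] is the default exponent 0, the least one, so [le x b] forces [x = 0]. *)
- case: (boolP (r == [::])) => [/hb e|/h2 hr]; last by rewrite inE hr orbT.
  suff -> : b = x by rewrite mem_head.
  by apply: (to_anti hle) => //; rewrite e; case: hle.
- rewrite inE => /orP[/eqP->|/h1 hp]; first exact: to_refl.
  by apply: (to_trans hle) hp _; have := to_total hle x b; rewrite h.
exact: mem_head.
Qed.

Lemma in_mon_le f p : p \in msupp f -> le p (in_mon le f).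
Proof. by have [h _] := in_mon_seq (msupp f); apply: h. Qed.

Lemma in_mon_supp f : f != 0 -> in_mon le f \in msupp f.
Proof. by rewrite -msupp_eq0; have [_ h] := in_mon_seq (msupp f); apply: h. Qed.

Lemma in_mon_eq f p : p \in msupp f -> (forall q, q \in msupp f -> le q p) ->
  in_mon le f = p.
Proof.
move=> hp h; apply: (to_anti hle); last exact: in_mon_le.
by apply/h/in_mon_supp; apply: contraTneq hp => ->; rewrite msupp0.
Qed.

(** [p] only bounds the support and [c] may vanish; this keeps the notion additive when leading
    terms cancel. *)
Definition lead f p (c : k) : Prop := (forall q, q \in msupp f -> le q p) /\ f@_p = c.

Lemma lead_in_mon f : lead f (in_mon le f) f@_(in_mon le f).
Proof. by split=> // q; apply: in_mon_le. Qed.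

Lemma lead0 p : lead 0 p 0.
Proof. by split=> [q|]; rewrite ?msupp0 ?mcoeff0. Qed.

Lemma lead1 : lead 1 0%MM 1.
Proof.
by split=> [q|]; rewrite ?mcoeff1 ?eqxx // msupp1 inE => /eqP->; apply: to_refl.
Qed.

Lemma leadX p : lead 'X_[p] p 1.
Proof.
by split=> [q|]; rewrite ?mcoeffX ?eqxx // msuppX inE => /eqP->; apply: to_refl.
Qed.

Lemma lead_le f p q c : lead f p c -> le p q -> exists c', lead f q c'.
Proof. by move=> [h _] pq; exists f@_q; split=> // r /h hr; apply: (to_trans hle) hr pq. Qed.

Lemma leadN f p c : lead f p c -> lead (- f) p (- c).
Proof.
by move=> [h <-]; split=> [q|]; rewrite ?mcoeffN // (perm_mem (msuppN _)); apply: h.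
Qed.

Lemma leadD f g p c d : lead f p c -> lead g p d -> lead (f + g) p (c + d).
Proof.
move=> [h <-] [h' <-]; split=> [q|]; last by rewrite mcoeffD.
by move/msuppD_le; rewrite mem_cat => /orP[/h|/h'].
Qed.

Lemma lead_sum (T : finType) (P : pred T) (F : T -> {mpoly k[N]}) p :
  (forall t, P t -> exists c, lead (F t) p c) -> exists c, lead (\sum_(t | P t) F t) p c.
Proof.
move=> h; apply: (big_ind (fun f => exists c, lead f p c)) => //.
  by exists 0; apply: lead0.
by move=> f g [c hc] [d hd]; exists (c + d); apply: leadD.
Qed.

Lemma leadM f g p q c d : lead f p c -> lead g q d -> lead (f * g) (p + q)%MM (c * d).
Proof.
move=> [hf <-] [hg <-]; split.
  move=> r /msuppM_le/allpairsP[[a b] /= [/hf ha /hg hb ->]].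
  exact: to_add.
have term a : a \in msupp f -> (f@_a *: 'X_[a] * g)@_(p + q)%MM = if a == p then f@_p * g@_q else 0.
  move=> af; rewrite -scalerAl mcoeffZ; case: eqP => [->|ne].
    by rewrite ['X_[p] * g]mulrC mcoeffMX.
  case: (boolP ((p + q)%MM \in msupp ('X_[a] * g))) => [|/memN_msupp_eq0 ->]; last by rewrite mulr0.
  rewrite mulrC (perm_mem (msuppMX _ _)) => /mapP[b bg e].
  case: ne; apply: (to_anti hle); first exact: hf.
  by rewrite -(to_add2r hle q) e (to_add2l hle); exact: hg.
rewrite {1}(mpolyE f) mulr_suml raddf_sum /=.
rewrite (eq_big_seq _ term); case: (boolP (p \in msupp f)) => [pf|pf].
  rewrite (bigD1_seq p) //= eqxx big1 ?addr0 // => a /negbTE -> //.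
rewrite (memN_msupp_eq0 pf) mul0r big_seq big1 // => a af.
by case: eqP => // e; rewrite -e af in pf.
Qed.

Lemma leadXn f p c e : lead f p c -> lead (f ^+ e) (p *+ e)%MM (c ^+ e).
Proof.
move=> h; elim: e => [|e IH]; first by rewrite mulm0n !expr0; apply: lead1.
by rewrite mulmS !exprS; apply: leadM.
Qed.

Lemma lead_prod (T : finType) (F : T -> {mpoly k[N]}) (mu : T -> 'X_{1..N}) (c : T -> k) :
  (forall t, lead (F t) (mu t) (c t)) ->
  lead (\prod_t F t) (\sum_t mu t)%MM (\prod_t c t).
Proof.
move=> h; apply: (big_rec3 (fun f p c => lead f p c)); first exact: lead1.
by move=> t f p d _ hd; apply: leadM.
Qed.

Section DetMonomials.
Variables (r : nat) (w : 'I_r -> 'I_r -> 'X_{1..N}).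

Definition perm_mon (s : 'S_r) : 'X_{1..N} := (\sum_i w i (s i))%MM.

Let A : 'M[{mpoly k[N]}]_r := \matrix_(i, j) 'X_[w i j].

Lemma det_monE : \det A = \sum_(s : 'S_r) ((-1) ^+ s) *: 'X_[perm_mon s].
Proof.
apply: eq_bigr => s _; rewrite -mprodXE -mul_mpolyC rmorphXn /= mpolyCN mpolyC1.
by congr (_ * _); apply: eq_bigr => i _; rewrite mxE.
Qed.

Lemma det_mon_supp p : p \in msupp (\det A) -> exists s, p = perm_mon s.
Proof.
rewrite mcoeff_msupp det_monE raddf_sum /= => h.
case: (pickP (fun s => perm_mon s == p)) => [s /eqP <-|np]; first by exists s.
by case/eqP: h; rewrite big1 // => s _; rewrite mcoeffZ mcoeffX np mulr0.
Qed.

Lemma det_mon_coef s : injective perm_mon -> perm_mon s \in msupp (\det A).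
Proof.
move=> inj; rewrite mcoeff_msupp det_monE raddf_sum /= (bigD1 s) //= big1 ?addr0.
  by rewrite mcoeffZ mcoeffX eqxx mulr1 signr_eq0.
move=> t ts; rewrite mcoeffZ mcoeffX; case: eqP => [/inj e|]; last by rewrite mulr0.
by rewrite e eqxx in ts.
Qed.

End DetMonomials.
End Leading.

(** * Maximal minors *)

Section Minors.
Local Open Scope ring_scope.
Import GRing.Theory.
Variables (k : fieldType) (n m : nat) (n_gt0 : (0 < n)%N) (n_le_m : (n <= m)%N).
Variable le : rel 'X_{1..#|vars n m|}.
Hypothesis hle : term_order le.
Variable M : {set 'I_m} -> {ffun 'I_n -> 'I_m}.
Hypothesis M_optn : forall a : {set 'I_m}, #|a| = n -> optimal (@cell n m) le a (M a).

Local Notation R := {mpoly k[#|vars n m|]}.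
Local Notation cell := (@cell n m).

(** The columns come in an arbitrary order, since only supports are compared; this permits an
    expansion with a chosen column in first place. *)
Definition minor (f : 'I_n -> 'I_m) : R := \det (\matrix_(i, j) 'X_[cell i (f j)]).

Lemma minor_mon (f : 'I_n -> 'I_m) (s : 'S_n) :
  perm_mon (fun i j => cell i (f j)) s = weight cell [ffun i => f (s i)].
Proof. by apply: eq_bigr => i _; rewrite ffunE. Qed.

Lemma minor_mon_inj (f : 'I_n -> 'I_m) : injective f ->
  injective (perm_mon (fun i j => cell i (f j))).
Proof.
move=> fi s t; rewrite !minor_mon => /row_weight_inj/ffunP e.
by apply/perm.permP=> i; have := e i; rewrite !ffunE => /fi.
Qed.

Lemma minor_supp (f : 'I_n -> 'I_m) (a : {set 'I_m}) p : injective f ->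
  (forall j, f j \in a) -> p \in msupp (minor f) ->
  exists2 g, matching a g & p = weight cell g.
Proof.
move=> fi fa /det_mon_supp[s ->]; exists [ffun i => f (s i)]; last exact: minor_mon.
by split=> [i j|l]; rewrite !ffunE // => /fi/perm_inj.
Qed.

(** Distinct permutations give distinct monomials, so no term of the determinant cancels. *)
Lemma minor_top (f : 'I_n -> 'I_m) (a : {set 'I_m}) : injective f ->
  (forall j, f j \in a) -> #|a| = n -> weight cell (M a) \in msupp (minor f).
Proof.
move=> fi fa ca.
have mf : matching a [ffun j => f j].
  by split=> [i j|j]; rewrite !ffunE // => /fi.
have /fin_all_exists[s hs] : forall i, exists j, f j = M a i.
  move=> i; have [|j] := matching_surj _ mf (M_in M_optn i ca).
    by rewrite ca card_ord.
  by rewrite ffunE; exists j.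
have si : injective s.
  by move=> i j e; apply: (M_inj M_optn ca); rewrite -!hs e.
have -> : weight cell (M a) = perm_mon (fun i j => cell i (f j)) (perm si).
  rewrite minor_mon; congr weight; apply/ffunP=> i; rewrite ffunE permE hs //.
exact/det_mon_coef/minor_mon_inj.
Qed.

Lemma max_minorE (a : {set 'I_m}) : #|a| = n -> exists f : 'I_n -> 'I_m,
  [/\ injective f, forall j, f j \in a & max_minor k n a = minor f].
Proof.
move=> ca; have sz : size (enum a) = n by rewrite -cardE.
pose c0 : 'I_m := widen_ord n_le_m (Ordinal n_gt0).
exists (fun j => nth c0 (enum a) j); split.
- move=> i j /eqP; rewrite nth_uniq ?sz ?enum_uniq // => /eqP e; exact: val_inj.
- by move=> j; rewrite -mem_enum mem_nth ?sz.
by congr (\det _); apply/matrixP=> i j; rewrite !mxE (nth_map c0) ?sz // mxE.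
Qed.

Lemma in_max_minor (a : {set 'I_m}) : #|a| = n ->
  in_mon le (max_minor k n a) = weight cell (M a).
Proof.
move=> ca; have [f [fi fa ->]] := max_minorE ca.
apply: (in_mon_eq hle); first exact: minor_top.
by move=> p /(minor_supp fi fa)[g mg ->]; case: (M_optn ca) => _; apply.
Qed.

(** * Initial monomials of the ideal of maximal minors *)

Section Groebner.
Variable U : {set 'I_m}.
Hypothesis cardU : #|U|.+1 = n.

Let j0 : 'I_n := Ordinal n_gt0.
Let c0 : 'I_m := widen_ord n_le_m (Ordinal n_gt0).
Let u_ (t : 'I_n.-1) : 'I_m := nth c0 (enum U) t.

Let cU : size (enum U) = n.-1.
Proof. by rewrite -cardE -cardU. Qed.

Let u_inj : injective u_.
Proof.
move=> s t /eqP; rewrite nth_uniq ?cU ?enum_uniq // => /eqP e; exact: val_inj.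
Qed.

Let u_in t : u_ t \in U.
Proof. by rewrite -mem_enum mem_nth ?cU. Qed.

Let u_surj c : c \in U -> exists t, u_ t = c.
Proof.
move=> cin; have lt : (index c (enum U) < n.-1)%N by rewrite -cU index_mem mem_enum.
by exists (Ordinal lt); rewrite /u_ /= nth_index ?mem_enum.
Qed.

Let W (v : 'I_n -> R) : 'M[R]_n :=
  \matrix_(i, j) if unlift j0 j is Some t then 'X_[cell i (u_ t)] else v i.

Definition Delta (i : 'I_n) : R := cofactor (W (fun=> 0)) i j0.

Lemma W_expand v : \det (W v) = \sum_i v i * Delta i.
Proof.
rewrite (expand_det_col _ j0); apply: eq_bigr => i _.
rewrite mxE unlift_none; congr (_ * _); rewrite /Delta /cofactor; congr (_ * \det _).
by apply/matrixP=> r t; rewrite !mxE liftK.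
Qed.

Lemma Delta_orth c : c \in U -> \sum_i 'X_[cell i c] * Delta i = 0.
Proof.
move=> /u_surj[t <-]; rewrite -(W_expand (fun i => 'X_[cell i (u_ t)])) -det_tr.
apply: (@determinant_alternate _ _ _ j0 (lift j0 t)); first exact: neq_lift.
by move=> i; rewrite !mxE unlift_none liftK.
Qed.

Let wD i (r t : 'I_n.-1) := cell (lift i r) (u_ t).

Lemma DeltaE i : Delta i = (-1) ^+ (i + j0) * \det (\matrix_(r, t) 'X_[wD i r t]).
Proof.
by congr (_ * \det _); apply/matrixP=> r t; rewrite !mxE liftK.
Qed.

Lemma msupp_sign (e : nat) (f : R) : msupp ((-1) ^+ e * f) =i msupp f.
Proof.
by move=> p; rewrite !mcoeff_msupp -signr_odd mulr_sign; case: ifP => // _; rewrite mcoeffN oppr_eq0.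
Qed.

Lemma Delta_supp i p : p \in msupp (Delta i) ->
  forall l c, c \notin U -> p (enum_rank ((l, c) : vars n m)) = 0%N.
Proof.
rewrite DeltaE msupp_sign => /det_mon_supp[s ->] l c nc.
rewrite mnm_sumE big1 // => r _; rewrite cellE; case: (eqVneq (u_ (s r)) c) => [e|]; last by rewrite andbF.
by move: nc; rewrite -e u_in.
Qed.

Lemma Delta_neq0 i : Delta i != 0.
Proof.
have h : perm_mon (wD i) 1%g \in msupp (Delta i).
  rewrite DeltaE msupp_sign; apply: det_mon_coef => s t e.
  apply/perm.permP=> r; have := congr1 (fun p : 'X_{1.._} => p (enum_rank ((lift i r, u_ (s r)) : vars n m))) e.
  rewrite !mnm_sumE (bigD1 r) //= cellE !eqxx big1 /=; last first.
    by move=> r' ne; rewrite cellE (inj_eq lift_inj) (negbTE ne).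
  rewrite (bigD1 r) //= cellE eqxx big1 /=; last first.
    by move=> r' ne; rewrite cellE (inj_eq lift_inj) (negbTE ne).
  by case: eqP => // /u_inj ->.
by apply: contraTneq h => ->; rewrite msupp0.
Qed.

Let nu i := in_mon le (Delta i).
Let rX := rowX n_gt0 M U.

(** Expand the minor of [c |: U] along column [c]. Only the summand of row [l] involves the variable
    [(l, c)], because the cofactors use columns of [U] alone, so nothing cancels between summands,
    and the lead monomial comes from row [rowX U c]. *)
Lemma nu_le c i : c \notin U -> le (cell i c + nu i)%MM (cell (rX c) c + nu (rX c))%MM.
Proof.
move=> nc; have cc := cardU1n cardU nc.
pose f (j : 'I_n) := if unlift j0 j is Some t then u_ t else c.
have fi : injective f.
  move=> j j'; rewrite /f; case: unliftP => [t|] ->; case: unliftP => [t'|] -> //.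
  - by move/u_inj ->.
  - by move=> e; move: nc; rewrite -e u_in.
  - by move=> e; move: nc; rewrite e u_in.
have fa j : f j \in c |: U.
  by rewrite /f; case: unliftP => [t|] _; rewrite !inE ?eqxx ?u_in ?orbT.
have mE : minor f = \sum_l 'X_[cell l c] * Delta l.
  rewrite -W_expand; congr (\det _); apply/matrixP=> l j; rewrite !mxE /f.
  by case: unliftP.
have Dc l p : p \in msupp ('X_[cell l c] * Delta l) -> exists2 p', p' \in msupp (Delta l) &
    p = (cell l c + p')%MM.
  by rewrite mulrC (perm_mem (msuppMX _ _)) => /mapP[p' h ->]; exists p'.
have top : (cell i c + nu i)%MM \in msupp (minor f).
  rewrite mE mcoeff_msupp raddf_sum /= (bigD1 i) //= big1 ?addr0.
    rewrite mulrC mcoeffMX -mcoeff_msupp; exact: in_mon_supp (Delta_neq0 i).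
  move=> l li; apply: memN_msupp_eq0; apply/negP=> /Dc[p' hp'].
  move/(congr1 (fun p : 'X_{1.._} => p (enum_rank ((l, c) : vars n m)))).
  rewrite !mnmDE !cellE !eqxx (eq_sym i) (negbTE li) /=.
  by rewrite (Delta_supp (in_mon_supp hle (Delta_neq0 i))).
apply: (@to_trans _ _ hle (weight cell (M (c |: U)))).
  have [g mg ->] := minor_supp fi fa top.
  by case: (M_optn cc) => _; apply.
have := minor_top fi fa cc; rewrite mE mcoeff_msupp raddf_sum /= => h.
have [l hl] : exists l, weight cell (M (c |: U)) \in msupp ('X_[cell l c] * Delta l).
  case: (pickP (fun l => weight cell (M (c |: U)) \in msupp ('X_[cell l c] * Delta l))) => [l|np].
    by exists l.
  by case/eqP: h; rewrite big1 // => l _; apply: memN_msupp_eq0; rewrite np.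
have [p' hp' e] := Dc _ _ hl.
have : M (c |: U) l == c.
  move/(congr1 (fun p : 'X_{1.._} => p (enum_rank ((l, c) : vars n m)))): e.
  by rewrite row_weightE mnmDE cellE !eqxx; case: eqP.
rewrite (rowX_eq n_gt0 M_optn) // => /eqP el; rewrite e /rX el (to_add2l hle).
exact: in_mon_le.
Qed.

(** The cells of [X_U]. Orthogonality of column [c] to the cofactors is solved for the entry in row
    [rX c], which gives [num] and [den]; all other entries remain free variables. *)
Let special (v : 'I_#|vars n m|) : bool :=
  let: (l, c) := enum_val v : vars n m in (c \notin U) && (l == rX c).

Let num (v : 'I_#|vars n m|) : R :=
  let: (l, c) := enum_val v : vars n m in
  if special v then - \sum_(l' | l' != l) 'X_[cell l' c] * Delta l' else 'X_v.

Let den (v : 'I_#|vars n m|) : R := if special v then Delta (enum_val v).1 else 1.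

Let dmu (v : 'I_#|vars n m|) := if special v then nu (enum_val v).1 else 0%MM.

Lemma den_neq0 v : den v != 0.
Proof. by rewrite /den; case: ifP => _; rewrite ?oner_neq0 // Delta_neq0. Qed.

Lemma lead_den v : exists2 c, c != 0 & lead le (den v) (dmu v) c.
Proof.
rewrite /den /dmu; case: ifP => _; last by exists 1; [exact: oner_neq0 | exact: lead1].
exists (Delta (enum_val v).1)@_(nu (enum_val v).1); last exact: lead_in_mon.
by rewrite -mcoeff_msupp; apply/in_mon_supp/Delta_neq0.
Qed.

(** By [nu_le], every term of the numerator is bounded by ['X_v] times the lead monomial of the
    denominator: the substitution does not raise lead exponents. *)
Lemma lead_num v : exists c, lead le (num v) (U_(v) + dmu v)%MM c /\ (~~ special v -> c = 1).
Proof.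
have ev := enum_valK v; rewrite /num /dmu; case E: (enum_val v) => [l c] /=.
case: (boolP (special v)) => sv; last by exists 1; split=> //; rewrite addm0; apply: leadX.
move: (sv); rewrite /special E => /andP[nc /eqP el].
have -> : U_(v)%MM = cell l c by rewrite /cell -E ev.
have [d hd] : exists d, lead le (\sum_(l' | l' != l) 'X_[cell l' c] * Delta l')
    (cell l c + nu l)%MM d.
  apply: lead_sum => l' _; have h := leadM hle (leadX k hle (cell l' c)) (lead_in_mon hle (Delta l')).
  by apply: (lead_le hle h); rewrite el; apply: nu_le.
by exists (- d); split=> //; apply: leadN.
Qed.

(* Generic matrices whose columns are orthogonal to Delta: a point of the
   variety of I_n over the field of fractions. *)
Let psi : {rmorphism R -> {fraction R}} :=
  mmap (@tofrac R \o @mpolyC #|vars n m| k) (fun v => tofrac (num v) / tofrac (den v)).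

Lemma psiX v : psi 'X_v = tofrac (num v) / tofrac (den v).
Proof. by rewrite /psi /= mmapX mmap1U. Qed.

Lemma psi_orth c : \sum_l psi 'X_[cell l c] * tofrac (Delta l) = 0.
Proof.
have sE l : special (enum_rank ((l, c) : vars n m)) = (c \notin U) && (l == rX c).
  by rewrite /special enum_rankK.
have nonsp l : ~~ ((c \notin U) && (l == rX c)) -> psi 'X_[cell l c] = tofrac 'X_[cell l c].
  move=> h; rewrite /cell psiX /num /den enum_rankK sE (negbTE h).
  by rewrite rmorph1 divr1.
case: (boolP (c \in U)) => cin.
  rewrite -[RHS](rmorph0 (@tofrac R)) -(Delta_orth cin) rmorph_sum /=.
  by apply: eq_bigr => l _; rewrite [in RHS]rmorphM nonsp ?cin. 
rewrite (bigD1 (rX c)) //= {1}/cell psiX /num /den enum_rankK sE cin eqxx /=.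
rewrite divfK ?tofrac_eq0 ?Delta_neq0 // rmorphN rmorph_sum addrC /=.
apply/eqP; rewrite subr_eq0; apply/eqP/eq_bigr => l ne.
by rewrite [in RHS]rmorphM nonsp ?(negbTE ne) ?andbF.
Qed.

Lemma psi_minor f : psi (minor f) = 0.
Proof.
rewrite /minor -det_map_mx; apply/eqP/det0P; exists (\row_i tofrac (Delta i)).
  apply/eqP => /matrixP/(_ 0 j0)/eqP; rewrite !mxE tofrac_eq0.
  by rewrite (negbTE (Delta_neq0 _)).
apply/matrixP=> z j; rewrite !mxE -[RHS](psi_orth (f j)); apply: eq_bigr => i _.
by rewrite !mxE mulrC.
Qed.

Lemma psi_minors f : minors_ideal k n m f -> psi f = 0.
Proof.
apply: (ideal_gen_min (J := fun f => psi f = 0)).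
  split=> [|a b ha hb|a b hb]; [exact: rmorph0 | by rewrite rmorphD /= ha hb addr0 |].
  by rewrite rmorphM /= hb mulr0.
by move=> _ [a [/max_minorE[g [_ _ ->]] ->]]; apply: psi_minor.
Qed.

(** If the lead exponent [p] of [f] avoided [X_U], substituting and clearing denominators would turn
    each ['X_[s]] into a polynomial with exponents at most [s + kap], and with a nonzero coefficient
    there for [s = p]. That term could not cancel in the image of [f], yet [psi f = 0]. *)
Lemma in_minors_hit f : minors_ideal k n m f -> f != 0 ->
  exists2 c, c \notin U & in_mon le f (enum_rank ((rX c, c) : vars n m)) != 0%N.
Proof.
move=> If f0; set p := in_mon le f.
case: (boolP [exists c, (c \notin U) && (p (enum_rank ((rX c, c) : vars n m)) != 0%N)]).
  by case/existsP => c /andP[]; exists c.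
move=> /existsPn nop; exfalso.
have psp v : special v -> p v = 0%N.
  rewrite /special; case E: (enum_val v) => [l c] => /andP[nc /eqP el].
  have := nop c; rewrite nc /= negbK => /eqP; rewrite -el -E enum_valK //.
(* A bound for all exponents in [f], so that [den v ^+ K] clears every denominator and the shift
   [kap] is the same for all monomials. *)
pose K := (\max_(s <- msupp f) mdeg s)%N.
have sK (s : 'X_{1..#|vars n m|}) v : s \in msupp f -> (s v <= K)%N.
  move=> hs; apply: leq_trans (_ : (mdeg s <= K)%N); last first.
    by rewrite /K (big_rem s) //= leq_maxl.
  by rewrite mdegE (bigD1 v) //= leq_addr.
pose g (s : 'X_{1..#|vars n m|}) : R := \prod_v (num v ^+ s v * den v ^+ (K - s v)).
pose kap := (\sum_v dmu v *+ K)%MM.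
have [cn hcn] := fin_all_exists lead_num.
have /fin_all_exists[cd hcd] : forall v, exists c, c != 0 /\ lead le (den v) (dmu v) c.
  by move=> v; have [c] := lead_den v; exists c.
have gl s : s \in msupp f -> lead le (g s) (s + kap)%MM (\prod_v (cn v ^+ s v * cd v ^+ (K - s v))).
  move=> hs; have -> : (s + kap = \sum_v ((U_(v) + dmu v) *+ s v + dmu v *+ (K - s v)))%MM.
    rewrite {1}(multinomUE_id s) /kap -big_split /=; apply: eq_bigr => v _.
    apply/mnmP => x; rewrite !mnmDE !mulmnE mnmDE mulnDl -addnA -mulnDr.
    by rewrite subnKC // sK.
  apply: (lead_prod hle) => v; apply: (leadM hle); apply: (leadXn hle).
    by case: (hcn v).
  by case: (hcd v).
have sum0 : \sum_(s <- msupp f) f@_s *: g s = 0.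
  apply/eqP; rewrite -tofrac_eq0; apply/eqP.
  have := psi_minors If; rewrite /psi /= /mmap => e.
  transitivity (tofrac (\prod_v den v ^+ K) * 0); last by rewrite mulr0.
  rewrite -e mulr_sumr rmorph_sum /=; apply: eq_big_seq => s hs.
  rewrite -mul_mpolyC rmorphM /= mulrCA; congr (_ * _).
  rewrite !rmorph_prod /mmap1 -big_split /=; apply: eq_bigr => v _.
  rewrite rmorphM !rmorphXn /= expr_div_n mulrCA; congr (_ * _).
  rewrite -{2}(subnK (sK s v hs)) exprD mulfK // expf_neq0 // tofrac_eq0.
  exact: den_neq0.
have ps := in_mon_supp hle f0; rewrite -/p in ps.
have /eqP := congr1 (mcoeff (p + kap)%MM) sum0.
rewrite raddf_sum mcoeff0 (bigD1_seq p) //= big1_seq ?addr0 => [|s /andP[sp hs]]; last first.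
  rewrite mcoeffZ; have [hb _] := gl s hs.
  rewrite [(g s)@_ _]memN_msupp_eq0 ?mulr0 //; apply/negP => /hb.
  rewrite (to_add2r hle) => le1; have le2 := in_mon_le hle hs.
  by case/eqP: sp; apply: (to_anti hle).
have [_ eg] := gl p ps; rewrite mcoeffZ eg mulf_eq0 mcoeff_eq0 ps /=.
apply/negP; rewrite prodf_seq_neq0; apply/allP => v _; apply/implyP => _.
apply: mulf_neq0; last by apply: expf_neq0; case: (hcd v).
case: (boolP (special v)) => [/psp ->|nsv]; first by rewrite expr0 oner_neq0.
by have [_ ->] := hcn v; rewrite // expr1n oner_neq0.
Qed.

End Groebner.
End Minors.

(** * Covers of all the matchings *)

Definition rcount n m (X : {set 'I_n * 'I_m}) (i : 'I_n) : nat := #|[set c | (i, c) \in X]|.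

Lemma rcount_sum n m (X : {set 'I_n * 'I_m}) : \sum_i rcount X i = #|X|.
Proof.
rewrite -sum1_card (eq_bigl (fun e : 'I_n * 'I_m => xpredT e.1 && ((e.1, e.2) \in X))); last first.
  by case.
rewrite -(pair_big_dep xpredT (fun i c => (i, c) \in X) (fun _ _ => 1)) /=.
by apply: eq_bigr => i _; rewrite sum1dep_card.
Qed.

Lemma sub_degree n (d : 'X_{1..n}) q : q <= mdeg d ->
  exists2 d' : 'X_{1..n}, (d' <= d)%MM & mdeg d' = q.
Proof.
elim: {d}(mdeg d) {-2}d (erefl (mdeg d)) => [|e IH] d ed lt.
  exists d; first exact: lepm_refl.
  by move: lt; rewrite ed leqn0 => /eqP ->.
move: lt; rewrite leq_eqVlt => /orP[/eqP->|lt].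
  by exists d; first exact: lepm_refl.
have [i di] : exists i, d i != 0.
  case: (pickP (fun i => d i != 0)) => [i|h]; first by exists i.
  by move: ed; rewrite mdegE big1 // => i _; apply/eqP/negbFE/h.
have le1 : (U_(i) <= d)%MM by rewrite lep1mP.
have e2 : mdeg (d - U_(i))%MM = e.
  have : mdeg d = mdeg ((d - U_(i)) + U_(i))%MM by rewrite submK.
  by rewrite ed mdegD mdeg1 addn1 => -[].
have lt' : q <= mdeg (d - U_(i))%MM by rewrite e2 -ltnS -ed.
have [d' le' <-] := IH _ e2 lt'.
by exists d' => //; apply: lepm_trans le' (lem_subr _ _).
Qed.

Section DegreeList.
Variables (n q : nat).

Definition low_degrees : seq 'X_{1..n} := [seq bmnm d | d <- enum {: 'X_{1..n < q.+1}}].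

Lemma low_degreesP d : (d \in low_degrees) = (mdeg d <= q).
Proof.
apply/mapP/idP => [[b _ ->]|lt]; first by rewrite -ltnS; apply: bmdeg.
by exists (BMultinom (lt : mdeg d < q.+1)); rewrite ?mem_enum.
Qed.

Lemma low_degrees_uniq : uniq low_degrees.
Proof. by rewrite map_inj_uniq ?enum_uniq //; apply: val_inj. Qed.

Lemma size_low_degrees : size low_degrees = 'C(n + q, n).
Proof.
rewrite size_map -cardE -card_partial_ord_partitions.
have lt (d : 'X_{1..n < q.+1}) i : bmnm d i < q.+1.
  apply: leq_ltn_trans (bmdeg d); rewrite mdegE (bigD1 i) //=; exact: leq_addr.
pose f (d : 'X_{1..n < q.+1}) : n.-tuple 'I_q.+1 := [tuple Ordinal (lt d i) | i < n].
have fi : injective f.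
  move=> d d' e; apply: val_inj; apply/mnmP => i.
  by have := congr1 (fun t => val (tnth t i)) e; rewrite !tnth_mktuple.
rewrite -(card_imset _ fi); apply: eq_card => t; rewrite inE big_tuple.
apply/imsetP/idP => [[d _ ->]|lq].
  apply: leq_trans (_ : mdeg (bmnm d) <= q); last by rewrite -ltnS; apply: bmdeg.
  by rewrite mdegE; apply/eq_leq/eq_bigr => i _; rewrite tnth_mktuple.
have ld : mdeg [multinom (tnth t i : nat) | i < n] < q.+1.
  by rewrite ltnS mdegE; apply: leq_trans lq; apply/eq_leq/eq_bigr => i _; rewrite mnmE.
exists (BMultinom ld) => //; apply/eq_from_tnth => i; rewrite tnth_mktuple.
by apply: val_inj; rewrite /= mnmE.
Qed.

End DegreeList.

Section GridMonomials.
Variables (n : nat) (m_ : 'I_n -> nat) (m_gt0 : forall i, 0 < m_ i).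
Local Notation T := (pol_idx m_).

(** The missing degree of each row is made up with its head variable. *)
Lemma rdeg_fill (p : 'X_{1..#|T|}) (d : 'X_{1..n}) : (rdeg p <= d)%MM ->
  exists2 p', (p <= p')%MM & rdeg p' = d.
Proof.
move=> le; exists (p + \sum_i U_(enum_rank (hd m_gt0 i)) *+ (d i - rdeg p i))%MM.
  exact: lem_addr.
rewrite rdegD -[RHS](submK le) addmC; congr (_ + _)%MM.
have rs (r : seq 'I_n) (f : 'I_n -> 'X_{1..#|T|}) :
    rdeg (\sum_(i <- r) f i)%MM = (\sum_(i <- r) rdeg (f i))%MM.
  elim: r => [|i r IH]; last by rewrite !big_cons rdegD IH.
  by rewrite !big_nil; apply/mnmP => i; rewrite !mnmE big1 // => u _; rewrite mnm0E.
have rM (p1 : 'X_{1..#|T|}) e : rdeg (p1 *+ e)%MM = (rdeg p1 *+ e)%MM.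
  elim: e => [|e IH]; last by rewrite !mulmS rdegD IH.
  by rewrite !mulm0n; apply/mnmP => i; rewrite !mnmE big1 // => u _; rewrite mnm0E.
rewrite rs [RHS]multinomUE_id; apply: eq_bigr => i _.
by rewrite rM rdegU mnmBE.
Qed.

End GridMonomials.

Section GridEval.
Import GRing.Theory.
Local Open Scope ring_scope.
Variables (k : fieldType) (n : nat) (m_ : 'I_n -> nat).
Local Notation T := (pol_idx m_).

Lemma ev_mono (A : 'X_{1..#|T|} -> Prop) (b : 'I_n -> T) (f : {mpoly k[#|T|]}) :
  valid b -> (forall p, A p -> exists i, p (enum_rank (b i)) != 0%N) ->
  mono_ideal A f -> ev b f = 0.
Proof.
move=> vb hA; apply: (ideal_gen_min (J := fun f => ev b f = 0)).
  split=> [|g h hg hh|g h hh]; [exact: rmorph0 | by rewrite rmorphD /= hg hh addr0 |].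
  by rewrite rmorphM /= hh mulr0.
move=> _ [p /hA[i hi] ->]; rewrite /ev substX (bigD1 (enum_rank (b i))) //=.
by rewrite enum_rankK vb /xv subrr expr0n (negbTE hi) mul0r.
Qed.

End GridEval.

Section FullCover.
Variables (k : fieldType) (n m : nat) (n_gt0 : 0 < n) (n_le_m : n <= m).
Variable le : rel 'X_{1..#|vars n m|}.
Hypothesis hle : term_order le.
Variable M : {set 'I_m} -> {ffun 'I_n -> 'I_m}.
Hypothesis M_optn : forall a : {set 'I_m}, #|a| = n -> optimal (@cell n m) le a (M a).

Definition Xcells (U : {set 'I_m}) : {set 'I_n * 'I_m} :=
  [set e : 'I_n * 'I_m | (e.2 \notin U) && (rowX n_gt0 M U e.2 == e.1)].

Lemma rcountX (U : {set 'I_m}) i : #|U|.+1 = n -> rcount (Xcells U) i = dg M U i.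
Proof.
by move=> cU; rewrite (dgE n_gt0 M_optn) //; apply: eq_card => c; rewrite !inE.
Qed.

Lemma card_Xcells (U : {set 'I_m}) : #|U|.+1 = n -> #|Xcells U| = (m - n).+1.
Proof.
move=> cU; rewrite -rcount_sum -(dg_sum n_gt0 n_le_m M_optn cU).
by apply: eq_bigr => i _; apply: rcountX.
Qed.

Lemma Xcells_cover (U a : {set 'I_m}) : #|U|.+1 = n -> #|a| = n ->
  exists l, (l, M a l) \in Xcells U.
Proof.
move=> cU ca; have [l h1 /eqP h2] := X_cover hle M_optn cU ca.
by exists l; rewrite inE /= h1 /=; rewrite (rowX_eq n_gt0 M_optn) in h2.
Qed.

Lemma Xcells_below (d : 'X_{1..n}) : m - n < mdeg d ->
  exists2 U : {set 'I_m}, #|U|.+1 = n & forall i, rcount (Xcells U) i <= d i.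
Proof.
move=> lt; have [d' le' e] := sub_degree lt.
have [|U cU h] := dg_surj n_gt0 n_le_m hle M_optn (d := fun i => d' i).
  by rewrite -mdegE.
exists U => // i; rewrite rcountX // h; exact: (mnm_lepP le').
Qed.

Lemma nsets_card : #|[set a : {set 'I_m} | #|a| == n]| = 'C(m, n).
Proof. by rewrite card_draws card_ord. Qed.

Let m_gt0 (i : 'I_n) : 0 < m := leq_trans n_gt0 n_le_m.
Local Notation T := (pol_idx (fun _ : 'I_n => m)).

Let tg (e : 'I_n * 'I_m) : T := @Tagged _ e.1 (fun _ => 'I_m) e.2.

Let tg_inj : injective tg.
Proof. by move=> [i c] [i' c'] /(congr1 (fun u : T => (tag u, tagged u))). Qed.

(* The monomials of the X_U generate the whole Alexander dual, by span_ker. *)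
Lemma full_cover (X : {set 'I_n * 'I_m}) :
  (forall a : {set 'I_m}, #|a| = n -> exists l, (l, M a l) \in X) ->
  exists2 U : {set 'I_m}, #|U|.+1 = n & Xcells U \subset X.
Proof.
move=> hX; pose inm (Y : {set 'I_n * 'I_m}) : 'X_{1..#|T|} :=
  [multinom (((tag (enum_val v : T), tagged (enum_val v : T)) \in Y) : nat) | v < #|T|].
have inmE Y e : inm Y (enum_rank (tg e)) = (e \in Y) :> nat.
  by rewrite mnmE enum_rankK /=; case: e.
have rinm Y i : rdeg (inm Y) i = rcount Y i.
  rewrite mnmE (reindex_onto (fun c : 'I_m => tg (i, c)) (fun u => tagged u)) /=; last first.
    by move=> [i' c] /eqP /= ->.
  rewrite /rcount -sum1_card big_mkcond [RHS]big_mkcond /=; apply: eq_bigr => c _.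
  by rewrite !eqxx inmE inE; case: (_ \in _).
pose A p := exists2 U : {set 'I_m}, #|U|.+1 = n & p = inm (Xcells U).
pose It := mono_ideal (k := k) A; have iIt : is_ideal It by apply: mono_ideal_ideal.
(* There are ['C(m, n)] such degrees, as many as [n]-sets, that is, as points. *)
pose B := low_degrees n (m - n).
have hB d : d \notin B -> exists2 p, rdeg p = d & It 'X_[p].
  rewrite low_degreesP -ltnNge => /Xcells_below[U cU hU].
  have [|p le1 <-] := rdeg_fill m_gt0 (p := inm (Xcells U)) (d := d).
    by apply/mnm_lepP => i; rewrite rinm.
  by exists p => //; apply/mono_idealX; exists (inm (Xcells U)) => //; exists U.
pose Ns := [set a : {set 'I_m} | #|a| == n].
have NsP (s : 'I_#|Ns|) : #|enum_val s| = n by have := enum_valP s; rewrite inE => /eqP.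
pose pts (s : 'I_#|Ns|) (i : 'I_n) : T := tg (i, M (enum_val s) i).
have vpts s : valid (pts s) by [].
have npts s t : s != t -> exists i, pts s i != pts t i.
  move=> st; apply/existsP; apply: contraNT st; rewrite negb_exists => /forallP h.
  have eM i : M (enum_val s) i = M (enum_val t) i.
    by have := h i; rewrite negbK => /eqP/tg_inj [].
  have sub (s' t' : 'I_#|Ns|) : (forall i, M (enum_val s') i = M (enum_val t') i) ->
      enum_val s' \subset enum_val t'.
    move=> e; apply/subsetP=> c /(M_surj M_optn (NsP s'))[l <-].
    by rewrite e; exact: (M_in M_optn l (NsP t')).
  by apply/eqP/enum_val_inj/eqP; rewrite eqEsubset !sub.
have evIt s f : It f -> ev (pts s) f = 0%R.
  apply: ev_mono (vpts s) _ => _ [U cU ->].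
  have [l hl] := Xcells_cover cU (NsP s); exists l.
  by rewrite inmE hl.
have szB : size B <= #|Ns|.
  by rewrite size_low_degrees nsets_card subnKC.
have spn := span_all m_gt0 iIt (low_degrees_uniq n (m - n)) hB.
(* [X] meets every matching, so its monomial vanishes at every point and hence lies in the ideal of
   the [X_U]. *)
have : It 'X_[inm X].
  apply: (span_ker spn vpts npts evIt szB) => s.
  apply: (ev_mono (A := fun p => p = inm X)) => [//|_ ->|].
    have [l hl] := hX _ (NsP s); exists l.
    by rewrite inmE hl.
  by apply/mono_idealX; exists (inm X) => //; apply: lepm_refl.
case/mono_idealX=> _ [U cU ->] /mnm_lepP h; exists U => //.
apply/subsetP => e eU; have := h (enum_rank (tg e)); rewrite !inmE eU.
by case: (e \in X).
Qed.

End FullCover.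

(** * Covers of the matchings of a complex *)

Lemma pred_ext (T : Type) (A B : T -> Prop) : (forall x, A x <-> B x) -> A = B.
Proof.
by move=> h; apply: functional_extensionality => x; apply: propositional_extensionality.
Qed.

Lemma facets_dual n m (D : {set {set 'I_m}}) (a : {set 'I_m}) :
  (a \in facets (dual_complex n D)) = (#|a| == n) && (a \notin facets D).
Proof.
have inD (F : {set 'I_m}) : #|F| == n -> F \notin facets D -> forall G : {set 'I_m}, G \subset F ->
    G \in dual_complex n D.
  by move=> cF nF G GF; rewrite inE; apply/existsP; exists F; rewrite cF nF.
rewrite [LHS]inE; apply/maxsetP/andP => [[] | [ca na]].
  rewrite inE => /existsP[F /and3P[cF nF aF]] hmax.
  by rewrite -(hmax F (inD F cF nF F (subxx _)) aF).
split; first exact: inD ca na _ (subxx _).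
move=> B; rewrite inE => /existsP[F /and3P[cF nF BF]] aB; apply/eqP.
rewrite eq_sym eqEcard aB (eqP ca) -(eqP cF); exact: subset_leq_card.
Qed.

Section Small.
Variables (k : fieldType) (n m : nat) (n_gt0 : 0 < n) (n_le_m : n <= m).
Variable le : rel 'X_{1..#|vars n m|}.
Hypothesis hle : term_order le.
Variable M : {set 'I_m} -> {ffun 'I_n -> 'I_m}.
Hypothesis M_optn : forall a : {set 'I_m}, #|a| = n -> optimal (@cell n m) le a (M a).
Variable D : {set {set 'I_m}}.
Hypothesis D_card : forall a, a \in facets D -> #|a| = n.
Hypothesis D_neq0 : facets D != set0.
Implicit Types (a b : {set 'I_m}) (X : {set 'I_n * 'I_m}).

Local Notation m_ := (row_size k le D).
Local Notation T := (pol_idx (row_size k le D)).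
Local Notation wM a := (weight (@cell n m) (M a)).
Local Notation s2v := (@small_to_var k n m le D).

Lemma M_facet_inj a b : #|a| = n -> #|b| = n -> M a =1 M b -> a = b.
Proof.
move=> ca cb e; apply/eqP; rewrite eqEcard ca cb leqnn andbT.
by apply/subsetP => c /(M_surj M_optn ca)[l <-]; rewrite e; apply: (M_in M_optn l cb).
Qed.

Lemma wM_le a p : (wM a <= p)%MM <-> forall l, p (enum_rank ((l, M a l) : vars n m)) != 0.
Proof.
split=> [/mnm_lepP h l|h].
  by have := h (enum_rank ((l, M a l) : vars n m)); rewrite row_weightE eqxx lt0n.
apply/mnm_lepP => v; rewrite -[v]enum_valK; case: (enum_val v) => l c.
by rewrite row_weightE; case: eqP => [<-|] //; rewrite lt0n.
Qed.

Lemma wM_dvd a b : #|a| = n -> #|b| = n -> (wM a <= wM b)%MM -> a = b.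
Proof.
move=> ca cb /wM_le h; apply: M_facet_inj => // l; apply/esym/eqP.
by have := h l; rewrite row_weightE eqb0 negbK.
Qed.

Lemma rainE (C : {set {set 'I_m}}) : (forall a : {set 'I_m}, a \in facets C -> #|a| = n) ->
  rain k le C = mono_ideal (fun p => exists2 a : {set 'I_m}, a \in facets C & p = wM a).
Proof.
move=> hC; congr mono_ideal; apply: pred_ext => p.
by split=> [] [a aC ->]; exists a => //; rewrite (in_max_minor k n_gt0 n_le_m hle M_optn) ?hC.
Qed.

Lemma min_gens_rain (C : {set {set 'I_m}}) : (forall a : {set 'I_m}, a \in facets C -> #|a| = n) ->
  forall p, min_gens (rain k le C) p <-> exists2 a, a \in facets C & p = wM a.
Proof.
move=> hC p; rewrite rainE //; split=> [[/mono_idealX[_ [a aC ->] le1] hmin]|[a aC ->]].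
  exists a => //; apply/esym/hmin => //; apply/mono_idealX; exists (wM a); first by exists a.
  exact: lepm_refl.
split; first by apply/mono_idealX; exists (wM a); [exists a | apply: lepm_refl].
move=> q /mono_idealX[_ [b bC ->] le1] le2.
have e : b = a by apply: wM_dvd (lepm_trans le1 le2); apply: hC.
by apply/mnmP => v; apply/eqP; rewrite eqn_leq (mnm_lepP le2) -e (mnm_lepP le1).
Qed.

Lemma row_supportP i c : reflect (exists2 a, a \in facets D & M a i = c)
  (c \in row_support k le D i).
Proof.
rewrite inE; apply: (iffP exists_inP) => [] [a aD].
  rewrite (in_max_minor k n_gt0 n_le_m hle M_optn) ?D_card // row_weightE.
  by case: eqP => // <- _; exists a.
move=> e; exists a => //.
by rewrite (in_max_minor k n_gt0 n_le_m hle M_optn) ?D_card // row_weightE e eqxx.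
Qed.

Lemma row_size_gt0 i : 0 < m_ i.
Proof.
have /set0Pn[a aD] := D_neq0; rewrite card_gt0; apply/set0Pn; exists (M a i).
by apply/row_supportP; exists a.
Qed.

Lemma s2v_inj : injective s2v.
Proof.
move=> [i j] [i' j']; rewrite /small_to_var /= => e.
have ei : i = i' by case: e.
by subst i'; case: e => /enum_val_inj ->.
Qed.

Lemma s2v_tag u : (s2v u).1 = tag u.
Proof. by []. Qed.

Lemma s2v_supp u : (s2v u).2 \in row_support k le D (tag u).
Proof. exact: enum_valP. Qed.

Lemma s2v_surj i c : c \in row_support k le D i -> exists u : T, s2v u = (i, c).
Proof.
move=> ci; exists (Tagged (fun i => 'I_(m_ i)) (enum_rank_in ci c)).
by rewrite /small_to_var /= enum_rankK_in.
Qed.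

(** The implication sits inside the existential so that one choice function serves all sets; a
    non-facet gets an arbitrary variable. *)
Lemma facet_pt_ex (a : {set 'I_m}) i : exists u : T,
  a \in facets D -> s2v u = (i, M a i).
Proof.
case: (boolP (a \in facets D)) => aD; last by exists (hd row_size_gt0 i).
have [|u hu] := s2v_surj (i := i) (c := M a i); last by exists u.
by apply/row_supportP; exists a.
Qed.

(* [Acov p]: the support of p is a vertex cover of the matchings of D. *)
Definition Acov (p : 'X_{1..#|T|}) : Prop := forall a, a \in facets D ->
  exists2 u : T, p (enum_rank u) != 0 & s2v u = ((s2v u).1, M a (s2v u).1).

Lemma restrictE a u : @restrict_mon k n m le D (wM a) (enum_rank u)
  = (M a (s2v u).1 == (s2v u).2) :> nat.
Proof.
by rewrite mnmE enum_rankK; case E: (s2v u) => [l c]; rewrite row_weightE.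
Qed.

Lemma min_gens_small q : min_gens (rain_small k le D) q <->
  exists2 a, a \in facets D & q = @restrict_mon k n m le D (wM a).
Proof.
have -> : rain_small k le D = mono_ideal (fun q => exists2 a : {set 'I_m}, a \in facets D
    & q = @restrict_mon k n m le D (wM a)).
  congr mono_ideal; apply: pred_ext => p.
  by split=> [] [a aD ->]; exists a => //; rewrite (in_max_minor k n_gt0 n_le_m hle M_optn) ?D_card.
split=> [[/mono_idealX[_ [a aD ->] le1] hmin]|[a aD ->]].
  exists a => //; apply/esym/hmin => //; apply/mono_idealX.
  by exists (restrict_mon k le D (wM a)); [exists a | apply: lepm_refl].
split; first by apply/mono_idealX; exists (restrict_mon k le D (wM a)); [exists a | apply: lepm_refl].
move=> r /mono_idealX[_ [b bD ->] le1] le2.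
have e : b = a.
  apply: M_facet_inj; try exact: D_card; move=> l; apply/eqP.
  have [u hu] := facet_pt_ex b l; have := mnm_lepP (lepm_trans le1 le2) (enum_rank u).
  by rewrite !restrictE (hu bD) /= eqxx eq_sym; case: eqP.
by apply/mnmP => v; apply/eqP; rewrite eqn_leq (mnm_lepP le2) -e (mnm_lepP le1).
Qed.

Lemma rain_dualE : rain_dual k le D = mono_ideal Acov.
Proof.
congr mono_ideal; apply: pred_ext => p; split=> [h a aD|h q /min_gens_small[a aD ->]].
  have [d [d0 dp dq]] := h _ (proj2 (min_gens_small _) (ex_intro2 _ _ a aD erefl)).
  have [v dv] : exists v, d v != 0.
    apply/existsP; apply: contraNT d0; rewrite negb_exists => /forallP h0.
    by apply/eqP/mnmP => v; rewrite mnm0E; apply/eqP; have := h0 v; rewrite negbK.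
  exists (enum_val v).
    by rewrite enum_valK -lt0n; apply: leq_trans (mnm_lepP dp v); rewrite lt0n.
  have := mnm_lepP dq v; rewrite -[v]enum_valK restrictE enum_valK.
  case: eqP => [-> _|_]; first by case: (s2v _).
  by rewrite leqn0 (negbTE dv).
have [u pu eu] := h a aD; exists U_(enum_rank u)%MM; split.
- by rewrite mnm1_eq0.
- by rewrite lep1mP.
by rewrite lep1mP restrictE eu /= eqxx.
Qed.

Lemma Acov_pt p a : a \in facets D -> Acov p ->
  exists2 u : T, p (enum_rank u) != 0 & M a (tag u) = (s2v u).2.
Proof. by move=> aD /(_ _ aD)[u pu eu]; exists u => //; rewrite eu. Qed.

Lemma Acov_le p q : (p <= q)%MM -> Acov p -> Acov q.
Proof.
move=> le1 h a /h[u pu eu]; exists u => //.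
by rewrite -lt0n; apply: leq_trans (mnm_lepP le1 _); rewrite lt0n.
Qed.

(** Cells outside the small ring are dropped. Covering survives, since a facet matching uses only
    cells of the small ring, but row degrees may decrease. *)
Definition inS (X : {set 'I_n * 'I_m}) : 'X_{1..#|T|} :=
  [multinom ((s2v (enum_val v) \in X) : nat) | v < #|T|].

Lemma inSE X u : inS X (enum_rank u) = (s2v u \in X) :> nat.
Proof. by rewrite mnmE enum_rankK. Qed.

Lemma inS_cov X : (forall a, a \in facets D -> exists l, (l, M a l) \in X) -> Acov (inS X).
Proof.
move=> hX a aD; have [l hl] := hX a aD; have [u hu] := facet_pt_ex a l.
by exists u; rewrite ?inSE (hu aD) ?hl.
Qed.

Lemma rdeg_inS X i :
  rdeg (inS X) i = #|[set c | (c \in row_support k le D i) && ((i, c) \in X)]|.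
Proof.
pose A := [set u : T | (tag u == i) && (s2v u \in X)].
transitivity #|A|.
  rewrite mnmE -sum1dep_card big_mkcondr /=; apply: eq_bigr => u _.
  by rewrite inSE; case: (_ \in X).
have f_inj : {in A &, injective (fun u => (s2v u).2)}.
  move=> u v; rewrite !inE => /andP[/eqP tu _] /andP[/eqP tv _] e; apply: s2v_inj.
  rewrite [LHS]surjective_pairing [RHS]surjective_pairing; congr pair; last exact: e.
  by rewrite !s2v_tag tu tv.
rewrite -(card_in_imset f_inj); apply: eq_card => c; rewrite [RHS]inE.
apply/imsetP/andP => [[u] | [ci cX]].
  rewrite inE => /andP[/eqP tu uX] ->; rewrite -tu; split; first exact: (s2v_supp u).
  by rewrite -s2v_tag -surjective_pairing.
have [u hu] := s2v_surj ci; exists u; last by rewrite hu.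
by rewrite inE -s2v_tag hu eqxx.
Qed.

Lemma rdeg_inS_le X i : rdeg (inS X) i <= rcount X i.
Proof.
by rewrite rdeg_inS; apply: subset_leq_card; apply/subsetP => c; rewrite !inE => /andP[].
Qed.

End Small.

Lemma lem_mdeg_eq n (p q : 'X_{1..n}) : (p <= q)%MM -> mdeg q <= mdeg p -> p = q.
Proof.
move=> le1 le2; have e := submK le1; have : mdeg (q - p)%MM == 0.
  by move: le2; rewrite -{1}e mdegD -{2}[mdeg p]add0n leq_add2r leqn0.
by rewrite mdeg_eq0 => /eqP e0; rewrite -e e0 add0m.
Qed.

Lemma lem_anti n (p q : 'X_{1..n}) : (p <= q)%MM -> (q <= p)%MM -> p = q.
Proof.
by move=> h1 h2; apply/mnmP => i; apply/eqP; rewrite eqn_leq (mnm_lepP h1) (mnm_lepP h2).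
Qed.

Section Good.
Variables (k : fieldType) (n m : nat) (n_gt0 : 0 < n) (n_le_m : n <= m).
Variable le : rel 'X_{1..#|vars n m|}.
Hypothesis hle : term_order le.
Variable M : {set 'I_m} -> {ffun 'I_n -> 'I_m}.
Hypothesis M_optn : forall a : {set 'I_m}, #|a| = n -> optimal (@cell n m) le a (M a).
Variable D : {set {set 'I_m}}.
Hypothesis D_card : forall a, a \in facets D -> #|a| = n.
Hypothesis D_neq0 : facets D != set0.
Implicit Types (a b : {set 'I_m}) (X : {set 'I_n * 'I_m}).

Definition nonfacet a : bool := (#|a| == n) && (a \notin facets D).

Hypothesis D_sep : forall a b, nonfacet a -> nonfacet b -> a != b -> #|a :&: b| < n - 1.

Local Notation m_ := (row_size k le D).
Local Notation T := (pol_idx (row_size k le D)).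
Local Notation s2v := (@small_to_var k n m le D).
Local Notation Acov := (@Acov k n m le M D).
Local Notation inS := (@inS k n m le D).

Definition Ecells a : {set 'I_n * 'I_m} := [set e : 'I_n * 'I_m | Ea M a e.1 e.2].

Definition good a : Prop := {in Ecells a &, injective snd}.

Lemma nonfacet_card a : nonfacet a -> #|a| = n.
Proof. by case/andP => /eqP. Qed.

Lemma Ea_notin a l c : Ea M a l c -> c \notin a.
Proof. by case/andP. Qed.

Lemma snd_Ecells a : #|a| = n -> [set e.2 | e in Ecells a] = ~: a.
Proof.
move=> ca; apply/setP => c; rewrite inE; apply/imsetP/idP => [[e]|nc].
  by rewrite inE => /Ea_notin nc ->.
have [l hl] := Ea_ex n_gt0 M_optn ca nc; by exists (l, c) => //; rewrite inE.
Qed.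

Lemma card_setC_n a : #|a| = n -> #|~: a| = m - n.
Proof. by move=> ca; rewrite cardsCs setCK ca card_ord. Qed.

Lemma Ecells_ge a : #|a| = n -> m - n <= #|Ecells a|.
Proof. by move=> ca; rewrite -(card_setC_n ca) -snd_Ecells // leq_imset_card. Qed.

(** [E_a] projects onto the [m - n] columns outside [a], and a surjection of finite sets is
    injective exactly when the sizes agree. *)
Lemma goodP a : #|a| = n -> good a <-> #|Ecells a| = m - n.
Proof.
move=> ca; rewrite -(card_setC_n ca) -snd_Ecells //; split=> [/card_in_imset -> //|e].
by apply/imset_injP; rewrite e.
Qed.

(** The exchanged set shares [n - 1] columns with [a], so separation forbids it to be another
    non-facet. *)
Lemma swap_facet a l c : nonfacet a -> Ea M a l c -> c |: a :\ M a l \in facets D.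
Proof.
move=> na hE; have ca := nonfacet_card na; have nc := Ea_notin hE.
have Ml : M a l \in a := M_in M_optn l ca.
have cb := card_swap ca nc Ml; apply: contraT => nb.
have nfb : nonfacet (c |: a :\ M a l) by rewrite /nonfacet cb eqxx nb.
have ne : a != c |: a :\ M a l.
  by apply: contraNneq nc => ->; rewrite !inE eqxx.
have := D_sep na nfb ne; rewrite ltnNge => /negP; case.
have -> : n - 1 = #|a :\ M a l| by rewrite -[in LHS](cardD1n ca Ml) subn1.
by apply: subset_leq_card; apply/subsetP => x; rewrite !inE => /andP[-> ->]; rewrite orbT.
Qed.

Lemma Ecells_cover a b : nonfacet a -> b \in facets D -> exists l, (l, M b l) \in Ecells a.
Proof.
move=> na bD; have ne : a != b.
  by apply: contraTneq bD => <-; case/andP: na.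
have [l hl] := Ea_cover hle M_optn (nonfacet_card na) (D_card bD) ne.
by exists l; rewrite inE.
Qed.

Lemma Ecells_supp a l c : nonfacet a -> Ea M a l c -> c \in row_support k le D l.
Proof.
move=> na hE; apply/(row_supportP k n_gt0 n_le_m hle M_optn D_card).
exists (c |: a :\ M a l); first exact: swap_facet.
by rewrite (Ea_swap hle M_optn (nonfacet_card na) hE) eqxx.
Qed.

(** For a cell [(l, c)] of [E_a], the matching of the swapped facet agrees with [M a] except at
    [(l, c)]. A cover that misses [M a] can meet it only there. *)
Lemma Acov_E a (q : 'X_{1..#|T|}) : nonfacet a -> Acov q ->
  (forall u, q (enum_rank u) != 0 -> M a (tag u) != (s2v u).2) ->
  (inS (Ecells a) <= q)%MM.
Proof.
move=> na cq hq; apply/mnm_lepP => v; rewrite -[v]enum_valK inSE.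
case: (boolP (_ \in _)) => //; case E : (s2v _) => [l c]; rewrite inE /= => hE.
have [u qu eu] := Acov_pt (swap_facet na hE) cq.
move: eu; rewrite (Ea_swap hle M_optn (nonfacet_card na) hE).
case: eqP => [tu ec|_ ec]; last by have := hq u qu; rewrite ec eqxx.
suff -> : enum_val v = u by rewrite lt0n.
by apply: s2v_inj; rewrite E [RHS]surjective_pairing -ec s2v_tag tu.
Qed.

Lemma Acov_inE a : nonfacet a -> Acov (inS (Ecells a)).
Proof.
move=> na; refine (inS_cov k n_gt0 n_le_m hle M_optn D_card D_neq0 _) => b bD.
exact: Ecells_cover.
Qed.

Lemma Ecells_min a (q : 'X_{1..#|T|}) : nonfacet a -> Acov q ->
  (q <= inS (Ecells a))%MM -> q = inS (Ecells a).
Proof.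
move=> na cq leq; apply: lem_anti => //; apply: Acov_E => // u qu.
have : inS (Ecells a) (enum_rank u) != 0.
  by rewrite -lt0n; apply: leq_trans (mnm_lepP leq _); rewrite lt0n.
rewrite inSE eqb0 negbK inE => /Ea_notin.
by apply: contraNneq => <-; exact: (M_in M_optn _ (nonfacet_card na)).
Qed.

Lemma rdeg_inE a i : nonfacet a -> rdeg (inS (Ecells a)) i = rcount (Ecells a) i.
Proof.
move=> na; rewrite rdeg_inS.
apply: eq_card => c; rewrite !inE /=; apply: andb_idl => hE.
by have := Ecells_supp na hE; rewrite inE.
Qed.

Definition degE a : 'X_{1..n} := [multinom rcount (Ecells a) i | i < n].

Lemma rdegE a : nonfacet a -> rdeg (inS (Ecells a)) = degE a.
Proof. by move=> na; apply/mnmP => i; rewrite rdeg_inE // mnmE. Qed.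

Lemma mdeg_degE a : mdeg (degE a) = #|Ecells a|.
Proof. by rewrite mdegE -rcount_sum; apply: eq_bigr => i _; rewrite mnmE. Qed.

(* A cover of D with at most m - n elements misses n columns, hence some M_a,
   and then it must be E_a. *)
Lemma small_cover (q : 'X_{1..#|T|}) : Acov q -> mdeg q <= m - n ->
  exists a, [/\ nonfacet a, good a & rdeg q = degE a].
Proof.
move=> cq dq; pose Q := [set u : T | q (enum_rank u) != 0].
pose C := [set (s2v u).2 | u in Q].
have cC : #|C| <= m - n.
  apply: leq_trans (leq_imset_card _ _) _; apply: leq_trans dq.
  rewrite mdegE (reindex (@enum_rank T)) /=; last first.
    by exists enum_val => x _; rewrite ?enum_rankK ?enum_valK.
  rewrite -sum1_card big_mkcond /=; apply: leq_sum => u _; rewrite inE.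
  by rewrite -lt0n; case: (q _).
have [a aC ca] : exists2 a : {set 'I_m}, a \subset ~: C & #|a| = n.
  have lt : n <= #|~: C|.
    by rewrite cardsCs setCK card_ord leq_subRL ?(leq_trans cC) ?leq_subr // addnC -leq_subRL.
  have : 0 < #|[set B : {set 'I_m} | B \subset ~: C & #|B| == n]|.
    by rewrite cards_draws bin_gt0.
  by rewrite card_gt0 => /set0Pn[a]; rewrite inE => /andP[h /eqP e]; exists a.
have hq u : q (enum_rank u) != 0 -> M a (tag u) != (s2v u).2.
  move=> qu; have := subsetP aC _ (M_in M_optn (tag u) ca); rewrite inE.
  by apply: contraNneq => ->; apply: imset_f; rewrite inE.
have na : nonfacet a.
  rewrite /nonfacet ca eqxx /=; apply/negP => aD.
  by have [u qu eu] := Acov_pt aD cq; have := hq u qu; rewrite eu eqxx.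
have leE := Acov_E na cq hq.
have eq : inS (Ecells a) = q.
  apply: lem_mdeg_eq => //; rewrite -(mdeg_rdeg (inS _)) rdegE // mdeg_degE.
  exact: leq_trans dq (Ecells_ge ca).
exists a; split=> //; last by rewrite -eq rdegE.
apply/goodP => //; apply/eqP; rewrite eqn_leq Ecells_ge // andbT.
by rewrite -mdeg_degE -rdegE // mdeg_rdeg eq.
Qed.

Lemma good_uniq a : good a -> forall c l l', Ea M a l c -> Ea M a l' c -> l = l'.
Proof.
move=> ga c l l' h h'; have := ga (l, c) (l', c); rewrite !inE /= => /(_ h h' erefl).
by case.
Qed.

(** Adding one unit to the degrees of [E_a] and [E_b] gives those of [X_(a - M a i)] and
    [X_(b - M b j)]. If these agree, so do the two [(n-1)]-sets, and [a], [b] are too close to be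
    distinct non-facets. *)
Lemma degE_near a b i j : nonfacet a -> nonfacet b -> good a -> good b ->
  (degE a + U_(i) = degE b + U_(j))%MM -> a = b.
Proof.
move=> na nb ga gb e; apply/eqP; apply: contraT => ne.
have ca := nonfacet_card na; have cb := nonfacet_card nb.
have Ma := M_in M_optn i ca; have Mb := M_in M_optn j cb.
have eU : a :\ M a i = b :\ M b j.
  apply: (dg_inj n_gt0 hle M_optn); try exact: cardD1n.
  move=> l; rewrite !(Ea_dg M_optn) //; try exact: good_uniq.
  have dE x : degE x l = #|[set c | Ea M x l c]|.
    by rewrite mnmE; apply: eq_card => c; rewrite !inE.
  have := congr1 (fun p : 'X_{1..n} => p l) e; rewrite !mnmDE !dE !mnm1E.
  by rewrite ![_ == l]eq_sym.
have := D_sep na nb ne; rewrite ltnNge => /negP; case.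
have -> : n - 1 = #|a :\ M a i| by rewrite -[in LHS](cardD1n ca Ma) subn1.
apply: subset_leq_card; rewrite subsetI subD1set /= eU; exact: subD1set.
Qed.

End Good.

(** * Polarizations *)

Section Polarizations.
Import GRing.Theory.
Variables (k : fieldType) (n m : nat) (n_gt0 : 0 < n) (n_le_m : n <= m).
Variable le : rel 'X_{1..#|vars n m|}.
Hypothesis hle : term_order le.
Variable M : {set 'I_m} -> {ffun 'I_n -> 'I_m}.
Hypothesis M_optn : forall a : {set 'I_m}, #|a| = n -> optimal (@cell n m) le a (M a).
Variable D : {set {set 'I_m}}.
Hypothesis D_card : forall a : {set 'I_m}, a \in facets D -> #|a| = n.
Hypothesis D_neq0 : facets D != set0.
Hypothesis D_sep : forall a b : {set 'I_m},
  nonfacet n D a -> nonfacet n D b -> a != b -> #|a :&: b| < n - 1.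
Implicit Types (a b : {set 'I_m}) (X : {set 'I_n * 'I_m}).

Local Notation m_ := (row_size k le D).
Local Notation T := (pol_idx (row_size k le D)).
Local Notation s2v := (@small_to_var k n m le D).
Local Notation Acov := (@Acov k n m le M D).
Local Notation inS := (@inS k n m le D).
Local Notation nonfacet := (nonfacet n D).
Local Notation good := (good M).
Local Notation degE := (degE M).
Local Notation It := (rain_dual k le D).

Let m_gt0 : forall i, 0 < m_ i := row_size_gt0 k n_gt0 n_le_m hle M_optn D_card D_neq0.

Let ItE : It = mono_ideal Acov := rain_dualE k n_gt0 n_le_m hle M_optn D_card D_neq0.

Let nfs : {set {set 'I_m}} := [set a | nonfacet a].

Lemma card_facets : #|facets D| = 'C(m, n) - #|nfs|.
Proof.
rewrite -(nsets_card n m) -(cardsID (facets D) [set a : {set 'I_m} | #|a| == n]).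
have -> : [set a : {set 'I_m} | #|a| == n] :\: facets D = nfs.
  by apply/setP => a; rewrite in_setD in_set [in RHS]in_set andbC.
rewrite addnK; apply: eq_card => a; rewrite in_setI.
case: (boolP (a \in facets D)) => [/D_card ca|]; last by rewrite andbF.
by rewrite andbT in_set ca eqxx.
Qed.

Lemma cover_degree (d : 'X_{1..n}) : m - n < mdeg d ->
  exists U : {set 'I_m}, exists p : 'X_{1..#|T|},
    [/\ #|U|.+1 = n, Acov (inS (Xcells n_gt0 M U)), (inS (Xcells n_gt0 M U) <= p)%MM & rdeg p = d].
Proof.
move=> /(Xcells_below n_gt0 n_le_m hle M_optn)[U cU hU]; exists U.
have [|p le1 e] := rdeg_fill m_gt0 (p := inS (Xcells n_gt0 M U)) (d := d).
  by apply/mnm_lepP => i; apply: leq_trans (hU i); apply: rdeg_inS_le.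
exists p; split=> //.
refine (inS_cov k n_gt0 n_le_m hle M_optn D_card D_neq0 _) => a aD.
exact: (Xcells_cover n_gt0 hle M_optn cU (D_card aD)).
Qed.

Lemma depolarizedX (d : 'X_{1..n}) :
  depolarized It 'X_[d] <-> exists2 p, Acov p & (rdeg p <= d)%MM.
Proof.
rewrite ItE; have -> : depolarized (mono_ideal (k := k) Acov) =
    mono_ideal (fun d => exists2 p, Acov p & rdeg p = d).
  by apply: pred_ext => f; apply: depolarized_mono.
rewrite mono_idealX; split=> [[_ [p cp <-] h]|[p cp h]]; first by exists p.
by exists (rdeg p) => //; exists p.
Qed.

Section Good.
Hypothesis all_good : forall a, nonfacet a -> good a.

(** The candidate standard monomials. When the [degE a] are distinct and of degree [m - n], their
    removal leaves as many exponents as there are facets. *)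
Let B : seq 'X_{1..n} := [seq d <- low_degrees n (m - n) | d \notin [seq degE a | a in nfs]].

Lemma B_uniq : uniq B.
Proof. by rewrite filter_uniq ?low_degrees_uniq. Qed.

Lemma B_size : size B <= #|facets D|.
Proof.
have e := count_predC [pred d | d \in [seq degE a | a in nfs]] (low_degrees n (m - n)).
rewrite size_low_degrees subnKC // in e.
rewrite card_facets -e size_filter leq_subRL; last first.
  rewrite e -(nsets_card n m); apply: subset_leq_card; apply/subsetP => a.
  by rewrite !in_set => /andP[].
rewrite leq_add2r -size_filter cardE -(size_map degE); apply: uniq_leq_size.
  rewrite map_inj_in_uniq ?enum_uniq // => a b; rewrite !mem_enum !inE => na nb e'.
  apply: (degE_near n_gt0 hle M_optn D_sep (i := Ordinal n_gt0) (j := Ordinal n_gt0)) => //; try exact: all_good.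
  by rewrite e'.
move=> x /mapP[a]; rewrite mem_enum => ain ->; rewrite mem_filter /= image_f // low_degreesP.
rewrite mdeg_degE; move: ain; rewrite inE => na.
by rewrite (proj1 (goodP n_gt0 M_optn (nonfacet_card na)) (all_good na)) leqnn.
Qed.

Lemma B_cover d : d \notin B -> exists2 p, rdeg p = d & Acov p.
Proof.
rewrite mem_filter negb_and negbK => /orP[/imageP[a]|].
  rewrite inE => na ->; exists (inS (Ecells M a)).
    by rewrite (rdegE _ n_gt0 n_le_m hle M_optn D_card D_sep).
  exact: (Acov_inE k n_gt0 n_le_m hle M_optn D_card D_neq0 na).
rewrite low_degreesP -ltnNge => /cover_degree[U [p [cU cX le1 e]]].
by exists p => //; apply: Acov_le cX.
Qed.

Lemma good_regular : regular_on It (pol_diffs k m_).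
Proof.
have iIt : is_ideal It by rewrite ItE; apply: mono_ideal_ideal.
have hB d : d \notin B -> exists2 p, rdeg p = d & It 'X_[p].
  move=> /B_cover[p e cp]; exists p => //; rewrite ItE; apply/mono_idealX.
  by exists p => //; apply: lepm_refl.
have /fin_all_exists[pt hpt] := fun a => fin_all_exists
  (fun i => facet_pt_ex k n_gt0 n_le_m hle M_optn D_card D_neq0 a i).
pose pts (s : 'I_#|facets D|) := pt (enum_val s).
have sD (s : 'I_#|facets D|) : enum_val s \in facets D by apply: enum_valP.
have vpts s : valid (pts s).
  by move=> i; rewrite -s2v_tag /pts hpt.
have npts s t : s != t -> exists i, pts s i != pts t i.
  move=> st; apply/existsP; apply: contraNT st; rewrite negb_exists => /forallP h.
  apply/eqP/enum_val_inj; apply: (M_facet_inj M_optn (D_card (sD s)) (D_card (sD t))) => i.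
  have := h i; rewrite negbK => /eqP/(congr1 (fun u => s2v u)); rewrite /pts !hpt //.
  by case.
have evIt s f : It f -> ev (pts s) f = 0%R.
  rewrite ItE; apply: ev_mono (vpts s) _ => p cp.
  have [u pu eu] := Acov_pt (sD s) cp; exists (tag u).
  suff -> : pts s (tag u) = u by [].
  apply: s2v_inj; rewrite /pts hpt // eu [RHS]surjective_pairing //.
split; last first.
  have coefI : forall f, ideal_adjoin It (pol_diffs k m_) f -> (f@_0%MM = 0)%R.
    apply: (adjoin_min (J := fun f => (f@_0%MM = 0)%R)); first exact: coef0_ideal.
      rewrite ItE; apply: (ideal_gen_min (J := fun f => (f@_0%MM = 0)%R)); first exact: coef0_ideal.
      move=> _ [p cp ->]; rewrite mcoeffX; case: eqP => // p0.
      have /set0Pn[a aD] := D_neq0; have [u] := cp a aD.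
      by rewrite p0 mnm0E.
    move=> f; rewrite (pol_diffsE k m_gt0) => /mapP[u _ ->].
    by rewrite mcoeffB !mcoeffX !mnm1_eq0 subrr.
  by move/coefI/eqP; rewrite mcoeff1 eqxx oner_eq0.
have spn := span_all m_gt0 iIt B_uniq hB.
exact: (pol_diffs_regular iIt spn vpts npts evIt B_size).
Qed.

Lemma good_polarization : is_polarization (depolarized It) It.
Proof.
have iIt : is_ideal It by rewrite ItE; apply: mono_ideal_ideal.
have dE : depolarized It = mono_ideal (k := k) (fun d => exists2 p, Acov p & rdeg p = d).
  by apply: pred_ext => f; rewrite ItE; apply: depolarized_mono.
have [reg n1] := good_regular.
split.
- split.
  + by exists (fun d => exists2 p, Acov p & rdeg p = d) => f; rewrite dE.
  + apply: (artinian_of_monomials (B := B)); first by rewrite dE; apply: mono_ideal_ideal.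
    move=> d /B_cover[p e cp]; apply/depolarizedX; exists p => //.
    by rewrite e; apply: lepm_refl.
  (* Every variable of row [i] lies in the matching of some facet; a cover confined to row [i] can
     meet that matching only in this variable, so it contains the whole row. *)
  move=> i; have rowi (p : 'X_{1..#|T|}) : Acov p -> (rdeg p <= U_(i) *+ m_ i)%MM ->
      forall j : 'I_(m_ i), p (enum_rank (Tagged (fun i => 'I_(m_ i)) j : T)) != 0.
    move=> cp le1 j; set u : T := Tagged _ j.
    have /(row_supportP k n_gt0 n_le_m hle M_optn D_card)[a aD ea] := s2v_supp u.
    have [v pv ev] := Acov_pt aD cp.
    have tv : tag v = i.
      apply/eqP; apply: contraT => ne; have := mnm_lepP le1 (tag v).
      rewrite mulmnE mnm1E eq_sym (negbTE ne) mul0n leqn0 mnmE.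
      by rewrite (bigD1 v) //= addn_eq0 (negbTE pv).
    suff <- : v = u by [].
    apply: s2v_inj; rewrite [LHS]surjective_pairing [RHS]surjective_pairing; congr pair.
      exact: tv.
    by rewrite -ev tv ea.
  pose X := [set e : 'I_n * 'I_m | e.1 == i].
  have eX : rdeg (inS X) = (U_(i) *+ m_ i)%MM.
    apply/mnmP => l; rewrite rdeg_inS mulmnE mnm1E eq_sym.
    case: eqP => [->|ne]; rewrite ?mul1n ?mul0n /row_size.
      by apply: eq_card => c; rewrite in_set [(_, _) \in X]in_set /= eqxx andbT.
    apply: eq_card0 => c; rewrite in_set [(_, _) \in X]in_set /=.
    by apply/negP => /andP[_ /eqP el]; apply: ne.
  split.
    apply/depolarizedX; exists (inS X); last by rewrite eX; apply: lepm_refl.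
    refine (inS_cov k n_gt0 n_le_m hle M_optn D_card D_neq0 _) => a aD.
    by exists i; rewrite inE.
  move=> q /depolarizedX[p cp le1] le2; apply: lem_anti => //.
  apply: lepm_trans (le1); rewrite -eX.
  have leX : (inS X <= p)%MM.
    apply/mnm_lepP => v; rewrite -[v]enum_valK inSE.
    case: (boolP (_ \in X)) => //; rewrite inE => /eqP ti.
    rewrite lt0n; have := rowi p cp (lepm_trans le1 le2).
    by case: (enum_val v) ti => l j /= ti; subst l; apply.
  by rewrite -(submK leX) rdegD lem_addl.
- by split.
- by move=> f hf; exists f.
- by move=> g [f hf <-]; exists f.
(* The kernel of [depolarize] is generated by the differences, so this is the vanishing of Tor_1
   given by regularity. *)
move=> f hf /(depolarize_ker m_gt0) hs; exact: weakly_regular_mul.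
Qed.

End Good.

(* If |E_a| > m - n, the minimal generator of E_a and a multiple of the one of some
   X_U have the same depolarization; their difference would then be in sigma It,
   where the monomial of E_a does not occur. *)
Lemma polarization_good (I : {mpoly k[n]} -> Prop) a :
  is_polarization I It -> nonfacet a -> good a.
Proof.
move=> [_ _ _ _ ker] na; have ca := nonfacet_card na.
apply/(goodP n_gt0 M_optn ca)/eqP; rewrite eqn_leq (Ecells_ge n_gt0 M_optn ca) andbT.
rewrite leqNgt; apply/negP => lt.
have E_min (q : 'X_{1..#|T|}) := @Ecells_min k n m le hle M M_optn D D_sep a q na.
set e := inS (Ecells M a).
have eE : rdeg e = degE a by rewrite (rdegE _ n_gt0 n_le_m hle M_optn D_card D_sep).
have [|U [p [cU cX le1 ep]]] := @cover_degree (degE a); first by rewrite mdeg_degE.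
(* Otherwise minimality gives [E_a] inside [X_U], and [#|E_a| > m - n] gives equality; but [X_U]
   meets [M a] and [E_a] does not. *)
have ne : p != e.
  apply/negP => /eqP epe; rewrite epe in le1.
  have eX := E_min _ cX le1.
  have sub : Ecells M a \subset Xcells n_gt0 M U.
    apply/subsetP => -[l c]; rewrite inE /= => hE.
    have := Ecells_supp k n_gt0 n_le_m hle M_optn D_card D_sep na hE.
    case/s2v_surj => u hu; have := congr1 (fun p : 'X_{1.._} => p (enum_rank u)) eX.
    by rewrite !inSE hu [in RHS]inE hE; case: (_ \in Xcells _ _ _).
  have eEX : Ecells M a = Xcells n_gt0 M U.
    by apply/eqP; rewrite eqEcard sub (card_Xcells n_gt0 n_le_m M_optn cU).
  have [l] := Xcells_cover n_gt0 hle M_optn cU ca; rewrite -eEX inE.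
  by move/Ea_notin; rewrite (M_in M_optn l ca).
have ce : Acov e by apply: (Acov_inE k n_gt0 n_le_m hle M_optn D_card D_neq0 na).
have cp : Acov p by apply: Acov_le cX.
have Ip q : Acov q -> It 'X_[q].
  by move=> cq; rewrite ItE; apply/mono_idealX; exists q => //; apply: lepm_refl.
have iIt : is_ideal It by rewrite ItE; apply: mono_ideal_ideal.
have : ideal_mul (ideal_gen (fun g => g \in pol_diffs k m_)) It ('X_[e] - 'X_[p])%R.
  apply: ker; first by apply: idealB => //; apply: Ip.
  by rewrite depolarizeE rmorphB /= -!depolarizeE !depolarizeX eE ep subrr.
(* The proper multiples of cover monomials: the differences have no constant term, so elements of
   the product ideal involve only these. *)
pose P q := exists2 r, Acov r & (r <= q)%MM /\ r != q.
have P_up q r : P q -> P (r + q)%MM.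
  move=> [s cs [s1 s2]]; exists s => //; split; first exact: lepm_trans s1 (lem_addl _ _).
  apply: contraNneq s2 => es; apply/eqP; apply: lem_anti => //.
  by rewrite es; apply: lem_addl.
move/(ideal_gen_min (supp_ideal k P_up)) => H.
have /H/(_ e) : forall f, (exists x y, [/\ ideal_gen (fun g => g \in pol_diffs k m_) x, It y & f = (x * y)%R]) ->
    forall q, q \in msupp f -> P q.
  move=> f [x [y [hx hy ->]]] q /msuppM_le/allpairsP[[q1 q2] /= [h1 h2 ->]].
  have x0 : (x@_0%MM = 0)%R.
    apply: (ideal_gen_min (J := fun f => (f@_0%MM = 0)%R)) hx; first exact: coef0_ideal.
    move=> g; rewrite (pol_diffsE k m_gt0) => /mapP[u _ ->].
    by rewrite mcoeffB !mcoeffX !mnm1_eq0 subrr.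
  rewrite ItE in hy; have [r cr le2] := proj1 (mono_idealP _ _) hy q2 h2.
  exists r => //; split; first exact: lepm_trans le2 (lem_addl _ _).
  apply: contraTneq h1 => er; rewrite mcoeff_msupp negbK.
  suff -> : q1 = 0%MM by rewrite x0.
  apply/eqP; rewrite -mdeg_eq0 -leqn0 -(leq_add2r (mdeg q2)) add0n -mdegD -er.
  by rewrite -(submK le2) mdegD leq_addl.
case.
  by rewrite mcoeff_msupp mcoeffB !mcoeffX eqxx (negbTE ne) subr0 oner_eq0.
by move=> r cr [r1 /eqP r2]; apply: r2; apply: E_min.
Qed.

Lemma maximal_pow t (f : {mpoly k[n]}) :
  ideal_pow (maximal_ideal k n) t f <-> forall d, d \in msupp f -> t <= mdeg d.
Proof.
split.
  apply: (ideal_gen_min (J := fun f => forall d, d \in msupp f -> t <= mdeg d)).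
    by apply: supp_ideal => p q h; rewrite mdegD (leq_trans h) // leq_addl.
  move=> _ [x [hx ->]].
  have hx1 i : forall d, d \in msupp (x i) -> 0 < mdeg d.
    apply: (ideal_gen_min (J := fun f => forall d, d \in msupp f -> 0 < mdeg d)) (hx i).
      by apply: supp_ideal => p q h; rewrite mdegD (leq_trans h) // leq_addl.
    by move=> _ [j ->] d; rewrite msuppX inE => /eqP->; rewrite mdeg1.
  elim: t x hx hx1 => [|t IH] x hx hx1 d //.
  rewrite big_ord_recl => /msuppM_le/allpairsP[[d1 d2] /= [h1 h2 ->]].
  rewrite mdegD -add1n leq_add //; first exact: hx1 h1.
  by apply: IH h2 => i; [apply: hx | apply: hx1].
move=> h; have iP := ideal_gen_ideal (fun f => exists a : 'I_t -> {mpoly k[n]},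
  (forall i, maximal_ideal k n (a i)) /\ f = (\prod_(i < t) a i)%R).
apply: (supp_gen iP) => d /h; have [P0 PD PM] := iP => le1.
have [d' le' ed] := sub_degree le1.
rewrite -(submK le') mpolyXD; apply: PM; apply: ideal_gen_in.
elim: t d' ed {le' le1 h iP P0 PD} => [|t IH] d' ed.
  exists (fun=> 0%R); split=> [[]//|]; rewrite big_ord0.
  by move/eqP: ed; rewrite mdeg_eq0 => /eqP ->; rewrite mpolyX0.
have [j dj] : exists j, d' j != 0.
  case: (pickP (fun j => d' j != 0)) => [j|h]; first by exists j.
  by move: ed; rewrite mdegE big1 // => j _; apply/eqP/negbFE/h.
have le1 : (U_(j) <= d')%MM by rewrite lep1mP.
have ed' : mdeg (d' - U_(j))%MM = t.
  have : mdeg d' = mdeg ((d' - U_(j)) + U_(j))%MM by rewrite submK.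
  by rewrite ed mdegD mdeg1 addn1 => -[].
have [x [hx ex]] := IH _ ed'.
exists (fun i => oapp x 'X_j (unlift ord0 i)); split=> [i|].
  by case: unliftP => [i' _|_] /=; [apply: hx | apply: ideal_gen_in; exists j].
rewrite big_ord_recl unlift_none /= -{1}(submK le1) mpolyXD ex mulrC; congr (_ * _)%R.
by apply: eq_bigr => i _; rewrite liftK.
Qed.

End Polarizations.

(** * Powers of the maximal ideal, and grades of the colon ideals *)

Section Powers.
Variables (k : fieldType) (n m : nat) (n_gt0 : 0 < n) (n_le_m : n <= m).
Variable le : rel 'X_{1..#|vars n m|}.
Hypothesis hle : term_order le.
Variable M : {set 'I_m} -> {ffun 'I_n -> 'I_m}.
Hypothesis M_optn : forall a : {set 'I_m}, #|a| = n -> optimal (@cell n m) le a (M a).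
Variable D : {set {set 'I_m}}.
Hypothesis D_card : forall a : {set 'I_m}, a \in facets D -> #|a| = n.
Hypothesis D_neq0 : facets D != set0.
Hypothesis D_sep : forall a b : {set 'I_m},
  nonfacet n D a -> nonfacet n D b -> a != b -> #|a :&: b| < n - 1.
Implicit Types (a b : {set 'I_m}).
Local Notation It := (rain_dual k le D).
Local Notation nonfacet := (nonfacet n D).
Local Notation wM a := (weight (@cell n m) (M a)).

(** The power is [m - n + 1]: without non-facets, [small_cover] leaves no cover of degree at most
    [m - n], and the [X_U] reach every larger degree vector. *)
Lemma no_nonfacet_power : (forall a, ~~ nonfacet a) -> is_power_polarization It.
Proof.
move=> nf; have ag a : nonfacet a -> good M a by rewrite (negbTE (nf a)).
have := good_polarization k n_gt0 n_le_m hle M_optn D_card D_neq0 D_sep ag.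
suff -> : depolarized It = ideal_pow (maximal_ideal k n) (m - n).+1 by exists (m - n).+1.
apply: pred_ext => f; have dX := depolarizedX k n_gt0 n_le_m hle M_optn D_card D_neq0.
have iI : is_ideal (depolarized It).
  have -> : depolarized It = mono_ideal (k := k) (fun d => exists2 p, @Acov k n m le M D p & rdeg p = d).
    apply: pred_ext => g; rewrite (rain_dualE k n_gt0 n_le_m hle M_optn D_card D_neq0).
    exact: (depolarized_mono (row_size_gt0 k n_gt0 n_le_m hle M_optn D_card D_neq0)).
  exact: mono_ideal_ideal.
rewrite maximal_pow; split=> [|h].
  rewrite (rain_dualE k n_gt0 n_le_m hle M_optn D_card D_neq0) => hf d.
  have m_gt0 := row_size_gt0 k n_gt0 n_le_m hle M_optn D_card D_neq0.
  move/(proj1 (mono_idealP _ _) (proj1 (depolarized_mono m_gt0 _ f) hf)) => [_ [p cp <-] le1].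
  rewrite ltnNge; apply/negP => le2.
  have [|a [na _ _]] := small_cover n_gt0 n_le_m hle M_optn D_card D_sep cp.
    rewrite -mdeg_rdeg; apply: leq_trans le2.
    by rewrite -(submK le1) mdegD leq_addl.
  by rewrite (negbTE (nf a)) in na.
apply: (supp_gen iI) => d /h lt; apply/dX.
have [U [p [cU cX le1 e]]] := cover_degree k n_gt0 n_le_m hle M_optn D_card D_neq0 lt.
by exists p; [apply: Acov_le cX | rewrite e; apply: lepm_refl].
Qed.

(** A non-facet [a] puts a monomial of degree [m - n] in the ideal, so a power of the maximal ideal
    contains all of that degree. Moving one unit of [degE M a] from row [i] to another row [j]
    gives, by [small_cover], the degree of some [E_b]; [degE_near] then forces [b = a], although the
    degrees differ. *)
Lemma power_no_nonfacet a : 1 < n -> is_power_polarization It -> ~~ nonfacet a.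
Proof.
move=> n_gt1 [t ht]; apply/negP => na.
have ag b : nonfacet b -> good M b.
  exact: (polarization_good n_gt0 n_le_m hle M_optn D_card D_neq0 D_sep ht).
have dgE b : nonfacet b -> mdeg (degE M b) = m - n.
  move=> nb; rewrite mdeg_degE; apply/(goodP n_gt0 M_optn (nonfacet_card nb)); exact: ag.
have [_ _ hd hs _] := ht.
have powE d : depolarized It 'X_[d] <-> t <= mdeg d.
  split=> [[f /hd hf ef]|le1].
    by move: hf; rewrite ef maximal_pow => /(_ d); apply; rewrite msuppX inE.
  by apply: hs; apply/maximal_pow => d'; rewrite msuppX inE => /eqP->.
have dX := depolarizedX k n_gt0 n_le_m hle M_optn D_card D_neq0.
have le_t : t <= m - n.
  rewrite -(dgE a na); apply/powE/dX; exists (inS k le D (Ecells M a)).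
    exact: (Acov_inE k n_gt0 n_le_m hle M_optn D_card D_neq0 na).
  by rewrite (rdegE k n_gt0 n_le_m hle M_optn D_card D_sep na); apply: lepm_refl.
(* If [n = m], the full set is the only [n]-set and it is already a facet. *)
have n_lt_m : n < m.
  rewrite ltn_neqAle n_le_m andbT; apply/negP => /eqP enm.
  have full b : #|b| = n -> b = setT.
    by move=> cb; apply/eqP; rewrite eqEcard subsetT cardsT card_ord cb enm leqnn.
  have /set0Pn[b bD] := D_neq0; case/andP: na => /eqP ca.
  by rewrite (full a ca) -(full b (D_card bD)) bD.
have [i di] : exists i, degE M a i != 0.
  case: (pickP (fun i => degE M a i != 0)) => [i|h]; first by exists i.
  have : mdeg (degE M a) == 0.
    by rewrite mdegE big1 // => i _; apply/eqP/negbFE/h.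
  by rewrite dgE // subn_eq0 leqNgt n_lt_m.
have [j ji] : exists j : 'I_n, j != i.
  have : 0 < #|~: [set i]| by rewrite cardsC1 card_ord -subn1 subn_gt0.
  by rewrite card_gt0 => /set0Pn[j]; rewrite !inE; exists j.
have le1 : (U_(i) <= degE M a)%MM by rewrite lep1mP.
pose d' := (degE M a - U_(i) + U_(j))%MM.
have ed : (d' + U_(i) = degE M a + U_(j))%MM.
  by rewrite /d' -addmA [(U_(j) + _)%MM]addmC addmA submK.
have dd' : mdeg d' = m - n.
  by have := congr1 (@mdeg n) ed; rewrite !mdegD !mdeg1 dgE // !addn1 => -[].
have [p cp lep] : exists2 p, @Acov k n m le M D p & (rdeg p <= d')%MM.
  by apply/dX/powE; rewrite dd'.
have [|b [nb gb eb]] := small_cover n_gt0 n_le_m hle M_optn D_card D_sep cp.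
  rewrite -mdeg_rdeg -dd' -(submK lep) mdegD; exact: leq_addl.
have ebd : degE M b = d'.
  by apply: lem_mdeg_eq; [rewrite -eb | rewrite dd' (dgE b nb)].
have e : b = a.
  by apply: (degE_near n_gt0 hle M_optn D_sep nb na gb (ag a na) (i := i) (j := j)); rewrite ebd ed.
have := congr1 (fun p : 'X_{1..n} => p i) ebd; rewrite e /d' mnmDE mnmBE !mnm1E eqxx (negbTE ji) addn0.
by move=> h; move: di; rewrite -lt0n -ltn_predL -subn1 -h ltnn.
Qed.

(** The colon ideal is generated by the variables of [E_a]. What remains of in[b] after removing its
    common part with in[a] contains such a variable, since [E_a] covers [M b] and avoids the columns
    of [a]; and the swapped facet of a cell of [E_a] leaves exactly its variable. *)
Lemma colon_grade a : nonfacet a ->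
  has_grade (colon (rain k le D) 'X_[wM a]) #|Ecells M a|.
Proof.
move=> na; have ca := nonfacet_card na.
pose vs := [seq enum_rank (e : vars n m) | e <- enum (Ecells M a)].
have -> : #|Ecells M a| = size vs by rewrite size_map cardE.
apply: variable_ideal_grade => [|f].
  by rewrite map_inj_uniq ?enum_uniq //; apply: enum_rank_inj.
rewrite /colon (rainE k n_gt0 n_le_m hle M_optn D_card) mono_idealP.
have key (p : 'X_{1..#|vars n m|}) : has (fun v => p v != 0) vs <->
    exists2 q, (exists2 b, b \in facets D & q = wM b) & (q <= p + wM a)%MM.
  split=> [/hasP[v /mapP[[l c]]]|[_ [b bD ->] /wM_le le1]].
    rewrite mem_enum inE /= => hE -> pv.
    have bD := swap_facet M_optn D_sep na hE.
    exists (wM (c |: a :\ M a l)); first by exists (c |: a :\ M a l).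
    apply/wM_le => l'; rewrite (Ea_swap hle M_optn ca hE) mnmDE addn_eq0 negb_and.
    case: (l' =P l) => [->|_] /=; first by rewrite pv.
    by rewrite row_weightE eqxx orbT.
  have [l hl] := Ecells_cover hle M_optn D_card na bD.
  apply/hasP; exists (enum_rank ((l, M b l) : vars n m)).
    by apply/mapP; exists (l, M b l); rewrite ?mem_enum.
  have := le1 l; rewrite mnmDE row_weightE.
  move: hl; rewrite inE => /Ea_notin; case: (M a l =P M b l) => [<-|_ _]; last by rewrite addn0.
  by rewrite (M_in M_optn l ca).
split=> [h p pf|h p].
  by apply/key/h; rewrite (perm_mem (msuppMX _ _)) addmC map_f.
rewrite (perm_mem (msuppMX _ _)) => /mapP[q /h hq ->]; rewrite addmC.
exact/key.
Qed.

End Powers.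

Theorem corollary6p6 (k : fieldType) (n m : nat) (hn : 0 < n) (hnm : n <= m)
    (le : rel 'X_{1..#|vars n m|}) (hle : term_order le)
    (D : {set {set 'I_m}})
    (hD : simplicial_complex D) (hpure : pure_with n D)
    (hdual : forall s t, s \in facets (dual_complex n D) ->
       t \in facets (dual_complex n D) -> s != t -> #|s :&: t| < n - 1) :
  (is_artinian_polarization (rain_dual k le D) <->
     forall g, min_gens (rain k le (dual_complex n D)) g ->
       has_grade (colon (rain k le D) 'X_[g]) (m - n))
  /\
  (is_artinian_polarization (rain_dual k le D) ->
     (is_power_polarization (rain_dual k le D) <->
        #|facets (dual_complex n D)| = 0)
     /\
     (#|facets (dual_complex n D)| = 0 <->
        eq_ideal (rain k le D) (in_ideal le (minors_ideal k n m)))).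
Proof.
have [D_neq0 D_card] := hpure.
have nfE a : (a \in facets (dual_complex n D)) = nonfacet n D a by apply: facets_dual.
have D_sep a b : nonfacet n D a -> nonfacet n D b -> a != b -> #|a :&: b| < n - 1.
  by rewrite -!nfE; apply: hdual.
have dual_card (a : {set 'I_m}) : a \in facets (dual_complex n D) -> #|a| = n.
  by rewrite nfE => /nonfacet_card.
have nf0 : #|facets (dual_complex n D)| = 0 <-> forall a, ~~ nonfacet n D a.
  split=> [/eqP|h]; first by rewrite cards_eq0 => /eqP e a; rewrite -nfE e inE.
  by apply: eq_card0 => a; rewrite nfE (negbTE (h a)).
(* For [n = 1] every singleton is a face, as all of [m] are vertices, hence a facet by purity, and
   no non-facet is left. *)
have n_gt1 a : nonfacet n D a -> 1 < n.
  rewrite ltn_neqAle hn andbT => na; apply/eqP => n1.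
  have ca := nonfacet_card na; have : #|a| == 1 by rewrite ca -n1.
  case/cards1P => v ev; case: hD => [_ /(_ v) vD].
  have [F maxF vF] := maxset_exists vD.
  have FD : F \in facets D by rewrite inE.
  have eF : [set v] = F.
    by apply/eqP; rewrite eqEcard vF cards1 (D_card _ FD) -n1.
  by case/andP: na => _; rewrite ev eF FD.
have [M M_optn] : exists M : {set 'I_m} -> {ffun 'I_n -> 'I_m},
    forall a : {set 'I_m}, #|a| = n -> optimal (@cell n m) le a (M a).
  have : forall a : {set 'I_m}, exists g, #|a| = n -> optimal (@cell n m) le a g.
    move=> a; case: (#|a| =P n) => [ca|ne].
      have [|g hg] := @optimal_ex _ _ _ (@cell n m) _ hle a; first by rewrite ca card_ord.
      by exists g.
    by exists [ffun i => widen_ord hnm i] => /ne.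
  by move/fin_all_exists => [M hM]; exists M.
have goods : is_artinian_polarization (rain_dual k le D) <->
    forall a, nonfacet n D a -> good M a.
  split=> [[I hI] a|ag].
    exact: (polarization_good hn hnm hle M_optn D_card D_neq0 D_sep hI).
  exists (depolarized (rain_dual k le D)).
  exact: (good_polarization k hn hnm hle M_optn D_card D_neq0 D_sep ag).
split.
  rewrite goods; split=> [ag g /(min_gens_rain k hn hnm hle M_optn dual_card)[a aD ->]|h a na].
    rewrite nfE in aD; have := ag a aD; rewrite (goodP hn M_optn (nonfacet_card aD)) => <-.
    exact: (colon_grade k hn hnm hle M_optn D_card D_sep aD).
  apply/(goodP hn M_optn (nonfacet_card na)).
  apply: has_grade_inj (colon_grade k hn hnm hle M_optn D_card D_sep na) _.
  apply/h/(min_gens_rain k hn hnm hle M_optn dual_card); exists a => //.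
  by rewrite nfE.
move=> _; split; rewrite nf0.
  split=> [hp a|]; last exact: (no_nonfacet_power k hn hnm hle M_optn D_card D_neq0 D_sep).
  apply/negP => na.
  have := power_no_nonfacet hn hnm hle M_optn D_card D_neq0 D_sep a (n_gt1 a na) hp.
  by rewrite na.
split=> [nf f|e a].
  rewrite (rainE k hn hnm hle M_optn D_card).
  split.
    apply: (ideal_gen_min (J := in_ideal le (minors_ideal k n m))); first exact: mono_ideal_ideal.
    move=> _ [p [a aD ->] ->]; apply/mono_idealX.
    exists (weight (@cell n m) (M a)); last exact: lepm_refl.
    have ca := D_card a aD; have [g [gi ga eg]] := max_minorE k hn hnm ca.
    exists (max_minor k n a); split.
    - by apply: ideal_gen_in; exists a.
    - have := minor_top k M_optn gi ga ca; rewrite -eg => h.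
      by apply: contraTneq h => ->; rewrite msupp0.
    - by rewrite (in_max_minor k hn hnm hle M_optn ca).
  apply: (ideal_gen_min (J := mono_ideal _)); first exact: mono_ideal_ideal.
  move=> _ [_ [g [Ig g0 ->]] ->]; set p := in_mon le g; apply/mono_idealX.
  case: (pickP (fun a : {set 'I_m} => (#|a| == n) &&
      [forall l, p (enum_rank ((l, M a l) : vars n m)) != 0])) => [a /andP[ca /forallP h]|np].
    exists (weight (@cell n m) (M a)); last exact/wM_le.
    by exists a => //; have := nf a; rewrite /nonfacet ca /= negbK.
  (* No in[a] divides in(g), so the cells absent from in(g) meet all matchings and contain some
     [X_U], against [in_minors_hit]. *)
  pose X := [set e : 'I_n * 'I_m | p (enum_rank (e : vars n m)) == 0].
  have [a ca|U cU /subsetP sU] := full_cover k hn hnm hle M_optn (X := X).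
    have := np a; rewrite ca eqxx /= => /negbT; rewrite negb_forall => /existsP[l].
    by rewrite negbK => hl; exists l; rewrite inE.
  have [c nc] := in_minors_hit hn hnm hle M_optn cU Ig g0.
  by have := sU (rowX hn M U c, c); rewrite !inE /= nc eqxx => /(_ isT) ->.
(* For a non-facet [a], in[a] lies in the initial ideal; divisibility by some in[b] with [b] a facet
   would force [b = a]. *)
apply/negP => na; have ca := nonfacet_card na.
have [g [gi ga eg]] := max_minorE k hn hnm ca.
have : in_ideal le (minors_ideal k n m) 'X_[weight (@cell n m) (M a)].
  apply/mono_idealX; exists (weight (@cell n m) (M a)); last exact: lepm_refl.
  exists (max_minor k n a); split.
  - by apply: ideal_gen_in; exists a.
  - have := minor_top k M_optn gi ga ca; rewrite -eg => h.
    by apply: contraTneq h => ->; rewrite msupp0.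
  - by rewrite (in_max_minor k hn hnm hle M_optn ca).
move/e; rewrite (rainE k hn hnm hle M_optn D_card) => /mono_idealX[_ [b bD ->]].
move/(wM_dvd M_optn (D_card b bD) ca) => eb.
by case/andP: na => _; rewrite -eb bD.
Qed.
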